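(* Let $\mathcal I\subset\mathbb R$ be an open interval and let $\gamma:\mathcal I\times[0,T)\to\mathbb R^2$ be a curve shortening flow with initially radial ends, which is smooth down to $t=0$. Suppose that the swept area of the initial curve has bounds $$\mathcal A_-\le\mathcal A(v,w,0)\le\mathcal A_+$$ for all $v,w\in\mathcal I$ with $v\le w$. Then the Harnack quantity $$\mathcal H(v,w,t):=\mathcal A(v,w,t)-t\,\Psi(v,w,t)$$ satisfies the Harnack inequality $$\mathcal A_-\le\mathcal H(v,w,t)\le\mathcal A_+$$ for all $v,w\in\mathcal I$ with $v<w$ and all $t\in[0,T)$.
   Context: Identify $\mathbb R^2\simeq\mathbb C$. Curve shortening flow: a smooth family of embedded curves $\gamma(\cdot,t)$ satisfies curve shortening flow if $\langle \partial_t\gamma,\nu\rangle=-\kappa$, where $\nu$ is a unit normal to $\gamma(\cdot,t)$ and $\kappa$ the corresponding geodesic curvature, so that the curvature vector is $\vec\kappa=-\kappa\nu$ (tangential motion is allowed). Uniformly proper solution: let $\mathcal I\subset\mathbb R$ be an open interval and $\mathcal J=[0,T)$ or $(0,T)$ with $T\in(0,\infty]$. A map $\gamma:\mathcal I\times\mathcal J\to\mathbb R^2$ is a uniformly proper solution to curve shortening flow if (1) $\gamma$ is continuous; (2) $\gamma$ is smooth on $\mathcal I\times(0,T)$; (3) $\gamma$ is proper on $\mathcal I\times[a,b]$ for any $[a,b]\subset\mathcal J$; (4) for each $t\in\mathcal J$ the curve $\gamma(\cdot,t)$ is embedded; (5) $\gamma$ satisfies the curve shortening flow equation for $t\in(0,T)$.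 ''Smooth down to $t=0$'' means smooth on $\mathcal I\times[0,T)$. Initially radial ends: for $a\in\mathbb R$ let $L_a:=\{re^{ia}: r\ge0\}$. A curve shortening flow with initially radial ends (at angles $a$ and $b$, for some $a,b\in\mathbb R$) is a uniformly proper solution $\gamma:\mathcal I\times[0,T)\to\mathbb R^2$ for which there exist $u_1<u_2$ in $\mathcal I$ such that $\gamma(u,0)\in L_a$ for $u\in\mathcal I\cap(-\infty,u_1)$ and $\gamma(u,0)\in L_b$ for $u\in\mathcal I\cap(u_2,\infty)$. Swept area: for a smooth immersed curve $\gamma:\mathcal I\to\mathbb R^2$ and $v\le w$ in $\mathcal I$, $\mathcal A(v,w):=\frac12\int_v^w *(\gamma_u\wedge\gamma)\,du$, where $*:\Lambda^2\mathbb R^2\to\mathbb R$ is the linear map with $*(e_1\wedge e_2)=1$. Turning function: for a smooth immersed curve $\gamma:\mathcal I\to\mathbb R^2$ with unit tangent $\mathcal T$, choose a continuous tangent angle $\psi:\mathcal I\to\mathbb R$ with $\mathcal T=(\cos\psi,\sin\psi)$ and set $\Psi(v,w):=\psi(w)-\psi(v)$ for $v\le w$ (independent of the choice of $\psi$). For the evolving curve $\gamma(\cdot,t)$ these are written $\mathcal A(v,w,t)$ and $\Psi(v,w,t)$. *)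

(* Defs.v *)
From Stdlib Require Import Reals List ClassicalEpsilon.
From Coquelicot Require Import Coquelicot.
Open Scope R_scope.

Notation plane := (R * R)%type.

Definition Rbar_interval (alpha beta : Rbar) (u : R) : Prop :=
  Rbar_lt alpha u /\ Rbar_lt u beta.

Definition time_interval (T : Rbar) (t : R) : Prop :=
  0 <= t /\ Rbar_lt t T.

Definition product_set (A B : R -> Prop) (p : R * R) : Prop :=
  A (fst p) /\ B (snd p).

Definition compact_set {X : UniformSpace} (K : X -> Prop) : Prop :=
  forall F : (X -> Prop) -> Prop,
    (forall U, F U -> open U) ->
    (forall x, K x -> exists U, F U /\ U x) ->
    exists l : list (X -> Prop),
      (forall U, In U l -> F U) /\
      (forall x, K x -> exists U, In U l /\ U x).

Definition proper_on {X Y : UniformSpace} (D : X -> Prop) (f : X -> Y) : Prop :=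
  forall K : Y -> Prop,
    compact_set K -> compact_set (fun x => D x /\ K (f x)).

(** Smoothness of a function of two real variables on an arbitrary set [D]:
    near each point of [D] it agrees on [D] with a C^oo function defined on a
    full neighbourhood.  This is ordinary smoothness when [D] is open, and
    smoothness up to the boundary for [I x [0,T)]. *)

Definition smooth_on (D : R * R -> Prop) (f : R -> R -> R) : Prop :=
  forall u t, D (u, t) ->
    exists F : R -> R -> R,
      locally_2d (fun x s => forall n : nat, ex_diff_n F n x s) u t /\
      locally_2d (fun x s => D (x, s) -> f x s = F x s) u t.

Definition smooth_map_on (D : R * R -> Prop) (gamma : R -> R -> plane) : Prop :=
  smooth_on D (fun u t => fst (gamma u t)) /\
  smooth_on D (fun u t => snd (gamma u t)).

Definition dot (p q : plane) : R := fst p * fst q + snd p * snd q.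

Definition enorm (p : plane) : R := sqrt (dot p p).

(** [*(p /\ q)], normalised by [*(e_1 /\ e_2) = 1]. *)
Definition star_wedge (p q : plane) : R := fst p * snd q - snd p * fst q.

Definition velocity (c : R -> plane) (u : R) : plane :=
  (Derive (fun s => fst (c s)) u, Derive (fun s => snd (c s)) u).

Definition speed (c : R -> plane) (u : R) : R := enorm (velocity c u).

Definition unit_tangent (c : R -> plane) (u : R) : plane :=
  (fst (velocity c u) / speed c u, snd (velocity c u) / speed c u).

(** The unit tangent rotated by a quarter turn.  The curve shortening flow
    equation below is invariant under changing the sign of the normal. *)
Definition unit_normal (c : R -> plane) (u : R) : plane :=
  (- snd (unit_tangent c u), fst (unit_tangent c u)).

(** Derivative of the unit tangent with respect to arc length. *)
Definition curvature_vector (c : R -> plane) (u : R) : plane :=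
  (fst (velocity (unit_tangent c) u) / speed c u,
   snd (velocity (unit_tangent c) u) / speed c u).

(** Sign convention: [curvature_vector = - curvature * unit_normal]. *)
Definition curvature (c : R -> plane) (u : R) : R :=
  - dot (curvature_vector c u) (unit_normal c u).

Definition immersed (I : R -> Prop) (c : R -> plane) : Prop :=
  forall u, I u -> velocity c u <> (0, 0).

Definition topologically_embedded (I : R -> Prop) (c : R -> plane) : Prop :=
  continuous_on I c /\
  (forall u v, I u -> I v -> c u = c v -> u = v) /\
  (forall u, I u -> forall eps : posreal, exists delta : posreal,
     forall v, I v -> ball (c u) delta (c v) -> ball u eps v).

(** The time interval [J] is meant to be [[0,T)] or
    [(0,T)], so that [(0,T)] is the set of positive elements of [J]. *)

Definition positive_part (J : R -> Prop) (t : R) : Prop := J t /\ 0 < t.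

Definition csf_equation (gamma : R -> R -> plane) (u t : R) : Prop :=
  dot (velocity (fun s => gamma u s) t) (unit_normal (fun x => gamma x t) u)
  = - curvature (fun x => gamma x t) u.

(** The curves at positive times are smooth, so that being embedded includes
    being immersed; at time [0] the curve is in general only continuous. *)
Record uniformly_proper_solution (I J : R -> Prop) (gamma : R -> R -> plane)
  : Prop := {
  ups_continuous :
    continuous_on (product_set I J) (fun p : R * R => gamma (fst p) (snd p));
  ups_smooth : smooth_map_on (product_set I (positive_part J)) gamma;
  ups_proper : forall a b, a <= b -> (forall t, a <= t <= b -> J t) ->
    proper_on (product_set I (fun t => a <= t <= b))
      (fun p : R * R => gamma (fst p) (snd p));
  ups_embedded : forall t, J t ->
    topologically_embedded I (fun u => gamma u t);
  ups_immersed : forall t, positive_part J t ->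
    immersed I (fun u => gamma u t);
  ups_flow : forall u t, I u -> positive_part J t -> csf_equation gamma u t
}.

Definition ray (a : R) (p : plane) : Prop :=
  exists r, 0 <= r /\ p = (r * cos a, r * sin a).

Definition csf_initially_radial_ends (I : R -> Prop) (T : Rbar)
    (gamma : R -> R -> plane) : Prop :=
  uniformly_proper_solution I (time_interval T) gamma /\
  exists a b u1 u2 : R,
    I u1 /\ I u2 /\ u1 < u2 /\
    (forall u, I u -> u < u1 -> ray a (gamma u 0)) /\
    (forall u, I u -> u2 < u -> ray b (gamma u 0)).

(** Smoothness on [I x [0,T)], with the initial curve embedded as a smooth
    curve, i.e. immersed too (its injectivity is already part of being a
    uniformly proper solution); its swept area and turning function presuppose
    this. *)
Definition smooth_down_to_0 (I : R -> Prop) (T : Rbar)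
    (gamma : R -> R -> plane) : Prop :=
  smooth_map_on (product_set I (time_interval T)) gamma /\
  immersed I (fun u => gamma u 0).

Definition swept_area (c : R -> plane) (v w : R) : R :=
  1 / 2 * RInt (fun u => star_wedge (velocity c u) (c u)) v w.

Definition is_tangent_angle (I : R -> Prop) (c : R -> plane) (psi : R -> R)
  : Prop :=
  continuous_on I psi /\
  forall u, I u -> unit_tangent c u = (cos (psi u), sin (psi u)).

(** A chosen tangent angle; a smooth immersed curve on an interval has one,
    unique up to an additive constant in [2 pi Z]. *)
Definition tangent_angle (I : R -> Prop) (c : R -> plane) : R -> R :=
  epsilon (inhabits (fun _ : R => 0)) (is_tangent_angle I c).

Definition turning (I : R -> Prop) (c : R -> plane) (v w : R) : R :=
  tangent_angle I c w - tangent_angle I c v.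

Definition harnack (I : R -> Prop) (gamma : R -> R -> plane) (v w t : R) : R :=
  swept_area (fun u => gamma u t) v w - t * turning I (fun u => gamma u t) v w.

(* Main.v *)
Require Import Defs.
From Stdlib Require Import Reals Lra Psatz List Classical ClassicalEpsilon.
From Coquelicot Require Import Coquelicot.
Open Scope R_scope.

(** Write [gamma = (x, y)].  Since tangential motion is allowed, the flow is
    [gamma_t = a gamma_uu + b gamma_u] with [a = 1 / |gamma_u| ^ 2] and some
    drift [b].  Each coordinate satisfies this linear equation, and
    [r ^ 2 = x ^ 2 + y ^ 2] satisfies it with source [-2].

    The Harnack quantity is a difference [H (v, w, t) = h (w, t) - h (v, t)],
    where [h (u, t)] integrates from a fixed point to [u] the density
    [1/2 *(gamma_u /\ gamma) - t psi_u], with [psi] the tangent angle.  The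
    swept area grows at the rate at which the curve turns, up to boundary
    terms, and the factor [t] in front of [psi_u] is chosen to cancel exactly
    this: the time derivative of the density is a derivative in [u]
    ([harnack_density_conservation]).  As a result [h] satisfies the same
    linear equation up to a source depending on time alone
    ([potential_evolves]), which cancels in the difference.  So [H] satisfies
    the heat equation in the two variables [v < w].  It vanishes for [v = w],
    where the bounds hold because the empty arc sweeps out no area, and it
    satisfies them at time [0] by assumption; the maximum principle gives the
    theorem ([two_point_maximum_principle]).

    The domain is not compact, so the maximum principle is applied after
    subtracting a small multiple of [r (v) ^ 2 + r (w) ^ 2 + 5 t], which is
    proper.  This requires [h ^ 2 <= C (1 + r ^ 2)] ([potential_growth]), and
    here the initially radial ends enter.  Let [X] and [Y] be the coordinates
    along and across the initial ray of an end, where at time [0] one has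
    [Y = 0] and [X] is monotone.  The maximum principle with the same penalty
    bounds [|Y|] on the end ([end_coordinate_bound]), and a comparison of the
    values of [X] at two points shows that far out [X] remains monotone along
    the curve ([end_monotone]).  The tangent of a monotone arc stays in a half
    plane, so the arc turns by at most [PI] ([angle_variation_le_PI]), and with
    [|Y|] bounded the area that it sweeps out grows at most linearly in [r]
    ([monotone_arc_area]). *)

(** * Compactness *)

Definition set_ideal {X : Type} (P : (X -> Prop) -> Prop) : Prop :=
  P (fun _ => False) /\
  (forall S S' : X -> Prop, (forall x, S x -> S' x) -> P S' -> P S) /\
  (forall S S' : X -> Prop, P S -> P S' -> P (fun x => S x \/ S' x)).

(** The open cover property as an induction principle: what holds near each
    point of a compact set, and passes to subsets and finite unions, holds for
    the whole set.  The converse below makes it usable for proving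
    compactness. *)
Lemma compact_induction {X : UniformSpace} (K : X -> Prop)
    (P : (X -> Prop) -> Prop) :
  compact_set K -> set_ideal P ->
  (forall x, K x -> exists S, locally x S /\ P S) -> P K.
Proof.
  intros HK [P0 [Psub Pun]] Hloc.
  destruct (HK (fun U => open U /\ P U)) as [l [HlF Hlc]].
  - intros U HU; exact (proj1 HU).
  - intros x Kx; destruct (Hloc x Kx) as [S [HS PS]].
    exists (fun y => locally y S); repeat split.
    + intros y Hy; apply locally_locally; exact Hy.
    + apply Psub with S; [intros y Hy; exact (locally_singleton _ _ Hy) | exact PS].
    + exact HS.
  - assert (Hfold : P (fun x => exists U, In U l /\ U x)).
    { clear Hlc; induction l as [|U l IH].
      - apply Psub with (2 := P0); intros x [U [[] _]].
      - assert (IH' := IH (fun V HV => HlF V (or_intror HV))).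
        apply Psub with (2 := Pun _ _ (proj2 (HlF U (or_introl eq_refl))) IH').
        intros x [V [[<-|HV] Vx]]; [left; exact Vx | right; exists V; tauto]. }
    apply Psub with (2 := Hfold); exact Hlc.
Qed.

Lemma compact_of_induction {X : UniformSpace} (K : X -> Prop) :
  (forall P, set_ideal P ->
     (forall x, K x -> exists S, locally x S /\ P S) -> P K) ->
  compact_set K.
Proof.
  intros H F Fo Fc.
  apply (H (fun S => exists l : list (X -> Prop), (forall U, In U l -> F U) /\
      (forall x, S x -> exists U, In U l /\ U x))).
  - repeat split.
    + exists nil; split; [intros U []| intros x []].
    + intros S S' HS [l [H1 H2]]; exists l; split; [exact H1 | auto].
    + intros S S' [l [H1 H2]] [l' [H1' H2']]; exists (l ++ l'); split.
      * intros U HU; apply in_app_or in HU; destruct HU; auto.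
      * intros x [Sx|Sx].
        -- destruct (H2 x Sx) as [U [HU Ux]]; exists U; split; [|exact Ux].
           apply in_or_app; now left.
        -- destruct (H2' x Sx) as [U [HU Ux]]; exists U; split; [|exact Ux].
           apply in_or_app; now right.
  - intros x Kx; destruct (Fc x Kx) as [U [FU Ux]]; exists U; split.
    + exact (Fo U FU x Ux).
    + exists (U :: nil); split.
      * intros V [<-|[]]; exact FU.
      * intros y Uy; exists U; split; [now left | exact Uy].
Qed.

Lemma compact_segment (a b : R) :
  compact_set (X := R_UniformSpace) (fun x => a <= x <= b).
Proof.
  apply compact_of_induction; intros P [P0 [Psub Pun]] Hloc.
  destruct (Rle_or_lt a b) as [Hab|Hab].
  2:{ apply Psub with (2 := P0); intros x Hx; lra. }
  set (E := fun x => a <= x <= b /\ P (fun y => a <= y <= x)).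
  assert (HEa : E a).
  { split; [lra|].
    destruct (Hloc a ltac:(lra)) as [S [HS PS]].
    apply Psub with (2 := PS); intros y Hy; replace y with a by lra.
    exact (locally_singleton _ _ HS). }
  destruct (completeness E) as [s [Hub Hlub]].
  - exists b; intros x [Hx _]; lra.
  - exists a; exact HEa.
  - assert (Has : a <= s) by exact (Hub a HEa).
    assert (Hsb : s <= b) by (apply Hlub; intros x [Hx _]; lra).
    destruct (Hloc s ltac:(lra)) as [S [[d Hd] PS]].
    assert (Hx : exists x, E x /\ s - d < x).
    { apply NNPP; intros Hn.
      assert (s <= s - d); [apply Hlub; intros x Ex | pose proof (cond_pos d); lra].
      apply Rnot_lt_le; intros Hlt; apply Hn; exists x; tauto. }
    destruct Hx as [x [[Hx Px] Hsx]].
    assert (Hreach : forall z, a <= z <= b -> z < s + d -> E z).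
    { intros z Hz Hzs; split; [exact Hz|].
      apply Psub with (2 := Pun _ _ Px PS); intros y Hy.
      destruct (Rle_or_lt y x) as [Hyx|Hyx]; [left; lra | right].
      apply Hd; change (Rabs (y - s) < d); apply Rabs_def1; lra. }
    pose proof (cond_pos d) as Hdpos.
    destruct (Req_dec s b) as [->|Hne].
    + exact (proj2 (Hreach b ltac:(lra) ltac:(lra))).
    + set (z := Rmin b (s + d / 2)).
      assert (Hz : s < z /\ z <= b /\ z < s + d).
      { unfold z, Rmin; destruct (Rle_dec b (s + d / 2)); lra. }
      assert (Hzs := Hub z (Hreach z ltac:(lra) ltac:(lra))); lra.
Qed.

(** Two nested inductions: over [A] for strips [S x B], and at a fixed point of
    [A] over [B] for boxes. *)
Lemma compact_product {X Y : UniformSpace} (A : X -> Prop) (B : Y -> Prop) :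
  compact_set A -> compact_set B ->
  compact_set (X := prod_UniformSpace X Y) (fun p => A (fst p) /\ B (snd p)).
Proof.
  intros HA HB; apply compact_of_induction; intros P [P0 [Psub Pun]] Hloc.
  apply (compact_induction A
           (fun S => P (fun p => S (fst p) /\ B (snd p)))); [exact HA | |].
  - repeat split.
    + apply Psub with (2 := P0); intros p [[] _].
    + intros S S' HS PS; apply Psub with (2 := PS); intros p [H1 H2]; auto.
    + intros S S' PS PS'; apply Psub with (2 := Pun _ _ PS PS'); tauto.
  - intros x Ax.
    apply (compact_induction B (fun W => exists S, locally x S /\
             P (fun p => S (fst p) /\ W (snd p)))); [exact HB | |].
    + repeat split.
      * exists (fun _ => True); split; [apply filter_true|].
        apply Psub with (2 := P0); intros p [_ []].
      * intros W W' HW [S [HS PS]]; exists S; split; [exact HS|].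
        apply Psub with (2 := PS); intros p [H1 H2]; auto.
      * intros W W' [S [HS PS]] [S' [HS' PS']].
        exists (fun z => S z /\ S' z); split; [now apply filter_and|].
        apply Psub with (2 := Pun _ _ PS PS'); tauto.
    + intros y By; destruct (Hloc (x, y) (conj Ax By)) as [S [[d Hd] PS]].
      exists (ball y d); split; [now exists d|].
      exists (ball x d); split; [now exists d|].
      apply Psub with (2 := PS); intros p [H1 H2]; apply Hd; split; assumption.
Qed.

Lemma compact_closed_subset {X : UniformSpace} (K C : X -> Prop) :
  compact_set K -> open (fun x => ~ C x) -> compact_set (fun x => K x /\ C x).
Proof.
  intros HK HC; apply compact_of_induction; intros P [P0 [Psub Pun]] Hloc.
  assert (H : P (fun x => K x /\ (K x /\ C x))).
  { apply (compact_induction K (fun S => P (fun x => S x /\ (K x /\ C x))));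
      [exact HK | |].
    - repeat split.
      + apply Psub with (2 := P0); tauto.
      + intros S S' HS PS; apply Psub with (2 := PS); intros x [H1 H2]; auto.
      + intros S S' PS PS'; apply Psub with (2 := Pun _ _ PS PS'); tauto.
    - intros x Kx; destruct (classic (C x)) as [Cx|nCx].
      + destruct (Hloc x (conj Kx Cx)) as [S [HS PS]]; exists S; split; [exact HS|].
        apply Psub with (2 := PS); tauto.
      + exists (fun y => ~ C y); split; [exact (HC x nCx)|].
        apply Psub with (2 := P0); tauto. }
  apply Psub with (2 := H); tauto.
Qed.

Lemma compact_triangle (a b t1 : R) :
  compact_set (fun p : R * (R * R) => ((a <= fst p <= b) /\
     ((a <= fst (snd p) <= b) /\ (0 <= snd (snd p) <= t1))) /\
     fst p <= fst (snd p)).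
Proof.
  apply (compact_closed_subset
    (X := prod_UniformSpace R_UniformSpace (prod_UniformSpace R_UniformSpace R_UniformSpace))).
  - exact (compact_product _ _ (compact_segment a b)
      (compact_product _ _ (compact_segment a b) (compact_segment 0 t1))).
  - intros [v [w t]] Hvw; simpl in Hvw.
    exists (mkposreal ((v - w) / 2) ltac:(lra)); intros [v' [w' t']] [H1 [H2 _]].
    change (Rabs (v' - v) < (v - w) / 2) in H1.
    change (Rabs (w' - w) < (v - w) / 2) in H2.
    apply Rabs_def2 in H1; apply Rabs_def2 in H2; simpl; lra.
Qed.

Lemma compact_attains_max {X : UniformSpace} (K : X -> Prop) (f : X -> R) :
  compact_set K -> (exists x, K x) -> (forall x, K x -> continuous f x) ->
  exists x, K x /\ forall y, K y -> f y <= f x.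
Proof.
  intros HK [x0 Kx0] Hf.
  assert (Hideal : forall B : R -> Prop, (exists b, B b) ->
     (forall b c, B b -> B c -> B (Rmax b c)) ->
     set_ideal (fun S => exists b, B b /\ forall y, K y -> S y -> f y <= b)).
  { intros B [b0 Bb0] HB; repeat split.
    - exists b0; split; [exact Bb0 | intros y _ []].
    - intros S S' HS [b [Bb Hb]]; exists b; split; [exact Bb | auto].
    - intros S S' [b [Bb Hb]] [c [Bc Hc]]; exists (Rmax b c); split; [auto|].
      intros y Ky [Sy|Sy].
      + apply Rle_trans with b; [auto | apply Rmax_l].
      + apply Rle_trans with c; [auto | apply Rmax_r]. }
  assert (Hnear : forall x (e : R), 0 < e -> K x -> locally x (fun y => f y < f x + e)).
  { intros x e He Kx.
    generalize (Hf x Kx (fun z => z < f x + e)); intros H; apply H.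
    exists (mkposreal e He); intros z Hz.
    change (Rabs (z - f x) < e) in Hz; apply Rabs_def2 in Hz; lra. }
  destruct (compact_induction K _ HK (Hideal (fun _ => True) (ex_intro _ 0 I)
              (fun _ _ _ _ => I))) as [B [_ HB]].
  { intros x Kx; exists (fun y => f y < f x + 1); split; [apply Hnear; [lra | exact Kx]|].
    exists (f x + 1); split; [exact I | intros y _ Hy; lra]. }
  destruct (completeness (fun r => exists x, K x /\ r = f x)) as [M [Mub Mlub]].
  { exists B; intros r [x [Kx ->]]; exact (HB x Kx Kx). }
  { exists (f x0), x0; tauto. }
  apply NNPP; intros Hno.
  assert (Hlt : forall x, K x -> f x < M).
  { intros x Kx; apply Rnot_le_lt; intros Hle; apply Hno; exists x; split; [exact Kx|].
    intros y Ky; apply Rle_trans with M; [apply Mub; exists y; tauto | exact Hle]. }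
  assert (HM : exists b, b < M) by (exists (M - 1); lra).
  destruct (compact_induction K _ HK (Hideal (fun b => b < M)
      HM (fun b c Hb Hc => Rmax_lub_lt b c M Hb Hc)))
    as [b [HbM Hb]].
  { intros x Kx; pose proof (Hlt x Kx) as Hx.
    exists (fun y => f y < f x + (M - f x) / 2); split; [apply Hnear; [lra | exact Kx]|].
    exists (f x + (M - f x) / 2); split; [lra | intros y _ Hy; lra]. }
  apply (Rlt_not_le _ _ HbM), Mlub; intros r [x [Kx ->]]; exact (Hb x Kx Kx).
Qed.

(** * Continuity *)

(* [ring] needs equality at the type [R] itself, not at a structure on it. *)
Ltac ring_R := match goal with |- ?l = ?r => change (@eq R l r); ring end.

Definition continuous_2 (f : R -> R -> R) (u t : R) : Prop :=
  continuous (fun p : R * R => f (fst p) (snd p)) (u, t).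

Lemma continuous_2_comp {U : UniformSpace} (f : R -> R -> R) (g h : U -> R) (x : U) :
  continuous_2 f (g x) (h x) -> continuous g x -> continuous h x ->
  continuous (fun y => f (g y) (h y)) x.
Proof. intros Hf Hg Hh; exact (continuous_comp_2 g h f x Hg Hh Hf). Qed.

Lemma continuous_2_l (f : R -> R -> R) (u t : R) :
  continuous_2 f u t -> continuous (fun z => f z t) u.
Proof.
  intros H; apply (continuous_2_comp f (fun z => z) (fun _ => t)).
  - exact H.
  - apply continuous_id.
  - apply continuous_const.
Qed.

Lemma continuous_2_r (f : R -> R -> R) (u t : R) :
  continuous_2 f u t -> continuous (fun s => f u s) t.
Proof.
  intros H; apply (continuous_2_comp f (fun _ => u) (fun s => s)).
  - exact H.
  - apply continuous_const.
  - apply continuous_id.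
Qed.

Lemma continuous_lin {U : UniformSpace} (c d : R) (f g : U -> R) (x : U) :
  continuous f x -> continuous g x -> continuous (fun y => c * f y + d * g y) x.
Proof.
  intros Hf Hg.
  apply (continuous_plus (fun y => c * f y) (fun y => d * g y)).
  - exact (continuous_scal_r c f x Hf).
  - exact (continuous_scal_r d g x Hg).
Qed.

Lemma continuous_sq_sum {U : UniformSpace} (f g : U -> R) (x : U) :
  continuous f x -> continuous g x -> continuous (fun y => f y ^ 2 + g y ^ 2) x.
Proof.
  intros Hf Hg.
  apply (continuous_ext (fun y => f y * f y + g y * g y)); [intros y; ring_R|].
  apply (continuous_plus (fun y => f y * f y) (fun y => g y * g y)).
  - exact (continuous_mult f f x Hf Hf).
  - exact (continuous_mult g g x Hg Hg).
Qed.

Lemma continuous_Rmax {U : UniformSpace} (c : R) (f : U -> R) (x : U) :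
  continuous f x -> continuous (fun y => Rmax (f y) c) x.
Proof.
  intros Hf; apply (continuous_comp f (fun z => Rmax z c)); [exact Hf|].
  intros P [e He]; exists e; intros y Hy; apply He.
  change (Rabs (y - f x) < e) in Hy; change (Rabs (Rmax y c - Rmax (f x) c) < e).
  apply Rle_lt_trans with (2 := Hy).
  unfold Rmax, Rabs; destruct (Rle_dec y c), (Rle_dec (f x) c);
    repeat destruct (Rcase_abs _); lra.
Qed.

(** The next three lemmas serve functions of [(v, (w, t))], two points of the
    curve at the same time. *)
Lemma continuous_time (v w t : R) :
  continuous (fun p : R * (R * R) => snd (snd p)) (v, (w, t)).
Proof.
  apply (continuous_comp (fun p : R * (R * R) => snd p) snd); apply continuous_snd.
Qed.

Lemma continuous_2_first (f : R -> R -> R) (v w t : R) :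
  continuous_2 f v t ->
  continuous (fun p : R * (R * R) => f (fst p) (snd (snd p))) (v, (w, t)).
Proof.
  intros Hf; apply (continuous_2_comp f (fun p : R * (R * R) => fst p)
    (fun p : R * (R * R) => snd (snd p)) (v, (w, t)) Hf).
  - apply continuous_fst.
  - apply continuous_time.
Qed.

Lemma continuous_2_second (f : R -> R -> R) (v w t : R) :
  continuous_2 f w t ->
  continuous (fun p : R * (R * R) => f (fst (snd p)) (snd (snd p))) (v, (w, t)).
Proof.
  intros Hf; apply (continuous_2_comp f (fun p : R * (R * R) => fst (snd p))
    (fun p : R * (R * R) => snd (snd p)) (v, (w, t)) Hf).
  - apply (continuous_comp (fun p : R * (R * R) => snd p) fst);
      [apply continuous_snd | apply continuous_fst].
  - apply continuous_time.
Qed.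

Lemma cont_plus {U : UniformSpace} (f g : U -> R) (x : U) :
  continuous f x -> continuous g x -> continuous (fun y => f y + g y) x.
Proof. exact (continuous_plus (V := R_NormedModule) f g x). Qed.

Lemma cont_minus {U : UniformSpace} (f g : U -> R) (x : U) :
  continuous f x -> continuous g x -> continuous (fun y => f y - g y) x.
Proof. exact (continuous_minus (V := R_NormedModule) f g x). Qed.

Lemma cont_mult {U : UniformSpace} (f g : U -> R) (x : U) :
  continuous f x -> continuous g x -> continuous (fun y => f y * g y) x.
Proof. exact (continuous_mult (K := R_AbsRing) f g x). Qed.

Lemma cont_inv {U : UniformSpace} (f : U -> R) (x : U) :
  continuous f x -> f x <> 0 -> continuous (fun y => / f y) x.
Proof.
  intros Hf H; apply (continuous_comp f Rinv); [exact Hf | now apply continuous_Rinv].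
Qed.

Ltac cont_ring :=
  try assumption;
  lazymatch goal with
  | |- continuous (fun y => @?f y ^ 2 + @?g y ^ 2) _ => apply continuous_sq_sum
  | |- continuous (fun y => _ + _) _ => apply cont_plus
  | |- continuous (fun y => _ - _) _ => apply cont_minus
  | |- continuous (fun y => _ * _) _ => apply cont_mult
  | |- continuous (fun y => ?c) _ => apply continuous_const
  end.

(** * Evolution equations along the flow *)

(** The drift [b] is the tangential part of a parametrization, and [q] a source;
    [a], [b] and [q] are the values of the coefficients at [(u, t)]. *)
Definition evolves (a b q : R) (f : R -> R -> R) (u t : R) : Prop :=
  exists (fu : R -> R) (fuu ft : R),
    locally u (fun z => is_derive (fun y => f y t) z (fu z)) /\
    is_derive fu u fuu /\
    is_derive (fun s => f u s) t ft /\
    ft = a * fuu + b * fu u + q.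

Lemma is_derive_slope (g : R -> R) (x l e : R) :
  is_derive g x l -> 0 < e ->
  exists d, 0 < d /\ forall y, Rabs (y - x) < d ->
    Rabs (g y - g x - l * (y - x)) <= e * Rabs (y - x).
Proof.
  intros H He; apply is_derive_Reals in H.
  destruct (H e He) as [d Hd]; exists d; split; [apply cond_pos|].
  intros y Hy; destruct (Req_dec y x) as [->|Hne].
  - replace (g x - g x - l * (x - x)) with 0 by ring.
    rewrite Rabs_R0; apply Rmult_le_pos; [lra | apply Rabs_pos].
  - generalize (Hd (y - x) ltac:(lra) Hy); replace (x + (y - x)) with y by ring.
    intros H1.
    replace (g y - g x - l * (y - x)) with (((g y - g x) / (y - x) - l) * (y - x))
      by (field; lra).
    rewrite Rabs_mult; apply Rmult_le_compat_r; [apply Rabs_pos | lra].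
Qed.

Lemma slope_above (g : R -> R) (x l m : R) :
  is_derive g x l -> m < l ->
  exists d, 0 < d /\
    (forall y, x - d < y < x -> g y < g x - m * (x - y)) /\
    (forall y, x < y < x + d -> g x + m * (y - x) < g y).
Proof.
  intros H Hm; destruct (is_derive_slope g x l ((l - m) / 2) H ltac:(lra))
    as [d [Hd Hs]].
  exists d; repeat split; [exact Hd | |]; intros y Hy.
  - assert (H1 : Rabs (y - x) < d) by (apply Rabs_def1; lra).
    generalize (Hs y H1); rewrite (Rabs_left (y - x)) by lra.
    intros H2; apply Rabs_le_between in H2; nra.
  - assert (H1 : Rabs (y - x) < d) by (apply Rabs_def1; lra).
    generalize (Hs y H1); rewrite (Rabs_pos_eq (y - x)) by lra.
    intros H2; apply Rabs_le_between in H2; nra.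
Qed.

Lemma slope_below (g : R -> R) (x l m : R) :
  is_derive g x l -> l < m ->
  exists d, 0 < d /\
    (forall y, x - d < y < x -> g x - m * (x - y) < g y) /\
    (forall y, x < y < x + d -> g y < g x + m * (y - x)).
Proof.
  intros H Hm.
  destruct (slope_above (fun y => - g y) x (- l) (- m)) as [d [Hd [H1 H2]]];
    [exact (is_derive_opp g x l H) | lra |].
  exists d; repeat split; [exact Hd | |]; intros y Hy.
  - generalize (H1 y Hy); lra.
  - generalize (H2 y Hy); lra.
Qed.

Lemma local_max_derivatives (g g' : R -> R) (x l : R) :
  locally x (fun z => is_derive g z (g' z)) -> is_derive g' x l ->
  locally x (fun z => g z <= g x) -> g' x = 0 /\ l <= 0.
Proof.
  intros [[d1 Hd1] H1] Hl [[d2 Hd2] H2]; simpl in H1, H2.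
  assert (Hg' : forall z, Rabs (z - x) < d1 -> is_derive g z (g' z)) by exact H1.
  assert (Hmax : forall z, Rabs (z - x) < d2 -> g z <= g x) by exact H2.
  assert (H0 : is_derive g x (g' x))
    by (apply Hg'; rewrite Rminus_diag, Rabs_R0; exact Hd1).
  assert (Hzero : g' x = 0).
  { destruct (Rtotal_order (g' x) 0) as [Hlt|[Heq|Hgt]]; [exfalso|exact Heq|exfalso].
    - destruct (slope_below g x _ 0 H0 Hlt) as [d [Hd [HL _]]].
      set (m := Rmin d d2 / 2).
      assert (Hm : 0 < m /\ m < d /\ m < d2)
        by (unfold m, Rmin; destruct (Rle_dec d d2); lra).
      generalize (HL (x - m) ltac:(lra)), (Hmax (x - m) ltac:(apply Rabs_def1; lra)); lra.
    - destruct (slope_above g x _ 0 H0 Hgt) as [d [Hd [_ HR]]].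
      set (m := Rmin d d2 / 2).
      assert (Hm : 0 < m /\ m < d /\ m < d2)
        by (unfold m, Rmin; destruct (Rle_dec d d2); lra).
      generalize (HR (x + m) ltac:(lra)), (Hmax (x + m) ltac:(apply Rabs_def1; lra)); lra. }
  split; [exact Hzero|]; apply Rnot_lt_le; intros Hpos.
  destruct (slope_above g' x l 0 Hl Hpos) as [d [Hd [_ HR]]].
  set (m := Rmin d (Rmin d1 d2) / 2).
  assert (Hm : 0 < m /\ m < d /\ m < d2 /\ m < d1).
  { unfold m, Rmin; destruct (Rle_dec d1 d2); destruct (Rle_dec d _); lra. }
  destruct (MVT_cor2 g g' x (x + m)) as [c [Heq Hc]]; [lra | |].
  - intros z Hz; apply is_derive_Reals, Hg', Rabs_def1; lra.
  - generalize (Hmax (x + m) ltac:(apply Rabs_def1; lra)), (HR c ltac:(lra)); nra.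
Qed.

(** At a spatial maximum the first order term drops out and the second order
    term has a sign, so only the source can make the value grow. *)
Lemma evolves_at_max (a b q : R) (f : R -> R -> R) (u t : R) :
  0 <= a -> evolves a b q f u t -> locally u (fun z => f z t <= f u t) ->
  exists ft, is_derive (fun s => f u s) t ft /\ ft <= q.
Proof.
  intros Ha (fu & fuu & ft & H1 & H2 & H3 & ->) Hmax.
  exists (a * fuu + b * fu u + q); split; [exact H3|].
  destruct (local_max_derivatives _ _ _ _ H1 H2 Hmax) as [-> Hle]; nra.
Qed.

Lemma evolves_comb (a b q r c d : R) (f g : R -> R -> R) (u t : R) :
  evolves a b q f u t -> evolves a b r g u t ->
  evolves a b (c * q + d * r) (fun z s => c * f z s + d * g z s) u t.
Proof.
  intros (fu & fuu & ft & F1 & F2 & F3 & F4) (gu & guu & gt & G1 & G2 & G3 & G4).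
  assert (Hd : forall (p1 p2 : R -> R) x l1 l2, is_derive p1 x l1 ->
     is_derive p2 x l2 ->
     is_derive (fun z => c * p1 z + d * p2 z) x (c * l1 + d * l2)).
  { intros p1 p2 x l1 l2 H1 H2; exact (is_derive_plus _ _ _ _ _
      (is_derive_scal p1 x c l1 H1) (is_derive_scal p2 x d l2 H2)). }
  exists (fun z => c * fu z + d * gu z), (c * fuu + d * guu), (c * ft + d * gt).
  split; [|split; [|split]]; [| now apply Hd | now apply Hd | rewrite F4, G4; ring].
  apply (filter_imp (fun z => is_derive (fun y => f y t) z (fu z) /\
                              is_derive (fun y => g y t) z (gu z))).
  - intros z [H1 H2]; exact (Hd (fun y => f y t) (fun y => g y t) _ _ _ H1 H2).
  - now apply filter_and.
Qed.

Lemma evolves_time (a b c u t : R) : evolves a b c (fun _ s => c * s) u t.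
Proof.
  exists (fun _ => 0), 0, c; split; [|split; [|split]].
  - apply filter_forall; intros z; exact (is_derive_const (c * t) z).
  - exact (is_derive_const 0 u).
  - generalize (is_derive_scal (fun s => s) t c 1 (is_derive_id t)).
    rewrite Rmult_1_r; trivial.
  - ring.
Qed.

Lemma evolves_ext_loc (a b q : R) (f g : R -> R -> R) (u t : R) :
  locally_2d (fun z s => f z s = g z s) u t ->
  evolves a b q f u t -> evolves a b q g u t.
Proof.
  intros [[d Hd] H] (fu & fuu & ft & F1 & F2 & F3 & F4).
  exists fu, fuu, ft; split; [|split; [|split]]; [| exact F2 | | exact F4].
  - assert (Hloc : locally u (fun z => locally z (fun y => f y t = g y t))).
    { apply locally_locally; exists (mkposreal d Hd); intros y Hy.
      apply H; [exact Hy | rewrite Rminus_diag, Rabs_R0; exact Hd]. }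
    generalize (filter_and _ _ F1 Hloc); apply filter_imp; intros z [H1 H2].
    exact (is_derive_ext_loc _ _ _ _ H2 H1).
  - apply is_derive_ext_loc with (2 := F3); exists (mkposreal d Hd); intros s Hs.
    apply H; [rewrite Rminus_diag, Rabs_R0; exact Hd | exact Hs].
Qed.

Lemma evolves_scal (a b q c : R) (f : R -> R -> R) (u t : R) :
  evolves a b q f u t -> evolves a b (c * q) (fun z s => c * f z s) u t.
Proof.
  intros H; replace (c * q) with (c * q + 0 * q) by ring.
  apply evolves_ext_loc with (2 := evolves_comb a b q q c 0 f f u t H H).
  exists (mkposreal 1 Rlt_0_1); intros z s _ _; ring.
Qed.

Lemma is_derive_reflect (g : R -> R) (x l : R) :
  is_derive g (- x) l -> is_derive (fun z => g (- z)) x (- l).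
Proof.
  intros H; replace (- l) with (scal (-1) l) by (unfold scal; simpl; unfold mult; simpl; ring).
  apply (is_derive_comp g Ropp); [exact H|].
  exact (is_derive_opp (fun z => z) x 1 (is_derive_id x)).
Qed.

Lemma evolves_reflect (a b q : R) (f : R -> R -> R) (u t : R) :
  evolves a b q f (- u) t -> evolves a (- b) q (fun z s => f (- z) s) u t.
Proof.
  intros (fu & fuu & ft & F1 & F2 & F3 & F4).
  exists (fun z => - fu (- z)), fuu, ft.
  split; [|split; [|split]]; [| | exact F3 | rewrite F4; ring].
  - assert (Hc : filterlim Ropp (locally u) (locally (- u)))
      by exact (continuous_opp (fun z => z) u (continuous_id u)).
    assert (F1' := Hc _ F1); unfold filtermap in F1'.
    apply filter_imp with (2 := F1'); intros z Hz.
    exact (is_derive_reflect (fun y => f y t) z _ Hz).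
  - replace fuu with (- - fuu) by ring.
    exact (is_derive_opp (fun z => fu (- z)) u _ (is_derive_reflect fu u fuu F2)).
Qed.

(** * The ends of the flow *)

(** The left part [(alpha, u1]] of a flow on the time interval [[0, t1]], in
    coordinates [X], [Y] of some orthonormal frame. *)
Record left_end (alpha : Rbar) (u1 t1 : R) (X Y : R -> R -> R) : Prop := {
  le_nonempty : Rbar_lt alpha u1;
  le_time : 0 < t1;
  le_continuous : forall u t : R, Rbar_lt alpha u -> u <= u1 -> 0 <= t <= t1 ->
    continuous_2 X u t /\ continuous_2 Y u t;
  le_flow : forall u t : R, Rbar_lt alpha u -> u < u1 -> 0 < t <= t1 ->
    exists a b, 0 <= a /\ evolves a b 0 X u t /\ evolves a b 0 Y u t /\
      evolves a b (-2) (fun z s => X z s ^ 2 + Y z s ^ 2) u t;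
  le_proper : forall M, exists uL : R, Rbar_lt alpha uL /\ uL < u1 /\
    forall u t : R, Rbar_lt alpha u -> u <= uL -> 0 <= t <= t1 ->
      M < X u t ^ 2 + Y u t ^ 2
}.

Lemma Rbar_lt_le_finite (alpha : Rbar) (u v : R) :
  Rbar_lt alpha u -> u <= v -> Rbar_lt alpha v.
Proof. intros H Huv; exact (Rbar_lt_le_trans alpha u v H Huv). Qed.

(** A coordinate grows at most like the distance [r] to the origin, and
    [r ^ 2 + 2 t] solves the same equation and is proper, so that an
    arbitrarily small multiple of [r ^ 2 + 3 t] pushes the maximum of the
    difference into a compact region. *)
Lemma end_coordinate_bound (alpha : Rbar) (u1 t1 : R) (X Y : R -> R -> R)
    (c d M : R) :
  left_end alpha u1 t1 X Y -> c ^ 2 + d ^ 2 <= 1 -> 0 <= M ->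
  (forall t : R, 0 <= t <= t1 -> c * X u1 t + d * Y u1 t <= M) ->
  (forall u : R, Rbar_lt alpha u -> u <= u1 -> c * X u 0 + d * Y u 0 <= M) ->
  forall u t : R, Rbar_lt alpha u -> u <= u1 -> 0 <= t <= t1 ->
    c * X u t + d * Y u t <= M.
Proof.
  intros [Hne Ht1 Hcont Hflow Hprop] Hcd HM Hside Hinit u0 t0 Hu0 Hu01 Ht0.
  apply Rnot_lt_le; intros Hbig.
  set (f := fun u t => c * X u t + d * Y u t) in *.
  set (N := fun u t => X u t ^ 2 + Y u t ^ 2).
  assert (HfN : forall u t, f u t ^ 2 <= N u t).
  { intros u t; unfold f, N.
    apply Rle_trans with ((c ^ 2 + d ^ 2) * (X u t ^ 2 + Y u t ^ 2)).
    - assert (0 <= (c * Y u t - d * X u t) ^ 2) by apply pow2_ge_0; nra.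
    - assert (0 <= X u t ^ 2 + Y u t ^ 2) by (apply Rplus_le_le_0_compat; apply pow2_ge_0).
      nra. }
  assert (HN0 : 0 <= N u0 t0)
    by (unfold N; apply Rplus_le_le_0_compat; apply pow2_ge_0).
  set (e := (f u0 t0 - M) / (2 * (N u0 t0 + 3 * t0 + 1))).
  assert (He : 0 < e) by (apply Rdiv_lt_0_compat; unfold f; lra).
  assert (Hedef : e * (N u0 t0 + 3 * t0) < f u0 t0 - M).
  { assert (H : e * (2 * (N u0 t0 + 3 * t0 + 1)) = f u0 t0 - M)
      by (unfold e; field; lra).
    nra. }
  destruct (Hprop (/ e ^ 2)) as [uL [HuL [HuL1 Hfar]]].
  set (uL' := Rmin uL u0).
  assert (HuL' : Rbar_lt alpha uL')
    by (unfold uL', Rmin; destruct (Rle_dec uL u0); assumption).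
  assert (HL : uL' <= uL /\ uL' <= u0) by (split; [apply Rmin_l | apply Rmin_r]).
  set (Q := fun p : R * R => f (fst p) (snd p) - e * (N (fst p) (snd p) + 3 * snd p)).
  destruct (compact_attains_max _ Q
     (compact_product _ _ (compact_segment uL' u1) (compact_segment 0 t1)))
    as [[u t] [[Hu Ht] Hmax]].
  { exists (u0, t0); simpl; lra. }
  { intros [u t] [Hu Ht]; simpl in Hu, Ht.
    destruct (Hcont u t (Rbar_lt_le_finite _ _ _ HuL' (proj1 Hu)) (proj2 Hu) Ht)
      as [HX HY].
    apply (continuous_ext (fun p : R * R => 1 * f (fst p) (snd p)
       + (- e) * (1 * N (fst p) (snd p) + 3 * snd p))); [intros p; unfold Q; ring_R|].
    apply continuous_lin; [|apply continuous_lin].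
    - unfold f; exact (continuous_lin c d _ _ _ HX HY).
    - unfold N; exact (continuous_sq_sum _ _ _ HX HY).
    - apply continuous_snd. }
  simpl in Hu, Ht.
  assert (HQ : M < Q (u, t)).
  { apply Rlt_le_trans with (Q (u0, t0)).
    - unfold Q; simpl; lra.
    - apply Hmax; simpl; lra. }
  assert (Hal : Rbar_lt alpha u) by exact (Rbar_lt_le_finite _ _ _ HuL' (proj1 Hu)).
  assert (HNpos : 0 <= N u t)
    by (unfold N; apply Rplus_le_le_0_compat; apply pow2_ge_0).
  assert (Hfu : M < f u t).
  { unfold Q in HQ; simpl in HQ; nra. }
  assert (Hu1 : u <> u1).
  { intros ->; generalize (Hside t Ht); unfold f in Hfu; lra. }
  assert (HuL2 : u <> uL').
  { intros Heq.
    assert (HNbig : / e ^ 2 < N u t) by (apply Hfar; [exact Hal | lra | exact Ht]).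
    assert (HeN : 1 < e ^ 2 * N u t).
    { apply Rmult_lt_reg_l with (/ e ^ 2); [apply Rinv_0_lt_compat, pow_lt, He|].
      rewrite <- Rmult_assoc, Rinv_l, Rmult_1_l, Rmult_1_r; [exact HNbig|].
      apply pow_nonzero; lra. }
    assert (Hf2 := HfN u t).
    unfold Q in HQ; simpl in HQ.
    assert (HeNf : e * N u t < f u t) by nra.
    assert (0 <= e * N u t) by (apply Rmult_le_pos; lra).
    assert ((e * N u t) ^ 2 < f u t ^ 2) by nra.
    assert ((e * N u t) ^ 2 = (e ^ 2 * N u t) * N u t) by ring.
    nra. }
  assert (Htpos : t <> 0).
  { intros ->; generalize (Hinit u Hal (proj2 Hu)); unfold f in Hfu; lra. }
  destruct (Hflow u t Hal ltac:(lra) ltac:(lra)) as (a & b & Ha & EX & EY & EN).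
  assert (EQ := evolves_comb _ _ _ _ 1 1 _ _ u t
     (evolves_comb _ _ _ _ c d _ _ u t EX EY)
     (evolves_comb _ _ _ _ (- e) (- (3 * e)) _ _ u t EN (evolves_time a b 1 u t))).
  destruct (evolves_at_max a b _ _ u t Ha EQ) as [l [Hl Hlq]].
  { set (r := Rmin (u - uL') (u1 - u)).
    assert (Hr : 0 < r /\ r <= u - uL' /\ r <= u1 - u).
    { unfold r; split; [|split; [apply Rmin_l | apply Rmin_r]].
      apply Rmin_glb_lt; lra. }
    exists (mkposreal r (proj1 Hr)); intros z Hz.
    change (Rabs (z - u) < r) in Hz; apply Rabs_def2 in Hz.
    assert (H : Q (z, t) <= Q (u, t)) by (apply Hmax; simpl; lra).
    unfold Q, f, N in H; simpl in H; simpl; lra. }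
  destruct (slope_below _ t l 0 Hl ltac:(lra)) as [r [Hr [Hleft _]]].
  set (s := t - Rmin r t / 2).
  assert (Hs : t - r < s < t /\ 0 <= s).
  { unfold s, Rmin; destruct (Rle_dec r t); lra. }
  assert (H : Q (u, s) <= Q (u, t)) by (apply Hmax; simpl; lra).
  generalize (Hleft s (proj1 Hs)); unfold Q, f, N in H; simpl in H; lra.
Qed.

(** Two points of the end are compared: at a positive maximum of
    [X (u, t) - max (X (u', t), c) - eps * (r ^ 2 + 3 t)] over [u' <= u] the
    point [u'] may be moved to the minimiser of [X (., t)], where [X] is not
    decreasing in time, whereas at [u] the penalised [X] is decreasing. *)
Lemma end_monotone (alpha : Rbar) (u1 t1 c : R) (X Y : R -> R -> R) :
  left_end alpha u1 t1 X Y -> 0 <= c ->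
  (forall u t : R, Rbar_lt alpha u -> u <= u1 -> 0 <= t <= t1 ->
     Rabs (Y u t) <= c /\ - c <= X u t) ->
  (forall t : R, 0 <= t <= t1 -> X u1 t <= c) ->
  (forall u' u : R, Rbar_lt alpha u' -> u' <= u -> u <= u1 -> X u 0 <= X u' 0) ->
  forall u' u t : R, Rbar_lt alpha u' -> u' <= u -> u <= u1 -> 0 <= t <= t1 ->
    X u t <= Rmax (X u' t) c.
Proof.
  intros [Hne Ht1 Hcont Hflow Hprop] Hc HXY Hside Hinit v0 w0 t0 Hv0 Hvw0 Hw0 Ht0.
  apply Rnot_lt_le; intros Hbig.
  set (N := fun u t => X u t ^ 2 + Y u t ^ 2).
  assert (HNpos : forall u t, 0 <= N u t)
    by (intros; unfold N; apply Rplus_le_le_0_compat; apply pow2_ge_0).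
  set (D := X w0 t0 - Rmax (X v0 t0) c) in *.
  set (e := D / (2 * (N w0 t0 + 3 * t0 + 1))).
  assert (HD : 0 < D) by (unfold D; lra).
  assert (HN0 := HNpos w0 t0).
  assert (He : 0 < e) by (apply Rdiv_lt_0_compat; lra).
  assert (Hedef : e * (N w0 t0 + 3 * t0) < D).
  { assert (H : e * (2 * (N w0 t0 + 3 * t0 + 1)) = D) by (unfold e; field; lra).
    nra. }
  set (B := c + / e).
  assert (Hie : 0 < / e) by (apply Rinv_0_lt_compat, He).
  destruct (Hprop (B ^ 2 + c ^ 2)) as [uL [HuL [HuL1 Hfar]]].
  set (uL' := Rmin uL v0).
  assert (HuL' : Rbar_lt alpha uL')
    by (unfold uL', Rmin; destruct (Rle_dec uL v0); assumption).
  assert (HL : uL' <= uL /\ uL' <= v0) by (split; [apply Rmin_l | apply Rmin_r]).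
  assert (Hdom : forall u : R, uL' <= u -> Rbar_lt alpha u)
    by (intros u; apply Rbar_lt_le_finite, HuL').
  assert (HXL : forall t, 0 <= t <= t1 -> B < X uL' t).
  { intros t Ht; generalize (Hfar uL' t HuL' ltac:(lra) Ht); intros H.
    destruct (HXY uL' t HuL' ltac:(lra) Ht) as [HY HX].
    apply Rabs_le_between in HY; apply Rnot_le_lt; intros HXB.
    assert (Y uL' t ^ 2 <= c ^ 2) by nra.
    assert (X uL' t ^ 2 <= B ^ 2) by (unfold B in *; nra).
    lra. }
  set (Q := fun p : R * (R * R) => X (fst (snd p)) (snd (snd p))
     - Rmax (X (fst p) (snd (snd p))) c
     - e * (N (fst (snd p)) (snd (snd p)) + 3 * snd (snd p))).
  destruct (compact_attains_max
    (fun p : R * (R * R) => ((uL' <= fst p <= u1) /\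
       ((uL' <= fst (snd p) <= u1) /\ (0 <= snd (snd p) <= t1))) /\
       fst p <= fst (snd p)) Q) as [[v1 [w t]] [[[Hv1 [Hw Ht]] Hvw1] Hmax]].
  { apply compact_triangle. }
  { exists (v0, (w0, t0)); simpl; lra. }
  { intros [v [w t]] [[Hv [Hw Ht]] Hvw]; simpl in Hv, Hw, Ht, Hvw.
    destruct (Hcont w t (Hdom w (proj1 Hw)) (proj2 Hw) Ht) as [HXw HYw].
    destruct (Hcont v t (Hdom v (proj1 Hv)) (proj2 Hv) Ht) as [HXv _].
    apply (continuous_ext (fun p : R * (R * R) =>
      1 * (1 * X (fst (snd p)) (snd (snd p)) + (-1) * Rmax (X (fst p) (snd (snd p))) c)
       + (- e) * (1 * (X (fst (snd p)) (snd (snd p)) ^ 2 + Y (fst (snd p)) (snd (snd p)) ^ 2)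
            + 3 * snd (snd p)))); [intros p; unfold Q, N; ring_R|].
    apply continuous_lin; apply continuous_lin.
    - exact (continuous_2_second X v w t HXw).
    - exact (continuous_Rmax c _ _ (continuous_2_first X v w t HXv)).
    - exact (continuous_sq_sum _ _ _ (continuous_2_second X v w t HXw)
               (continuous_2_second Y v w t HYw)).
    - apply continuous_time. }
  simpl in Hv1, Hw, Ht, Hvw1.
  assert (HQ1 : 0 < Q (v1, (w, t))).
  { apply Rlt_le_trans with (Q (v0, (w0, t0))).
    - unfold Q; simpl; unfold D in Hedef; lra.
    - apply Hmax; simpl; lra. }
  (* replacing [v1] by the minimiser cannot decrease [Q] *)
  destruct (continuity_ab_min (fun z => X z t) uL' w ltac:(lra)) as [v [Hvmin Hv]].
  { intros z Hz; apply continuity_pt_filterlim.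
    apply (continuous_2_l X z t), Hcont; [apply Hdom; lra | lra | exact Ht]. }
  assert (HQge : Q (v1, (w, t)) <= Q (v, (w, t))).
  { unfold Q; simpl.
    generalize (Rle_max_compat_r _ _ c (Hvmin v1 ltac:(lra))); lra. }
  assert (HQ : 0 < Q (v, (w, t))) by lra.
  assert (Hal := Hdom w (proj1 Hw)).
  assert (Hpen : 0 <= e * (N w t + 3 * t))
    by (generalize (HNpos w t); intros; apply Rmult_le_pos; lra).
  assert (HXgt : Rmax (X v t) c < X w t) by (unfold Q in HQ; simpl in HQ; lra).
  generalize (Rmax_l (X v t) c) (Rmax_r (X v t) c); intros Hml Hmr.
  assert (Hw1 : w <> u1) by (intros ->; generalize (Hside t Ht); lra).
  assert (Hvw : v <> w) by (intros ->; lra).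
  assert (HvL : v <> uL').
  { intros Heq; rewrite Heq in *.
    assert (HXB := HXL t Ht).
    unfold Q, N in HQ; simpl in HQ.
    assert (0 <= Y w t ^ 2) by apply pow2_ge_0.
    assert (Hsq : X w t - e * X w t ^ 2 <= / e).
    { assert (Hx : e * (/ e) = 1) by (field; lra).
      assert (0 <= (e * X w t - 1) ^ 2) by apply pow2_ge_0.
      apply Rmult_le_reg_l with e; [exact He|]; nra. }
    assert (0 <= e * (Y w t ^ 2 + 3 * t)) by (apply Rmult_le_pos; lra).
    unfold B in HXB; nra. }
  assert (Htpos : t <> 0).
  { intros ->; generalize (Hinit v w (Hdom v (proj1 Hv)) (proj2 Hv) (proj2 Hw)); lra. }
  destruct (Hflow w t Hal ltac:(lra) ltac:(lra)) as (a & b & Ha & EX & EY & EN).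
  assert (EQ := evolves_comb _ _ _ _ 1 1 _ _ w t EX
     (evolves_comb _ _ _ _ (- e) (- (3 * e)) _ _ w t EN (evolves_time a b 1 w t))).
  destruct (evolves_at_max a b _ _ w t Ha EQ) as [l [Hl Hlq]].
  { set (r := Rmin (w - v) (u1 - w)).
    assert (Hr : 0 < r /\ r <= w - v /\ r <= u1 - w).
    { unfold r; split; [|split; [apply Rmin_l | apply Rmin_r]].
      apply Rmin_glb_lt; lra. }
    exists (mkposreal r (proj1 Hr)); intros z Hz.
    change (Rabs (z - w) < r) in Hz; apply Rabs_def2 in Hz.
    assert (H : Q (v, (z, t)) <= Q (v1, (w, t))) by (apply Hmax; simpl; lra).
    assert (H' := Rle_trans _ _ _ H HQge).
    unfold Q, N in H'; simpl in H'; simpl; lra. }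
  destruct (Hflow v t (Hdom v (proj1 Hv)) ltac:(lra) ltac:(lra))
    as (a' & b' & Ha' & EX' & _ & _).
  assert (EV := evolves_comb _ _ _ _ (-1) 0 _ _ v t EX' (evolves_time a' b' 0 v t)).
  destruct (evolves_at_max a' b' _ _ v t Ha' EV) as [m [Hm Hmq]].
  { set (r := Rmin (v - uL') (w - v)).
    assert (Hr : 0 < r /\ r <= v - uL' /\ r <= w - v).
    { unfold r; split; [|split; [apply Rmin_l | apply Rmin_r]].
      apply Rmin_glb_lt; lra. }
    exists (mkposreal r (proj1 Hr)); intros z Hz.
    change (Rabs (z - v) < r) in Hz; apply Rabs_def2 in Hz.
    generalize (Hvmin z ltac:(lra)); lra. }
  (* at [w] the penalised [X] decreases at rate [e] at least, while at [v] the
     rate of [X] is nonnegative; [e / 2] and [e / 4] leave a margin at each *)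
  destruct (slope_below _ t l (- e / 2) Hl ltac:(lra)) as [r [Hr [Hleft _]]].
  destruct (slope_below _ t m (e / 4) Hm ltac:(lra)) as [r' [Hr' [Hleft' _]]].
  set (s := t - Rmin (Rmin r r') t / 2).
  assert (Hs : t - r < s < t /\ t - r' < s < t /\ 0 <= s).
  { unfold s, Rmin; destruct (Rle_dec r r'), (Rle_dec _ t); lra. }
  destruct Hs as [Hs1 [Hs2 Hs3]].
  assert (H : Q (v, (w, s)) <= Q (v1, (w, t))) by (apply Hmax; simpl; lra).
  assert (H' := Rle_trans _ _ _ H HQge).
  assert (Hmx : Rmax (X v s) c <= Rmax (X v t) c + e / 4 * (t - s)).
  { assert (0 <= e / 4 * (t - s)) by (apply Rmult_le_pos; lra).
    generalize (Hleft' s Hs2); intros; apply Rmax_lub; lra. }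
  generalize (Hleft s Hs1); unfold Q, N in H'; simpl in H'.
  assert (0 < e / 4 * (t - s)) by (apply Rmult_lt_0_compat; lra).
  nra.
Qed.

(** [X] is injective in [u] and tends to infinity at the end, so that it cannot
    increase anywhere, by the intermediate value theorem. *)
Lemma end_initially_monotone (alpha : Rbar) (u1 t1 : R) (X Y : R -> R -> R) :
  left_end alpha u1 t1 X Y ->
  (forall u : R, Rbar_lt alpha u -> u <= u1 -> Y u 0 = 0 /\ 0 <= X u 0) ->
  (forall u v : R, Rbar_lt alpha u -> u <= u1 -> Rbar_lt alpha v -> v <= u1 ->
     X u 0 = X v 0 -> u = v) ->
  forall u' u : R, Rbar_lt alpha u' -> u' <= u -> u <= u1 -> X u 0 <= X u' 0.
Proof.
  intros [Hne Ht1 Hcont _ Hprop] Hray Hinj u' u Hu' Huu Hu1.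
  apply Rnot_lt_le; intros Hlt.
  destruct (Hprop (X u 0 ^ 2)) as [uL [HuL [HuL1 Hfar]]].
  set (w := Rmin uL u').
  assert (Hw : Rbar_lt alpha w)
    by (unfold w, Rmin; destruct (Rle_dec uL u'); assumption).
  assert (Hwl : w <= uL /\ w <= u') by (split; [apply Rmin_l | apply Rmin_r]).
  assert (Hdom : forall z : R, w <= z -> Rbar_lt alpha z)
    by (intros z; apply Rbar_lt_le_finite, Hw).
  assert (HXw : X u 0 < X w 0).
  { generalize (Hfar w 0 Hw ltac:(lra) ltac:(lra)).
    destruct (Hray w Hw ltac:(lra)) as [-> H1].
    destruct (Hray u (Hdom u ltac:(lra)) Hu1) as [_ H2].
    intros H; apply Rnot_le_lt; intros Hle; nra. }
  destruct (Req_dec w u') as [Heq|Hne']; [rewrite Heq in HXw; lra|].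
  destruct (Ranalysis5.IVT_interv (fun z => X u 0 - X z 0) w u') as [z [Hz HXz]].
  - intros z Hz; apply continuity_pt_filterlim.
    apply (continuous_minus (fun _ => X u 0) (fun y => X y 0)).
    + apply continuous_const.
    + apply continuous_2_l, Hcont; [apply Hdom | |]; lra.
  - lra.
  - lra.
  - lra.
  - assert (z = u).
    { apply Hinj; try lra; apply Hdom; lra. }
    assert (z = u') by lra; subst; lra.
Qed.

(** The constant [c] bounds the coordinates on the side [u = u1] of the end, and
    then [|Y|] and [- X] everywhere.  Far out [X > c], and there
    [X (u, t) <= max (X (u', t), c)] says that [X] is monotone. *)
Lemma end_graphical (alpha : Rbar) (u1 t1 : R) (X Y : R -> R -> R) :
  left_end alpha u1 t1 X Y ->
  (forall u : R, Rbar_lt alpha u -> u <= u1 -> Y u 0 = 0 /\ 0 <= X u 0) ->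
  (forall u v : R, Rbar_lt alpha u -> u <= u1 -> Rbar_lt alpha v -> v <= u1 ->
     X u 0 = X v 0 -> u = v) ->
  exists uE c : R, Rbar_lt alpha uE /\ uE < u1 /\ 0 <= c /\
    forall u t : R, Rbar_lt alpha u -> u <= uE -> 0 <= t <= t1 ->
      Rabs (Y u t) <= c /\
      forall u' : R, Rbar_lt alpha u' -> u' <= u -> X u t <= X u' t.
Proof.
  intros Hend Hray Hinj; assert (Hend' := Hend).
  destruct Hend' as [Hne Ht1 Hcont _ Hprop].
  destruct (compact_attains_max (X := R_UniformSpace) (fun t => 0 <= t <= t1)
     (fun t => X u1 t ^ 2 + Y u1 t ^ 2)) as [ts [Hts Hmax]].
  { apply compact_segment. }
  { exists 0; lra. }
  { intros t Ht; destruct (Hcont u1 t Hne (Rle_refl u1) Ht) as [HX HY].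
    apply (continuous_sq_sum (fun t => X u1 t) (fun t => Y u1 t));
      apply continuous_2_r; assumption. }
  set (c := X u1 ts ^ 2 + Y u1 ts ^ 2 + 1).
  assert (Hc : 0 <= c).
  { assert (H1 := pow2_ge_0 (X u1 ts)); assert (H2 := pow2_ge_0 (Y u1 ts)).
    unfold c; lra. }
  assert (Hside : forall t : R, 0 <= t <= t1 ->
            - c <= X u1 t <= c /\ - c <= Y u1 t <= c).
  { intros t Ht; generalize (Hmax t Ht); unfold c; nra. }
  assert (HY1 : forall u t : R, Rbar_lt alpha u -> u <= u1 -> 0 <= t <= t1 ->
            0 * X u t + 1 * Y u t <= c).
  { apply end_coordinate_bound with (1 := Hend); [lra | exact Hc | |].
    - intros t Ht; generalize (Hside t Ht); lra.
    - intros u Ha Hu; destruct (Hray u Ha Hu) as [-> _]; lra. }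
  assert (HY2 : forall u t : R, Rbar_lt alpha u -> u <= u1 -> 0 <= t <= t1 ->
            0 * X u t + (-1) * Y u t <= c).
  { apply end_coordinate_bound with (1 := Hend); [lra | exact Hc | |].
    - intros t Ht; generalize (Hside t Ht); lra.
    - intros u Ha Hu; destruct (Hray u Ha Hu) as [-> _]; lra. }
  assert (HX : forall u t : R, Rbar_lt alpha u -> u <= u1 -> 0 <= t <= t1 ->
            (-1) * X u t + 0 * Y u t <= c).
  { apply end_coordinate_bound with (1 := Hend); [lra | exact Hc | |].
    - intros t Ht; generalize (Hside t Ht); lra.
    - intros u Ha Hu; destruct (Hray u Ha Hu) as [_ H]; lra. }
  assert (HXY : forall u t : R, Rbar_lt alpha u -> u <= u1 -> 0 <= t <= t1 ->
            Rabs (Y u t) <= c /\ - c <= X u t).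
  { intros u t Ha Hu Ht; generalize (HY1 u t Ha Hu Ht), (HY2 u t Ha Hu Ht),
      (HX u t Ha Hu Ht); intros; split; [apply Rabs_le|]; lra. }
  assert (Hmon := end_monotone alpha u1 t1 c X Y Hend Hc HXY
     (fun t Ht => proj2 (proj1 (Hside t Ht)))
     (end_initially_monotone alpha u1 t1 X Y Hend Hray Hinj)).
  destruct (Hprop (2 * c ^ 2)) as [uE [HE [HE1 Hfar]]].
  exists uE, c; repeat split; [exact HE | exact HE1 | exact Hc | |].
  - apply HXY; [assumption | lra | assumption].
  - intros u' Hu' Huu.
    assert (Hlt : c < X u t).
    { destruct (HXY u t H ltac:(lra) H1) as [HYu HXu].
      generalize (Hfar u t H H0 H1); apply Rabs_le_between in HYu.
      intros HN; apply Rnot_le_lt; intros Hle; nra. }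
    generalize (Hmon u' u t Hu' Huu ltac:(lra) H1).
    unfold Rmax; destruct (Rle_dec (X u' t) c); lra.
Qed.

(** * Turning and swept area of a monotone arc *)

(** If the angle took all values of an interval longer than [PI], then the cosine
    would have to vanish on a nondegenerate interval, because
    [cos (y + PI) = - cos y]. *)
Lemma angle_variation_le_PI (s p q : R) (psi : R -> R) (theta : R) :
  p <= q -> (forall x, p <= x <= q -> continuity_pt psi x) ->
  (forall x, p <= x <= q -> 0 <= s * cos (psi x - theta)) -> s <> 0 ->
  Rabs (psi q - psi p) <= PI.
Proof.
  intros Hpq Hpsi Hcos Hs; apply Rnot_lt_le; intros Hbig.
  set (m := Rmin (psi p) (psi q)); set (M := Rmax (psi p) (psi q)).
  assert (HmM : PI < M - m).
  { unfold m, M, Rmin, Rmax; destruct (Rle_dec _ _).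
    - rewrite Rabs_pos_eq in Hbig; lra.
    - rewrite Rabs_left in Hbig; lra. }
  assert (Hval : forall y, m <= y <= M -> 0 <= s * cos (y - theta)).
  { intros y Hy.
    assert (Hx : exists x, p <= x <= q /\ psi x = y).
    { destruct (Req_dec y (psi p)) as [->|Hyp]; [exists p; split; [lra | reflexivity]|].
      destruct (Req_dec y (psi q)) as [->|Hyq]; [exists q; split; [lra | reflexivity]|].
      assert (Hlt : p < q).
      { destruct (Req_dec p q) as [->|]; [|lra].
        unfold m, M in HmM; rewrite Rmin_left, Rmax_left in HmM by lra.
        generalize PI_RGT_0; lra. }
      destruct (Rle_or_lt (psi p) (psi q)) as [Hle|Hgt].
      - destruct (Ranalysis5.IVT_interv (fun x => psi x - y) p q) as [x [Hx Hxy]].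
        + intros x Hx; apply continuity_pt_minus; [now apply Hpsi|].
          apply continuity_pt_const; intros ? ?; reflexivity.
        + exact Hlt.
        + unfold m, M in Hy; rewrite Rmin_left, Rmax_right in Hy by lra; lra.
        + unfold m, M in Hy; rewrite Rmin_left, Rmax_right in Hy by lra; lra.
        + exists x; split; [exact Hx | lra].
      - destruct (Ranalysis5.IVT_interv (fun x => y - psi x) p q) as [x [Hx Hxy]].
        + intros x Hx; apply continuity_pt_minus; [|now apply Hpsi].
          apply continuity_pt_const; intros ? ?; reflexivity.
        + exact Hlt.
        + unfold m, M in Hy; rewrite Rmin_right, Rmax_left in Hy by lra; lra.
        + unfold m, M in Hy; rewrite Rmin_right, Rmax_left in Hy by lra; lra.
        + exists x; split; [exact Hx | lra]. }
    destruct Hx as [x [Hx <-]]; exact (Hcos x Hx). }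
  assert (Hzero : forall d, 0 <= d <= M - m - PI -> cos (m - theta + d) = 0).
  { intros d Hd; generalize (Hval (m + d) ltac:(generalize PI_RGT_0; lra)).
    generalize (Hval (m + d + PI) ltac:(generalize PI_RGT_0; lra)).
    replace (m + d + PI - theta) with (m - theta + d + PI) by ring.
    replace (m + d - theta) with (m - theta + d) by ring.
    rewrite neg_cos; intros H1 H2.
    assert (H : s * cos (m - theta + d) = 0) by lra.
    apply Rmult_integral in H; tauto. }
  assert (H0 := Hzero 0 ltac:(lra)); rewrite Rplus_0_r in H0.
  set (d := Rmin (M - m - PI) (PI / 2)).
  assert (Hd : 0 < d /\ d <= M - m - PI /\ d <= PI / 2).
  { generalize PI_RGT_0; intros; unfold d; split; [|split; [apply Rmin_l | apply Rmin_r]].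
    apply Rmin_glb_lt; lra. }
  assert (H1 := Hzero d ltac:(lra)); rewrite cos_plus, H0 in H1.
  assert (Hsd : 0 < sin d) by (apply sin_gt_0; generalize PI_RGT_0; lra).
  generalize (sin2_cos2 (m - theta)); rewrite H0; unfold Rsqr; nra.
Qed.

(** [X' Y - Y' X = 2 X' Y - (X Y)'], and the integral of [|X'|] over a monotone
    arc is the difference of the end values of [X], up to sign. *)
Lemma monotone_arc_area (s c p q : R) (X Y X' Y' : R -> R) :
  p <= q -> 0 <= c ->
  (forall x, p <= x <= q -> is_derive X x (X' x) /\ is_derive Y x (Y' x) /\
     continuous X' x /\ continuous Y' x) ->
  (forall x, p <= x <= q -> 0 <= s * X' x) -> s = 1 \/ s = -1 ->
  (forall x, p <= x <= q -> Rabs (Y x) <= c) ->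
  Rabs (RInt (fun x => X' x * Y x - Y' x * X x) p q)
    <= 3 * c * (Rabs (X p) + Rabs (X q)).
Proof.
  intros Hpq Hc Hd Hmon Hs HY.
  assert (Hd' : forall x, Rmin p q <= x <= Rmax p q -> is_derive X x (X' x) /\
     is_derive Y x (Y' x) /\ continuous X' x /\ continuous Y' x)
    by (intros x; rewrite Rmin_left, Rmax_right by lra; apply Hd).
  assert (HcY : forall x, Rmin p q <= x <= Rmax p q -> continuous Y x)
    by (intros x Hx; apply (ex_derive_continuous Y); exists (Y' x); apply Hd', Hx).
  assert (HcX : forall x, Rmin p q <= x <= Rmax p q -> continuous X x)
    by (intros x Hx; apply (ex_derive_continuous X); exists (X' x); apply Hd', Hx).
  set (J := RInt (fun x => X' x * Y x) p q).
  assert (HJ : is_RInt (fun x => X' x * Y x) p q J).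
  { apply (RInt_correct (V := R_CompleteNormedModule)), ex_RInt_continuous; intros x Hx.
    apply (continuous_mult X' Y); [apply Hd', Hx | apply HcY, Hx]. }
  assert (HXY : is_RInt (fun x => X' x * Y x + X x * Y' x) p q (X q * Y q - X p * Y p)).
  { exact (is_RInt_scal_derive (V := R_CompleteNormedModule) X Y X' Y' p q
       (fun t Ht => proj1 (Hd' t Ht)) (fun t Ht => proj1 (proj2 (Hd' t Ht)))
       (fun t Ht => proj1 (proj2 (proj2 (Hd' t Ht))))
       (fun t Ht => proj2 (proj2 (proj2 (Hd' t Ht))))). }
  assert (HA : is_RInt (fun x => X' x * Y x - Y' x * X x) p q
                 (2 * J - (X q * Y q - X p * Y p))).
  { apply (is_RInt_ext (fun x => minus (scal 2 (X' x * Y x)) (X' x * Y x + X x * Y' x))).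
    - intros x _; unfold minus, plus, opp, scal; simpl; unfold mult; simpl; ring_R.
    - exact (is_RInt_minus _ _ _ _ _ _ (is_RInt_scal _ p q 2 _ HJ) HXY). }
  rewrite (is_RInt_unique _ _ _ _ HA).
  assert (HJb : Rabs J <= c * (s * X q - s * X p)).
  { assert (HX' : is_RInt (fun x => c * (s * X' x)) p q (c * (s * (X q - X p)))).
    { apply (is_RInt_scal (V := R_NormedModule) (fun x => s * X' x) p q c).
      apply (is_RInt_scal (V := R_NormedModule) X' p q s).
      apply (is_RInt_derive X X'); intros x Hx; apply Hd', Hx. }
    replace (c * (s * X q - s * X p)) with (c * (s * (X q - X p))) by ring.
    apply (norm_RInt_le (V := R_NormedModule) (fun x => X' x * Y x)
             (fun x => c * (s * X' x)) p q J _ Hpq); [|exact HJ|exact HX'].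
    intros x Hx; change (norm (X' x * Y x)) with (Rabs (X' x * Y x)).
    rewrite Rabs_mult, Rmult_comm.
    apply Rmult_le_compat; [apply Rabs_pos | apply Rabs_pos | apply HY, Hx |].
    generalize (Hmon x Hx); destruct Hs as [-> | ->]; intros H;
      unfold Rabs; destruct (Rcase_abs _); lra. }
  assert (HYp := HY p ltac:(lra)); assert (HYq := HY q ltac:(lra)).
  assert (Hs1 : s * X q - s * X p <= Rabs (X p) + Rabs (X q)).
  { destruct Hs as [-> | ->]; unfold Rabs; repeat destruct (Rcase_abs _); lra. }
  assert (B1 : Rabs (X q * Y q) <= c * Rabs (X q))
    by (rewrite Rabs_mult, Rmult_comm; apply Rmult_le_compat_r; [apply Rabs_pos | lra]).
  assert (B2 : Rabs (X p * Y p) <= c * Rabs (X p))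
    by (rewrite Rabs_mult, Rmult_comm; apply Rmult_le_compat_r; [apply Rabs_pos | lra]).
  assert (B3 : Rabs J <= c * (Rabs (X p) + Rabs (X q)))
    by (apply Rle_trans with (1 := HJb), Rmult_le_compat_l; lra).
  apply Rabs_le_between in B1; apply Rabs_le_between in B2; apply Rabs_le_between in B3.
  apply Rabs_le; lra.
Qed.

(** * The two-point maximum principle *)

(** The source [q] does not depend on the point and cancels in the difference
    [h w t - h v t], which therefore satisfies the heat equation in the two
    variables [v < w]; it vanishes on the diagonal, and its growth is beaten
    by a small multiple of [N v t + N w t + 5 t].  The two terms [N] have source
    [-2] each, so that this penalty has the positive source [1]. *)
Lemma two_point_maximum_principle (alpha beta : Rbar) (t1 C M : R)
    (h N : R -> R -> R) (q : R -> R) :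
  0 < t1 -> 0 < C -> 0 <= M ->
  (forall u t : R, Rbar_interval alpha beta u -> 0 <= t <= t1 ->
     continuous_2 h u t /\ continuous_2 N u t) ->
  (forall u t : R, Rbar_interval alpha beta u -> 0 < t <= t1 ->
     exists a b, 0 <= a /\ evolves a b (q t) h u t /\ evolves a b (-2) N u t) ->
  (forall B, exists uL uR : R,
     Rbar_interval alpha beta uL /\ Rbar_interval alpha beta uR /\
     forall u t : R, Rbar_interval alpha beta u -> 0 <= t <= t1 ->
       u <= uL \/ uR <= u -> B < N u t) ->
  (forall u t : R, Rbar_interval alpha beta u -> 0 <= t <= t1 ->
     0 <= N u t /\ h u t ^ 2 <= C * (1 + N u t)) ->
  (forall v w : R, Rbar_interval alpha beta v -> Rbar_interval alpha beta w ->
     v <= w -> h w 0 - h v 0 <= M) ->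
  forall v w t : R, Rbar_interval alpha beta v -> Rbar_interval alpha beta w ->
    v <= w -> 0 <= t <= t1 -> h w t - h v t <= M.
Proof.
  intros Ht1 HC HM Hcont Hflow Hprop Hgrow Hinit v0 w0 t0 Hv0 Hw0 Hvw0 Ht0.
  apply Rnot_lt_le; intros Hbig.
  set (D := h w0 t0 - h v0 t0 - M).
  assert (HN0 : 0 <= N v0 t0 + N w0 t0)
    by (apply Rplus_le_le_0_compat; apply Hgrow; assumption).
  set (e := D / (2 * (N v0 t0 + N w0 t0 + 5 * t0 + 1))).
  assert (He : 0 < e) by (apply Rdiv_lt_0_compat; unfold D; lra).
  assert (Hedef : e * (N v0 t0 + N w0 t0 + 5 * t0) < D).
  { assert (H : e * (2 * (N v0 t0 + N w0 t0 + 5 * t0 + 1)) = D)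
      by (unfold e; field; lra).
    assert (0 < D) by (unfold D; lra); nra. }
  set (B := e / 2 + C / (2 * e)).
  (* [|h| <= h ^ 2 * e / (2 C) + C / (2 e)] *)
  assert (Hh : forall u t : R, Rbar_interval alpha beta u -> 0 <= t <= t1 ->
            Rabs (h u t) <= B + e / 2 * N u t).
  { intros u t Hu Ht; destruct (Hgrow u t Hu Ht) as [HNu Hhu].
    set (y := Rabs (h u t)).
    assert (Hy2 : y ^ 2 <= C * (1 + N u t)) by (unfold y; rewrite pow2_abs; exact Hhu).
    assert (Hamgm : y <= e / (2 * C) * y ^ 2 + C / (2 * e)).
    { assert (Hsq : 0 <= (e * y - C) ^ 2) by apply pow2_ge_0.
      replace (e / (2 * C) * y ^ 2 + C / (2 * e))
        with (y + (e * y - C) ^ 2 / (2 * C * e)) by (field; lra).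
      assert (0 <= (e * y - C) ^ 2 / (2 * C * e)); [|lra].
      apply Rdiv_le_0_compat; [exact Hsq|].
      apply Rmult_lt_0_compat; lra. }
    assert (Hmul : e / (2 * C) * y ^ 2 <= e / (2 * C) * (C * (1 + N u t))).
    { apply Rmult_le_compat_l; [|exact Hy2].
      apply Rlt_le, Rdiv_lt_0_compat; lra. }
    replace (e / (2 * C) * (C * (1 + N u t))) with (e / 2 * (1 + N u t)) in Hmul
      by (field; lra).
    unfold B; lra. }
  destruct (Hprop (4 * B / e)) as (uL & uR & HuL & HuR & Hfar).
  assert (HfarB : forall u t : R, Rbar_interval alpha beta u -> 0 <= t <= t1 ->
            u <= uL \/ uR <= u -> 4 * B < e * N u t).
  { intros u t Hu Ht Hout; generalize (Hfar u t Hu Ht Hout); intros H.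
    apply Rmult_lt_compat_l with (1 := He) in H.
    replace (e * (4 * B / e)) with (4 * B) in H by (field; lra); exact H. }
  set (a0 := Rmin uL v0); set (b0 := Rmax uR w0).
  assert (Ha0 : Rbar_interval alpha beta a0)
    by (unfold a0, Rmin; destruct (Rle_dec uL v0); assumption).
  assert (Hb0 : Rbar_interval alpha beta b0)
    by (unfold b0, Rmax; destruct (Rle_dec uR w0); assumption).
  assert (HaL : a0 <= uL /\ a0 <= v0) by (split; [apply Rmin_l | apply Rmin_r]).
  assert (HbR : uR <= b0 /\ w0 <= b0) by (split; [apply Rmax_l | apply Rmax_r]).
  assert (Hdom : forall u : R, a0 <= u <= b0 -> Rbar_interval alpha beta u).
  { intros u Hu; split.
    - exact (Rbar_lt_le_finite _ _ _ (proj1 Ha0) (proj1 Hu)).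
    - exact (Rbar_le_lt_trans u b0 beta (proj2 Hu) (proj2 Hb0)). }
  set (Q := fun p : R * (R * R) =>
     h (fst (snd p)) (snd (snd p)) - h (fst p) (snd (snd p))
     - e * (N (fst p) (snd (snd p)) + N (fst (snd p)) (snd (snd p))
            + 5 * snd (snd p))).
  destruct (compact_attains_max
    (fun p : R * (R * R) => ((a0 <= fst p <= b0) /\
       ((a0 <= fst (snd p) <= b0) /\ (0 <= snd (snd p) <= t1))) /\
       fst p <= fst (snd p)) Q) as [[v [w t]] [[[Hv [Hw Ht]] Hvw] Hmax]].
  { apply compact_triangle. }
  { exists (v0, (w0, t0)); simpl; lra. }
  { intros [v [w t]] [[Hv [Hw Ht]] Hvw]; simpl in Hv, Hw, Ht, Hvw.
    destruct (Hcont w t (Hdom w Hw) Ht) as [Hhw HNw].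
    destruct (Hcont v t (Hdom v Hv) Ht) as [Hhv HNv].
    apply (continuous_ext (fun p : R * (R * R) =>
      1 * (1 * h (fst (snd p)) (snd (snd p)) + (-1) * h (fst p) (snd (snd p)))
       + (- e) * (1 * (1 * N (fst p) (snd (snd p)) + 1 * N (fst (snd p)) (snd (snd p)))
            + 5 * snd (snd p)))); [intros p; unfold Q; ring_R|].
    apply continuous_lin; apply continuous_lin; try apply continuous_lin.
    - exact (continuous_2_second h v w t Hhw).
    - exact (continuous_2_first h v w t Hhv).
    - exact (continuous_2_first N v w t HNv).
    - exact (continuous_2_second N v w t HNw).
    - apply continuous_time. }
  simpl in Hv, Hw, Ht, Hvw.
  assert (HQ : M < Q (v, (w, t))).
  { apply Rlt_le_trans with (Q (v0, (w0, t0))).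
    - unfold Q; simpl; unfold D in Hedef; lra.
    - apply Hmax; simpl; lra. }
  assert (HIv := Hdom v Hv); assert (HIw := Hdom w Hw).
  destruct (Hgrow v t HIv Ht) as [HNv _]; destruct (Hgrow w t HIw Ht) as [HNw _].
  assert (Hpv : 0 <= e * N v t) by (apply Rmult_le_pos; lra).
  assert (Hpw : 0 <= e * N w t) by (apply Rmult_le_pos; lra).
  assert (Hpt : 0 <= e * (5 * t)) by (apply Rmult_le_pos; lra).
  assert (HQ' := HQ); unfold Q in HQ'; simpl in HQ'.
  assert (Hhv := Hh v t HIv Ht); assert (Hhw := Hh w t HIw Ht).
  apply Rabs_le_between in Hhv; apply Rabs_le_between in Hhw.
  assert (Hne : v <> w) by (intros ->; lra).
  assert (Hva : v <> a0).
  { intros Heq; assert (Hout : v <= uL \/ uR <= v) by (left; lra).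
    generalize (HfarB v t HIv Ht Hout); lra. }
  assert (Hwb : w <> b0).
  { intros Heq; assert (Hout : w <= uL \/ uR <= w) by (right; lra).
    generalize (HfarB w t HIw Ht Hout); lra. }
  assert (Htpos : t <> 0).
  { intros ->; generalize (Hinit v w HIv HIw Hvw); lra. }
  destruct (Hflow v t HIv ltac:(lra)) as (av & bv & Hav & Ehv & ENv).
  destruct (Hflow w t HIw ltac:(lra)) as (aw & bw & Haw & Ehw & ENw).
  set (r := Rmin (Rmin (v - a0) (b0 - w)) (w - v)).
  assert (Hr : 0 < r /\ r <= v - a0 /\ r <= b0 - w /\ r <= w - v).
  { unfold r; split; [|split; [|split]].
    - apply Rmin_glb_lt; [apply Rmin_glb_lt|]; lra.
    - apply Rle_trans with (1 := Rmin_l _ _), Rmin_l.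
    - apply Rle_trans with (1 := Rmin_l _ _), Rmin_r.
    - apply Rmin_r. }
  destruct (evolves_at_max av bv _ _ v t Hav
     (evolves_comb _ _ _ _ (-1) (- e) _ _ v t Ehv ENv)) as [l [Hl Hlq]].
  { exists (mkposreal r (proj1 Hr)); intros z Hz.
    change (Rabs (z - v) < r) in Hz; apply Rabs_def2 in Hz.
    assert (H : Q (z, (w, t)) <= Q (v, (w, t))) by (apply Hmax; simpl; lra).
    unfold Q in H; simpl in H; simpl; lra. }
  destruct (evolves_at_max aw bw _ _ w t Haw
     (evolves_comb _ _ _ _ 1 (- e) _ _ w t Ehw ENw)) as [m [Hm Hmq]].
  { exists (mkposreal r (proj1 Hr)); intros z Hz.
    change (Rabs (z - w) < r) in Hz; apply Rabs_def2 in Hz.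
    assert (H : Q (v, (z, t)) <= Q (v, (w, t))) by (apply Hmax; simpl; lra).
    unfold Q in H; simpl in H; simpl; lra. }
  (* the spatial maxima bound the two time derivatives by [- q t + 2 e] and
     [q t + 2 e]; [9/4] leaves a margin on both sides of [2 * 9/4 < 5] *)
  destruct (slope_below _ t l (- q t + 9 / 4 * e) Hl ltac:(lra)) as [d [Hd [Hleft _]]].
  destruct (slope_below _ t m (q t + 9 / 4 * e) Hm ltac:(lra)) as [d' [Hd' [Hleft' _]]].
  set (s := t - Rmin (Rmin d d') t / 2).
  assert (Hs : t - d < s < t /\ t - d' < s < t /\ 0 <= s).
  { unfold s, Rmin; destruct (Rle_dec d d'), (Rle_dec _ t); lra. }
  destruct Hs as [Hs1 [Hs2 Hs3]].
  assert (H : Q (v, (w, s)) <= Q (v, (w, t))) by (apply Hmax; simpl; lra).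
  generalize (Hleft s Hs1), (Hleft' s Hs2); unfold Q in H; simpl in H.
  assert (0 < e * (t - s)) by (apply Rmult_lt_0_compat; lra).
  nra.
Qed.

(** * The tangent angle *)

Lemma Rbar_interval_convex (alpha beta : Rbar) (u v x : R) :
  Rbar_interval alpha beta u -> Rbar_interval alpha beta v ->
  Rmin u v <= x <= Rmax u v -> Rbar_interval alpha beta x.
Proof.
  intros [Hu1 Hu2] [Hv1 Hv2] Hx; split.
  - apply Rbar_lt_le_trans with (Rmin u v); [|exact (proj1 Hx)].
    unfold Rmin; destruct (Rle_dec u v); assumption.
  - apply Rbar_le_lt_trans with (Rmax u v); [exact (proj2 Hx)|].
    unfold Rmax; destruct (Rle_dec u v); assumption.
Qed.

Lemma Rbar_interval_open (alpha beta : Rbar) (u : R) :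
  Rbar_interval alpha beta u -> locally u (Rbar_interval alpha beta).
Proof.
  intros [H1 H2]; apply filter_and.
  - exact (open_Rbar_gt alpha u H1).
  - exact (open_Rbar_lt beta u H2).
Qed.

Lemma unit_vector_angle (p q : R) :
  p ^ 2 + q ^ 2 = 1 -> exists psi, p = cos psi /\ q = sin psi.
Proof.
  intros H; assert (Hp : -1 <= p <= 1) by nra.
  destruct (Rle_or_lt 0 q) as [Hq|Hq].
  - exists (acos p); rewrite cos_acos, sin_acos by exact Hp; split; [reflexivity|].
    replace (1 - p²) with (q²) by (unfold Rsqr; lra).
    rewrite sqrt_Rsqr; [reflexivity | exact Hq].
  - exists (- acos p); rewrite cos_neg, sin_neg, cos_acos, sin_acos by exact Hp.
    split; [reflexivity|].
    replace (1 - p²) with ((- q)²) by (unfold Rsqr; lra).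
    rewrite sqrt_Rsqr; lra.
Qed.

Lemma constant_of_zero_derivative (alpha beta : Rbar) (f : R -> R) (u v : R) :
  (forall x : R, Rbar_interval alpha beta x -> is_derive f x 0) ->
  Rbar_interval alpha beta u -> Rbar_interval alpha beta v -> f u = f v.
Proof.
  intros Hf.
  assert (H : forall a b : R, Rbar_interval alpha beta a -> Rbar_interval alpha beta b ->
             a < b -> f a = f b).
  { intros a b Ha Hb Hab; apply (eq_is_derive f a b); [|exact Hab].
    intros t Ht; apply Hf, (Rbar_interval_convex alpha beta a b); [exact Ha | exact Hb|].
    rewrite Rmin_left, Rmax_right; lra. }
  intros Hu Hv; destruct (Rtotal_order u v) as [Hlt|[->|Hgt]].
  - now apply H.
  - reflexivity.
  - symmetry; now apply H.
Qed.

(** Two tangent angles differ by a continuous function with values in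
    [2 PI Z]. *)
Lemma constant_of_cos_eq_1 (alpha beta : Rbar) (d : R -> R) (u v : R) :
  (forall x : R, Rbar_interval alpha beta x -> continuity_pt d x /\ cos (d x) = 1) ->
  Rbar_interval alpha beta u -> Rbar_interval alpha beta v -> u < v -> d u = d v.
Proof.
  intros Hd Hu Hv Huv.
  assert (HI : forall x, u <= x <= v -> Rbar_interval alpha beta x).
  { intros x Hx; apply (Rbar_interval_convex alpha beta u v); [exact Hu | exact Hv|].
    rewrite Rmin_left, Rmax_right; lra. }
  assert (Hgap : forall g : R -> R, (forall x, u <= x <= v ->
             continuity_pt g x /\ cos (g x) = 1) -> g u < g v -> False).
  { intros g Hg Hlt; pose proof PI_RGT_0 as HPI.
    set (m := Rmin (g v - g u) PI / 2).
    assert (Hm : 0 < m /\ m < g v - g u /\ m < PI).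
    { unfold m, Rmin; destruct (Rle_dec _ _); lra. }
    destruct (Ranalysis5.IVT_interv (fun x => g x - (g u + m)) u v) as [x [Hx Hgx]].
    - intros x Hx; apply continuity_pt_minus; [apply Hg, Hx|].
      apply continuity_pt_const; intros ? ?; reflexivity.
    - exact Huv.
    - lra.
    - lra.
    - assert (H1 : cos (g x) = 1) by apply Hg, Hx.
      assert (H2 : cos (g u) = 1) by (apply Hg; lra).
      replace (g x) with (g u + m) in H1 by lra.
      assert (H3 : sin (g u) = 0).
      { generalize (sin2_cos2 (g u)); rewrite H2; unfold Rsqr; nra. }
      rewrite cos_plus, H2, H3 in H1.
      assert (H4 : 0 < sin m) by (apply sin_gt_0; lra).
      generalize (sin2_cos2 m); unfold Rsqr; nra. }
  destruct (Rtotal_order (d u) (d v)) as [Hlt|[Heq|Hgt]]; [exfalso | exact Heq | exfalso].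
  - apply (Hgap d); [|exact Hlt]; intros x Hx; apply Hd, HI, Hx.
  - apply (Hgap (fun x => - d x)); [|lra]; intros x Hx; split.
    + apply continuity_pt_opp, Hd, HI, Hx.
    + rewrite cos_neg; apply Hd, HI, Hx.
Qed.

(** The rate at which the angle of the vector [(p, q)] changes when its
    derivative is [(p', q')]. *)
Definition angular_rate (p q p' q' : R) : R := (p * q' - q * p') / (p ^ 2 + q ^ 2).

Lemma is_derive_normalized (p q : R -> R) (u p' q' : R) :
  is_derive p u p' -> is_derive q u q' -> 0 < p u ^ 2 + q u ^ 2 ->
  let n := sqrt (p u ^ 2 + q u ^ 2) in
  let k := angular_rate (p u) (q u) p' q' in
  is_derive (fun x => p x / sqrt (p x ^ 2 + q x ^ 2)) u (- k * (q u / n)) /\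
  is_derive (fun x => q x / sqrt (p x ^ 2 + q x ^ 2)) u (k * (p u / n)).
Proof.
  intros Dp Dq HS n k.
  assert (Hn : 0 < n) by (apply sqrt_lt_R0, HS).
  assert (Hnn : n ^ 2 = p u ^ 2 + q u ^ 2) by (apply pow2_sqrt; lra).
  assert (Ep : Derive (fun x => p x) u = p') by (apply is_derive_unique; exact Dp).
  assert (Eq : Derive (fun x => q x) u = q') by (apply is_derive_unique; exact Dq).
  assert (H0 : p u * (p u * 1) + q u * (q u * 1) = n ^ 2) by (rewrite Hnn; ring).
  assert (Hsq : sqrt (p u * (p u * 1) + q u * (q u * 1)) = n)
    by (unfold n; f_equal; ring).
  unfold k, angular_rate; rewrite <- Hnn; split; auto_derive.
  - repeat split; try (now exists p'); try (now exists q'); rewrite H0.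
    + apply pow_lt, Hn.
    + rewrite <- H0, Hsq; lra.
  - rewrite Ep, Eq, Hsq; field_simplify_eq; [|lra].
    replace (n ^ 3) with (n ^ 2 * n) by ring; rewrite Hnn; ring.
  - repeat split; try (now exists p'); try (now exists q'); rewrite H0.
    + apply pow_lt, Hn.
    + rewrite <- H0, Hsq; lra.
  - rewrite Ep, Eq, Hsq; field_simplify_eq; [|lra].
    replace (n ^ 3) with (n ^ 2 * n) by ring; rewrite Hnn; ring.
Qed.

(** The angle of a nonvanishing vector field [(p, q)] is a primitive of
    [angular_rate]: rotating [(p, q) / |(p, q)|] back by the primitive gives a
    vector with vanishing derivative. *)
Lemma angle_primitive (alpha beta : Rbar) (p q p' q' : R -> R) (u0 : R) :
  Rbar_interval alpha beta u0 ->
  (forall u : R, Rbar_interval alpha beta u ->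
     is_derive p u (p' u) /\ is_derive q u (q' u) /\
     continuous p' u /\ continuous q' u /\ 0 < p u ^ 2 + q u ^ 2) ->
  exists psi : R -> R,
    (forall u : R, Rbar_interval alpha beta u ->
       is_derive psi u (angular_rate (p u) (q u) (p' u) (q' u))) /\
    (forall u : R, Rbar_interval alpha beta u ->
       p u / sqrt (p u ^ 2 + q u ^ 2) = cos (psi u) /\
       q u / sqrt (p u ^ 2 + q u ^ 2) = sin (psi u)).
Proof.
  intros Hu0 Hpq.
  set (K := fun u => angular_rate (p u) (q u) (p' u) (q' u)).
  set (S := fun u => p u ^ 2 + q u ^ 2).
  assert (HS : forall u : R, Rbar_interval alpha beta u -> 0 < S u)
    by (intros u Hu; apply Hpq, Hu).
  assert (HK : forall u : R, Rbar_interval alpha beta u -> continuous K u).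
  { intros u Hu; destruct (Hpq u Hu) as (Dp & Dq & Cp' & Cq' & Hpos).
    assert (Cp : continuous p u) by (apply (ex_derive_continuous p); exists (p' u); exact Dp).
    assert (Cq : continuous q u) by (apply (ex_derive_continuous q); exists (q' u); exact Dq).
    apply (continuous_mult (fun x => p x * q' x - q x * p' x) (fun x => / S x)).
    - apply (continuous_minus (fun x => p x * q' x) (fun x => q x * p' x)).
      + exact (continuous_mult p q' u Cp Cq').
      + exact (continuous_mult q p' u Cq Cp').
    - apply (continuous_comp S Rinv); [exact (continuous_sq_sum p q u Cp Cq)|].
      apply continuous_Rinv, Rgt_not_eq, HS, Hu. }
  assert (H0 : (p u0 / sqrt (S u0)) ^ 2 + (q u0 / sqrt (S u0)) ^ 2 = 1).
  { assert (Hs : 0 < sqrt (S u0)) by (apply sqrt_lt_R0, HS, Hu0).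
    assert (Hss : sqrt (S u0) ^ 2 = S u0) by (apply pow2_sqrt; apply Rlt_le, HS, Hu0).
    replace ((p u0 / sqrt (S u0)) ^ 2 + (q u0 / sqrt (S u0)) ^ 2)
      with ((p u0 ^ 2 + q u0 ^ 2) / sqrt (S u0) ^ 2) by (field; lra).
    rewrite Hss; fold (S u0); field; apply Rgt_not_eq, HS, Hu0. }
  destruct (unit_vector_angle _ _ H0) as [psi0 [Hc0 Hs0]].
  set (psi := fun u => psi0 + RInt K u0 u).
  assert (Hpsi : forall u : R, Rbar_interval alpha beta u -> is_derive psi u (K u)).
  { intros u Hu; replace (K u) with (plus 0 (K u)) by (unfold plus; simpl; ring_R).
    apply (is_derive_plus (fun _ => psi0) (fun x => RInt K u0 x)).
    - exact (is_derive_const psi0 u).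
    - apply (is_derive_RInt K (fun x => RInt K u0 x) u0); [|exact (HK u Hu)].
      generalize (Rbar_interval_open alpha beta u Hu); apply filter_imp; intros x Hx.
      apply (RInt_correct (V := R_CompleteNormedModule)), ex_RInt_continuous; intros z Hz.
      apply HK, (Rbar_interval_convex alpha beta u0 x); assumption. }
  exists psi; split; [exact Hpsi|].
  assert (Hpsi0 : psi u0 = psi0)
    by (unfold psi; rewrite RInt_point; unfold zero; simpl; ring_R).
  set (P := fun u => p u / sqrt (S u)) in *; set (Q := fun u => q u / sqrt (S u)) in *.
  set (c1 := fun u => P u * cos (psi u) + Q u * sin (psi u)).
  set (c2 := fun u => Q u * cos (psi u) - P u * sin (psi u)).
  assert (HD : forall u : R, Rbar_interval alpha beta u ->
            is_derive c1 u 0 /\ is_derive c2 u 0).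
  { intros u Hu; destruct (Hpq u Hu) as (Dp & Dq & _ & _ & HSu).
    destruct (is_derive_normalized p q u _ _ Dp Dq HSu) as [DP DQ].
    fold (K u) in DP, DQ; fold (S u) in DP, DQ; fold (P u) in DP, DQ; fold (Q u) in DP, DQ.
    assert (Dpsi := Hpsi u Hu).
    assert (EP : Derive (fun x => P x) u = - K u * Q u) by (apply is_derive_unique; exact DP).
    assert (EQ : Derive (fun x => Q x) u = K u * P u) by (apply is_derive_unique; exact DQ).
    assert (Epsi : Derive (fun x => psi x) u = K u) by (apply is_derive_unique; exact Dpsi).
    assert (XP : ex_derive (fun x => P x) u) by (eexists; exact DP).
    assert (XQ : ex_derive (fun x => Q x) u) by (eexists; exact DQ).
    assert (Xpsi : ex_derive (fun x => psi x) u) by (eexists; exact Dpsi).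
    unfold c1, c2; split; auto_derive; try (repeat split; assumption);
      rewrite EP, EQ, Epsi; ring. }
  intros u Hu.
  assert (E1 : c1 u = 1).
  { rewrite (constant_of_zero_derivative alpha beta c1 u u0 (fun x Hx => proj1 (HD x Hx)) Hu Hu0).
    unfold c1; rewrite Hpsi0; fold (P u0) in Hc0; fold (Q u0) in Hs0.
    rewrite Hc0, Hs0; generalize (sin2_cos2 psi0); unfold Rsqr; lra. }
  assert (E2 : c2 u = 0).
  { rewrite (constant_of_zero_derivative alpha beta c2 u u0 (fun x Hx => proj2 (HD x Hx)) Hu Hu0).
    unfold c2; rewrite Hpsi0; fold (P u0) in Hc0; fold (Q u0) in Hs0.
    rewrite Hc0, Hs0; ring. }
  fold (S u); fold (P u); fold (Q u).
  generalize (sin2_cos2 (psi u)); unfold Rsqr; intros Hsc; unfold c1, c2 in E1, E2.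
  split.
  - transitivity (P u * (sin (psi u) * sin (psi u) + cos (psi u) * cos (psi u)));
      [rewrite Hsc; ring|].
    transitivity ((P u * cos (psi u) + Q u * sin (psi u)) * cos (psi u)
      - (Q u * cos (psi u) - P u * sin (psi u)) * sin (psi u)); [ring|].
    rewrite E1, E2; ring.
  - transitivity (Q u * (sin (psi u) * sin (psi u) + cos (psi u) * cos (psi u)));
      [rewrite Hsc; ring|].
    transitivity ((P u * cos (psi u) + Q u * sin (psi u)) * sin (psi u)
      + (Q u * cos (psi u) - P u * sin (psi u)) * cos (psi u)); [ring|].
    rewrite E1, E2; ring.
Qed.

Lemma enorm_components (p q : R) : enorm (p, q) = sqrt (p ^ 2 + q ^ 2).
Proof. unfold enorm, dot; simpl; f_equal; ring. Qed.

Lemma unit_tangent_components (c : R -> plane) (u p q : R) :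
  is_derive (fun s => fst (c s)) u p -> is_derive (fun s => snd (c s)) u q ->
  velocity c u = (p, q) /\
  unit_tangent c u = (p / sqrt (p ^ 2 + q ^ 2), q / sqrt (p ^ 2 + q ^ 2)).
Proof.
  intros Hp Hq.
  assert (Hv : velocity c u = (p, q)).
  { unfold velocity; f_equal; apply is_derive_unique; assumption. }
  split; [exact Hv|].
  unfold unit_tangent, speed; rewrite Hv, enorm_components; reflexivity.
Qed.

(** The chosen tangent angle is merely known to be continuous; it differs by a
    constant from the primitive of the angular rate. *)
Lemma turning_integral (alpha beta : Rbar) (c : R -> plane) (p q p' q' : R -> R) :
  (forall u : R, Rbar_interval alpha beta u ->
     is_derive (fun s => fst (c s)) u (p u) /\ is_derive (fun s => snd (c s)) u (q u) /\
     is_derive p u (p' u) /\ is_derive q u (q' u) /\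
     continuous p' u /\ continuous q' u /\ 0 < p u ^ 2 + q u ^ 2) ->
  (exists u0 : R, Rbar_interval alpha beta u0) ->
  let psi := tangent_angle (Rbar_interval alpha beta) c in
  (forall u : R, Rbar_interval alpha beta u ->
     continuity_pt psi u /\
     p u = sqrt (p u ^ 2 + q u ^ 2) * cos (psi u) /\
     q u = sqrt (p u ^ 2 + q u ^ 2) * sin (psi u)) /\
  (forall v w : R, Rbar_interval alpha beta v -> Rbar_interval alpha beta w -> v <= w ->
     is_RInt (fun u => angular_rate (p u) (q u) (p' u) (q' u)) v w
       (turning (Rbar_interval alpha beta) c v w)).
Proof.
  intros H [u0 Hu0] psi; set (I := Rbar_interval alpha beta) in *.
  destruct (angle_primitive alpha beta p q p' q' u0 Hu0) as [phi [Dphi Hphi]].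
  { intros u Hu; destruct (H u Hu) as (_ & _ & H1 & H2 & H3 & H4 & H5); tauto. }
  assert (Hut : forall u : R, I u -> unit_tangent c u = (cos (phi u), sin (phi u))).
  { intros u Hu; destruct (H u Hu) as (H1 & H2 & _).
    rewrite (proj2 (unit_tangent_components c u _ _ H1 H2)).
    destruct (Hphi u Hu) as [-> ->]; reflexivity. }
  assert (Cphi : forall u : R, I u -> continuity_pt phi u).
  { intros u Hu; apply continuity_pt_filterlim.
    apply (ex_derive_continuous (K := R_AbsRing) (V := R_NormedModule) phi u).
    eexists; exact (Dphi u Hu). }
  assert (Hpsi : is_tangent_angle I c psi).
  { apply (epsilon_spec (inhabits (fun _ : R => 0)) (is_tangent_angle I c)).
    exists phi; split; [|exact Hut].
    intros u Hu; apply (filterlim_filter_le_1 (F := locally u)).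
    - intros Q HQ; unfold within; apply filter_imp with (2 := HQ); auto.
    - exact (proj1 (continuity_pt_filterlim phi u) (Cphi u Hu)). }
  destruct Hpsi as [Cpsi Hpsi].
  assert (Cpsi' : forall u : R, I u -> continuity_pt psi u).
  { intros u Hu; apply continuity_pt_filterlim; intros Q HQ.
    generalize (Cpsi u Hu Q HQ); unfold filtermap, within; intros HW.
    generalize (filter_and _ _ HW (Rbar_interval_open alpha beta u Hu)).
    apply filter_imp; intros x [H1 H2]; exact (H1 H2). }
  assert (Hsame : forall u : R, I u -> cos (psi u) = cos (phi u) /\ sin (psi u) = sin (phi u)).
  { intros u Hu; generalize (Hpsi u Hu); rewrite (Hut u Hu); intros He.
    injection He; auto. }
  split.
  - intros u Hu; split; [exact (Cpsi' u Hu)|].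
    destruct (Hsame u Hu) as [-> ->]; destruct (Hphi u Hu) as [<- <-].
    assert (0 < sqrt (p u ^ 2 + q u ^ 2)) by (apply sqrt_lt_R0, H, Hu).
    split; field; lra.
  - intros v w Hv Hw Hvw.
    assert (Heq : psi w - psi v = phi w - phi v).
    { destruct (Req_dec v w) as [->|Hne]; [ring|].
      assert (Hd : psi v - phi v = psi w - phi w).
      { apply (constant_of_cos_eq_1 alpha beta (fun x => psi x - phi x));
          [|exact Hv|exact Hw|lra].
        intros x Hx; split; [apply continuity_pt_minus; auto|].
        rewrite cos_minus; destruct (Hsame x Hx) as [-> ->].
        generalize (sin2_cos2 (phi x)); unfold Rsqr; lra. }
      lra. }
    change (turning I c v w) with (psi w - psi v); rewrite Heq.
    assert (HI : forall x, Rmin v w <= x <= Rmax v w -> I x)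
      by (intros x; apply Rbar_interval_convex; assumption).
    apply (is_RInt_derive phi); [intros x Hx; apply Dphi, HI, Hx|].
    intros u Hu; destruct (H u (HI u Hu)) as (_ & _ & Dp & Dq & Cp' & Cq' & Hpos).
    assert (Cp : continuous p u) by (apply (ex_derive_continuous p); eexists; exact Dp).
    assert (Cq : continuous q u) by (apply (ex_derive_continuous q); eexists; exact Dq).
    apply (continuous_mult (fun x => p x * q' x - q x * p' x)
             (fun x => / (p x ^ 2 + q x ^ 2))).
    + apply (continuous_minus (fun x => p x * q' x) (fun x => q x * p' x)).
      * exact (continuous_mult p q' u Cp Cq').
      * exact (continuous_mult q p' u Cq Cp').
    + apply (continuous_comp (fun x => p x ^ 2 + q x ^ 2) Rinv);
        [exact (continuous_sq_sum p q u Cp Cq)|].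
      apply continuous_Rinv; lra.
Qed.

Lemma curvature_components (c : R -> plane) (p q : R -> R) (u p' q' : R) :
  locally u (fun x => is_derive (fun s => fst (c s)) x (p x) /\
                      is_derive (fun s => snd (c s)) x (q x)) ->
  is_derive p u p' -> is_derive q u q' -> 0 < p u ^ 2 + q u ^ 2 ->
  let n := sqrt (p u ^ 2 + q u ^ 2) in
  unit_normal c u = (- (q u / n), p u / n) /\
  curvature c u = - (angular_rate (p u) (q u) p' q' / n).
Proof.
  intros Hloc Dp Dq HS n.
  assert (Hn : 0 < n) by (apply sqrt_lt_R0, HS).
  assert (Hnn : n ^ 2 = p u ^ 2 + q u ^ 2) by (apply pow2_sqrt; lra).
  destruct (locally_singleton _ _ Hloc) as [H1 H2].
  destruct (unit_tangent_components c u _ _ H1 H2) as [Hv Ht].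
  assert (Hun : unit_normal c u = (- (q u / n), p u / n))
    by (unfold unit_normal; rewrite Ht; reflexivity).
  split; [exact Hun|].
  destruct (is_derive_normalized p q u p' q' Dp Dq HS) as [DP DQ].
  fold n in DP, DQ.
  assert (HT : locally u (fun x => unit_tangent c x =
     (p x / sqrt (p x ^ 2 + q x ^ 2), q x / sqrt (p x ^ 2 + q x ^ 2)))).
  { apply filter_imp with (2 := Hloc); intros x [G1 G2].
    exact (proj2 (unit_tangent_components c x _ _ G1 G2)). }
  assert (Hvt : velocity (unit_tangent c) u =
     (- angular_rate (p u) (q u) p' q' * (q u / n),
      angular_rate (p u) (q u) p' q' * (p u / n))).
  { unfold velocity; f_equal; apply is_derive_unique.
    - apply is_derive_ext_loc with (2 := DP).
      apply filter_imp with (2 := HT); intros x ->; reflexivity.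
    - apply is_derive_ext_loc with (2 := DQ).
      apply filter_imp with (2 := HT); intros x ->; reflexivity. }
  unfold curvature, curvature_vector; rewrite Hvt, Hun; unfold speed; rewrite Hv.
  rewrite enorm_components; fold n; unfold dot; simpl.
  set (k := angular_rate (p u) (q u) p' q').
  transitivity (- (k * (p u ^ 2 + q u ^ 2) / n ^ 3)); [field; lra|].
  rewrite <- Hnn; field; lra.
Qed.

(** * Smooth functions of space and time *)

Definition du (f : R -> R -> R) (u t : R) : R := Derive (fun z => f z t) u.
Definition dt (f : R -> R -> R) (u t : R) : R := Derive (fun s => f u s) t.

Lemma locally_2d_self (P : R -> R -> Prop) (u t : R) :
  locally_2d P u t -> locally_2d (locally_2d P) u t.
Proof.
  intros H; apply locally_2d_locally in H; apply locally_2d_locally.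
  apply locally_locally in H; revert H; apply filter_imp.
  intros [z s] H; apply locally_2d_locally; exact H.
Qed.

(** Only the slices of [D] at fixed time have to be open, so that spatial
    derivatives keep smoothness up to the initial time. *)
Lemma smooth_on_du (D : R * R -> Prop) (f : R -> R -> R) :
  (forall u t, D (u, t) -> locally u (fun z => D (z, t))) ->
  smooth_on D f -> smooth_on D (du f).
Proof.
  intros HD Hf u t Hut; destruct (Hf u t Hut) as [F [H1 H2]].
  exists (du F); split.
  - revert H1; apply locally_2d_impl, locally_2d_forall; intros z s H n.
    exact (ex_diff_n_deriv_aux1 F n z s (H (S n))).
  - apply locally_2d_self in H2; revert H2.
    apply locally_2d_impl, locally_2d_forall; intros z s H Hzs.
    apply Derive_ext_loc.
    apply locally_2d_1d_const_y in H.
    generalize (filter_and _ _ H (HD z s Hzs)); apply filter_imp; intros x [G1 G2]; auto.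
Qed.

Lemma smooth_on_dt (D : R * R -> Prop) (f : R -> R -> R) :
  (forall u t, D (u, t) -> locally t (fun s => D (u, s))) ->
  smooth_on D f -> smooth_on D (dt f).
Proof.
  intros HD Hf u t Hut; destruct (Hf u t Hut) as [F [H1 H2]].
  exists (dt F); split.
  - revert H1; apply locally_2d_impl, locally_2d_forall; intros z s H n.
    exact (ex_diff_n_deriv_aux2 F n z s (H (S n))).
  - apply locally_2d_self in H2; revert H2.
    apply locally_2d_impl, locally_2d_forall; intros z s H Hzs.
    apply Derive_ext_loc.
    apply locally_2d_1d_const_x in H.
    generalize (filter_and _ _ H (HD z s Hzs)); apply filter_imp; intros x [G1 G2]; auto.
Qed.

Lemma smooth_on_subset (D D' : R * R -> Prop) (f : R -> R -> R) :
  (forall p, D' p -> D p) -> smooth_on D f -> smooth_on D' f.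
Proof.
  intros HD Hf u t Hut; destruct (Hf u t (HD _ Hut)) as [F [H1 H2]].
  exists F; split; [exact H1|].
  revert H2; apply locally_2d_impl, locally_2d_forall; auto.
Qed.

Lemma smooth_on_is_derive_u (D : R * R -> Prop) (f : R -> R -> R) (u t : R) :
  (forall u t, D (u, t) -> locally u (fun z => D (z, t))) ->
  smooth_on D f -> D (u, t) -> is_derive (fun z => f z t) u (du f u t).
Proof.
  intros HD Hf Hut; destruct (Hf u t Hut) as [F [H1 H2]].
  apply Derive_correct.
  destruct (locally_2d_singleton _ _ _ H1 1%nat) as [_ [[l Hl] _]].
  exists l; apply is_derive_ext_loc with (2 := Hl).
  apply locally_2d_1d_const_y in H2.
  generalize (filter_and _ _ H2 (HD u t Hut)); apply filter_imp; intros x [G1 G2].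
  symmetry; auto.
Qed.

Lemma smooth_on_is_derive_t (D : R * R -> Prop) (f : R -> R -> R) (u t : R) :
  (forall u t, D (u, t) -> locally t (fun s => D (u, s))) ->
  smooth_on D f -> D (u, t) -> is_derive (fun s => f u s) t (dt f u t).
Proof.
  intros HD Hf Hut; destruct (Hf u t Hut) as [F [H1 H2]].
  apply Derive_correct.
  destruct (locally_2d_singleton _ _ _ H1 1%nat) as [_ [_ [[l Hl] _]]].
  exists l; apply is_derive_ext_loc with (2 := Hl).
  apply locally_2d_1d_const_x in H2.
  generalize (filter_and _ _ H2 (HD u t Hut)); apply filter_imp; intros x [G1 G2].
  symmetry; auto.
Qed.

Lemma smooth_on_continuity (D : R * R -> Prop) (f : R -> R -> R) (u t : R) :
  smooth_on D f -> D (u, t) ->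
  forall eps : posreal,
    locally_2d (fun z s => D (z, s) -> Rabs (f z s - f u t) < eps) u t.
Proof.
  intros Hf Hut eps; destruct (Hf u t Hut) as [F [H1 H2]].
  destruct (locally_2d_singleton _ _ _ H1 0%nat) as [HC _].
  assert (E0 := locally_2d_singleton _ _ _ H2 Hut).
  generalize (locally_2d_and _ _ _ _ H2 (HC eps)).
  apply locally_2d_impl, locally_2d_forall; intros z s [G1 G2] Hzs.
  rewrite (G1 Hzs), E0; exact G2.
Qed.

Lemma smooth_on_continuous_2 (D : R * R -> Prop) (f : R -> R -> R) (u t : R) :
  locally_2d (fun z s => D (z, s)) u t -> smooth_on D f -> continuous_2 f u t.
Proof.
  intros HD Hf; apply continuity_2d_pt_filterlim; intros eps.
  generalize (locally_2d_and _ _ _ _ HD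
    (smooth_on_continuity D f u t Hf (locally_2d_singleton _ _ _ HD) eps)).
  apply locally_2d_impl, locally_2d_forall; intros z s [G1 G2]; auto.
Qed.

Lemma smooth_on_mixed_partials (D : R * R -> Prop) (f : R -> R -> R) (u t : R) :
  (forall u t, D (u, t) -> locally_2d (fun z s => D (z, s)) u t) ->
  smooth_on D f -> D (u, t) -> dt (du f) u t = du (dt f) u t.
Proof.
  intros HD Hf Hut.
  assert (HDu : forall u t, D (u, t) -> locally u (fun z => D (z, t)))
    by (intros z s Hzs; exact (locally_2d_1d_const_y _ _ _ (HD z s Hzs))).
  assert (HDt : forall u t, D (u, t) -> locally t (fun s => D (u, s)))
    by (intros z s Hzs; exact (locally_2d_1d_const_x _ _ _ (HD z s Hzs))).
  assert (Hfu := smooth_on_du D f HDu Hf); assert (Hft := smooth_on_dt D f HDt Hf).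
  symmetry; apply Schwarz.
  - generalize (HD u t Hut); apply locally_2d_impl, locally_2d_forall; intros z s Hzs.
    repeat split.
    + eexists; exact (smooth_on_is_derive_u D f z s HDu Hf Hzs).
    + eexists; exact (smooth_on_is_derive_t D f z s HDt Hf Hzs).
    + eexists; exact (smooth_on_is_derive_u D (dt f) z s HDu Hft Hzs).
    + eexists; exact (smooth_on_is_derive_t D (du f) z s HDt Hfu Hzs).
  - apply continuity_2d_pt_filterlim.
    apply (smooth_on_continuous_2 D (du (dt f)) u t (HD u t Hut)), smooth_on_du; assumption.
  - apply continuity_2d_pt_filterlim.
    apply (smooth_on_continuous_2 D (dt (du f)) u t (HD u t Hut)), smooth_on_dt; assumption.
Qed.

(** * Curve shortening flow in coordinates *)

Definition coord_x (gamma : R -> R -> R * R) (u t : R) : R := fst (gamma u t).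
Definition coord_y (gamma : R -> R -> R * R) (u t : R) : R := snd (gamma u t).

Definition flow_domain (alpha beta T : Rbar) : R * R -> Prop :=
  product_set (Rbar_interval alpha beta) (time_interval T).
Definition open_flow_domain (alpha beta T : Rbar) : R * R -> Prop :=
  product_set (Rbar_interval alpha beta) (positive_part (time_interval T)).

(** [pf_equation] is the normal component of the flow equation multiplied by the
    speed, which removes the square roots. *)
Record planar_flow (alpha beta T : Rbar) (x y : R -> R -> R) : Prop := {
  pf_smooth_x : smooth_on (flow_domain alpha beta T) x;
  pf_smooth_y : smooth_on (flow_domain alpha beta T) y;
  pf_immersed : forall u t : R, Rbar_interval alpha beta u -> time_interval T t ->
    0 < du x u t ^ 2 + du y u t ^ 2;
  pf_equation : forall u t : R, Rbar_interval alpha beta u ->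
    positive_part (time_interval T) t ->
    du x u t * dt y u t - du y u t * dt x u t
    = angular_rate (du x u t) (du y u t) (du (du x) u t) (du (du y) u t)
}.

Lemma flow_domain_slices (alpha beta T : Rbar) (u t : R) :
  flow_domain alpha beta T (u, t) ->
  locally u (fun z => flow_domain alpha beta T (z, t)).
Proof.
  intros [Hu Ht]; generalize (Rbar_interval_open alpha beta u Hu).
  apply filter_imp; intros z Hz; split; assumption.
Qed.

Lemma open_flow_domain_open (alpha beta T : Rbar) (u t : R) :
  open_flow_domain alpha beta T (u, t) ->
  locally_2d (fun z s => open_flow_domain alpha beta T (z, s)) u t.
Proof.
  intros [Hu [[_ HtT] Ht]]; simpl in Hu, HtT, Ht.
  destruct (Rbar_interval_open alpha beta u Hu) as [d1 H1].
  assert (Hloc : locally t (fun s => 0 < s /\ Rbar_lt s T)).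
  { apply filter_and; [exact (open_gt 0 t Ht) | exact (open_Rbar_lt T t HtT)]. }
  destruct Hloc as [d2 H2].
  exists (mkposreal (Rmin d1 d2) (Rmin_stable_in_posreal d1 d2)); simpl.
  intros z s Hz Hs.
  assert (Hz' := H1 z (Rlt_le_trans _ _ _ Hz (Rmin_l _ _))).
  destruct (H2 s (Rlt_le_trans _ _ _ Hs (Rmin_r _ _))) as [G1 G2].
  split; [exact Hz'|]; split; [split; [exact (Rlt_le _ _ G1) | exact G2] | exact G1].
Qed.

Lemma open_flow_domain_incl (alpha beta T : Rbar) p :
  open_flow_domain alpha beta T p -> flow_domain alpha beta T p.
Proof. intros [H1 [H2 _]]; split; assumption. Qed.

Lemma open_flow_domain_slices_u (alpha beta T : Rbar) (u t : R) :
  open_flow_domain alpha beta T (u, t) ->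
  locally u (fun z => open_flow_domain alpha beta T (z, t)).
Proof. intros H; exact (locally_2d_1d_const_y _ _ _ (open_flow_domain_open _ _ _ u t H)). Qed.

Lemma open_flow_domain_slices_t (alpha beta T : Rbar) (u t : R) :
  open_flow_domain alpha beta T (u, t) ->
  locally t (fun s => open_flow_domain alpha beta T (u, s)).
Proof. intros H; exact (locally_2d_1d_const_x _ _ _ (open_flow_domain_open _ _ _ u t H)). Qed.

Lemma csf_planar_flow (alpha beta T : Rbar) (gamma : R -> R -> R * R) :
  uniformly_proper_solution (Rbar_interval alpha beta) (time_interval T) gamma ->
  smooth_down_to_0 (Rbar_interval alpha beta) T gamma ->
  planar_flow alpha beta T (coord_x gamma) (coord_y gamma).
Proof.
  intros Hups [[Hx Hy] Himm0].
  assert (Himm : forall u t : R, Rbar_interval alpha beta u -> time_interval T t ->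
    0 < du (coord_x gamma) u t ^ 2 + du (coord_y gamma) u t ^ 2).
  { intros u t Hu Ht.
    assert (Hv : velocity (fun u => gamma u t) u <> (0, 0)).
    { destruct (Req_dec t 0) as [->|Hne]; [exact (Himm0 u Hu)|].
      apply (ups_immersed _ _ _ Hups); [|exact Hu].
      split; [exact Ht | destruct Ht; lra]. }
    unfold velocity in Hv.
    change (Derive (fun s => fst (gamma s t)) u) with (du (coord_x gamma) u t) in Hv.
    change (Derive (fun s => snd (gamma s t)) u) with (du (coord_y gamma) u t) in Hv.
    apply Rnot_le_lt; intros Hle; apply Hv; f_equal; nra. }
  split; [exact Hx | exact Hy | exact Himm |].
  set (x := coord_x gamma) in *; set (y := coord_y gamma) in *.
  intros u t Hu Ht.
  assert (HD : flow_domain alpha beta T (u, t)) by (split; [exact Hu | exact (proj1 Ht)]).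
  assert (Dx := smooth_on_du _ x (flow_domain_slices alpha beta T) Hx).
  assert (Dy := smooth_on_du _ y (flow_domain_slices alpha beta T) Hy).
  destruct (curvature_components (fun z => gamma z t) (fun z => du x z t) (fun z => du y z t)
    u (du (du x) u t) (du (du y) u t)) as [Hn Hk].
  - generalize (flow_domain_slices alpha beta T u t HD); apply filter_imp; intros z Hz; split.
    + exact (smooth_on_is_derive_u _ x z t (flow_domain_slices alpha beta T) Hx Hz).
    + exact (smooth_on_is_derive_u _ y z t (flow_domain_slices alpha beta T) Hy Hz).
  - exact (smooth_on_is_derive_u _ (du x) u t (flow_domain_slices alpha beta T) Dx HD).
  - exact (smooth_on_is_derive_u _ (du y) u t (flow_domain_slices alpha beta T) Dy HD).
  - exact (Himm u t Hu (proj1 Ht)).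
  - generalize (ups_flow _ _ _ Hups u t Hu Ht); unfold csf_equation; rewrite Hn, Hk.
    unfold dot; simpl; unfold velocity; simpl.
    change (Derive (fun s => fst (gamma u s)) t) with (dt x u t).
    change (Derive (fun s => snd (gamma u s)) t) with (dt y u t).
    set (n := sqrt _); set (k := angular_rate _ _ _ _).
    assert (Hnpos : 0 < n) by (apply sqrt_lt_R0, (Himm u t Hu (proj1 Ht))).
    intros He.
    replace (du x u t * dt y u t - du y u t * dt x u t)
      with ((dt x u t * - (du y u t / n) + dt y u t * (du x u t / n)) * n) by (field; lra).
    replace k with (- - (k / n) * n) by (field; lra).
    rewrite He; reflexivity.
Qed.

(** The flow equation fixes the normal component of the velocity only; the
    tangential one is absorbed in the drift [b]. *)
Lemma planar_flow_parametric (alpha beta T : Rbar) (x y : R -> R -> R) (u t : R) :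
  planar_flow alpha beta T x y -> open_flow_domain alpha beta T (u, t) ->
  exists a b, 0 <= a /\ a * (du x u t ^ 2 + du y u t ^ 2) = 1 /\
    dt x u t = a * du (du x) u t + b * du x u t /\
    dt y u t = a * du (du y) u t + b * du y u t.
Proof.
  intros Hpf HD; destruct HD as [Hu Ht]; simpl in Hu, Ht.
  assert (HS := pf_immersed _ _ _ _ _ Hpf u t Hu (proj1 Ht)).
  assert (HE := pf_equation _ _ _ _ _ Hpf u t Hu Ht).
  unfold angular_rate in HE.
  set (S := du x u t ^ 2 + du y u t ^ 2) in *.
  set (p := du x u t) in *; set (q := du y u t) in *.
  set (p' := du (du x) u t) in *; set (q' := du (du y) u t) in *.
  exists (/ S), (((dt x u t - p' / S) * p + (dt y u t - q' / S) * q) / S).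
  assert (HE' : q * (dt x u t - p' / S) = p * (dt y u t - q' / S)).
  { replace (p * (dt y u t - q' / S)) with
      ((p * dt y u t - q * dt x u t) + q * dt x u t - p * q' / S) by (field; lra).
    rewrite HE; field; lra. }
  split; [apply Rlt_le, Rinv_0_lt_compat, HS|]; split; [field; lra|].
  set (m := dt x u t - p' / S) in *; set (n := dt y u t - q' / S) in *.
  split.
  - assert (H : (m * p + n * q) * p = m * S).
    { unfold S; transitivity (m * p ^ 2 + q * (p * n)); [ring | rewrite <- HE'; ring]. }
    replace (/ S * p' + (m * p + n * q) / S * p) with (p' / S + (m * p + n * q) * p / S)
      by (field; lra).
    rewrite H; unfold m; field; lra.
  - assert (H : (m * p + n * q) * q = n * S).
    { unfold S; transitivity (p * (q * m) + n * q ^ 2); [ring | rewrite HE'; ring]. }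
    replace (/ S * q' + (m * p + n * q) / S * q) with (q' / S + (m * p + n * q) * q / S)
      by (field; lra).
    rewrite H; unfold n; field; lra.
Qed.

Lemma planar_flow_evolves (alpha beta T : Rbar) (x y : R -> R -> R) (u t : R) :
  planar_flow alpha beta T x y -> open_flow_domain alpha beta T (u, t) ->
  exists a b, 0 <= a /\ a * (du x u t ^ 2 + du y u t ^ 2) = 1 /\
    dt x u t = a * du (du x) u t + b * du x u t /\
    dt y u t = a * du (du y) u t + b * du y u t /\
    evolves a b 0 x u t /\ evolves a b 0 y u t /\
    evolves a b (-2) (fun z s => x z s ^ 2 + y z s ^ 2) u t.
Proof.
  intros Hpf HD.
  destruct (planar_flow_parametric _ _ _ x y u t Hpf HD) as (a & b & Ha & HaS & Ex & Ey).
  exists a, b; repeat (split; [assumption|]).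
  assert (HDu := open_flow_domain_slices_u alpha beta T).
  assert (HDt := open_flow_domain_slices_t alpha beta T).
  assert (Sx := smooth_on_subset _ _ x (open_flow_domain_incl alpha beta T)
                 (pf_smooth_x _ _ _ _ _ Hpf)).
  assert (Sy := smooth_on_subset _ _ y (open_flow_domain_incl alpha beta T)
                 (pf_smooth_y _ _ _ _ _ Hpf)).
  assert (Sxu := smooth_on_du _ x HDu Sx); assert (Syu := smooth_on_du _ y HDu Sy).
  assert (Lx : locally u (fun z => is_derive (fun v => x v t) z (du x z t) /\
                                   is_derive (fun v => y v t) z (du y z t))).
  { generalize (HDu u t HD); apply filter_imp; intros z Hz; split.
    - exact (smooth_on_is_derive_u _ x z t HDu Sx Hz).
    - exact (smooth_on_is_derive_u _ y z t HDu Sy Hz). }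
  assert (Dxu := smooth_on_is_derive_u _ (du x) u t HDu Sxu HD).
  assert (Dyu := smooth_on_is_derive_u _ (du y) u t HDu Syu HD).
  assert (Dxt := smooth_on_is_derive_t _ x u t HDt Sx HD).
  assert (Dyt := smooth_on_is_derive_t _ y u t HDt Sy HD).
  split; [|split].
  - exists (fun z => du x z t), (du (du x) u t), (dt x u t).
    split; [|split; [exact Dxu | split; [exact Dxt | rewrite Ex; ring]]].
    apply filter_imp with (2 := Lx); tauto.
  - exists (fun z => du y z t), (du (du y) u t), (dt y u t).
    split; [|split; [exact Dyu | split; [exact Dyt | rewrite Ey; ring]]].
    apply filter_imp with (2 := Lx); tauto.
  - assert (Hsq : forall (f g : R -> R) (s f' g' : R), is_derive f s f' -> is_derive g s g' ->
              is_derive (fun z => f z ^ 2 + g z ^ 2) s (2 * f s * f' + 2 * g s * g')).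
    { intros f g s f' g' Hf Hg; auto_derive.
      - split; [now exists f' | split; [now exists g' | exact I]].
      - replace (Derive (fun z => f z) s) with f' by (symmetry; apply is_derive_unique, Hf).
        replace (Derive (fun z => g z) s) with g' by (symmetry; apply is_derive_unique, Hg).
        ring. }
    assert (Hmul : forall (f g f1 g1 : R -> R) (s f' g' f1' g1' : R),
              is_derive f s f' -> is_derive g s g' -> is_derive f1 s f1' -> is_derive g1 s g1' ->
              is_derive (fun z => 2 * f z * f1 z + 2 * g z * g1 z) s
                (2 * (f' * f1 s + f s * f1' + (g' * g1 s + g s * g1')))).
    { intros f g f1 g1 s f' g' f1' g1' Hf Hg Hf1 Hg1; auto_derive.
      - repeat (split; [eexists; eassumption|]); exact I.
      - replace (Derive (fun z => f z) s) with f' by (symmetry; apply is_derive_unique, Hf).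
        replace (Derive (fun z => g z) s) with g' by (symmetry; apply is_derive_unique, Hg).
        replace (Derive (fun z => f1 z) s) with f1' by (symmetry; apply is_derive_unique, Hf1).
        replace (Derive (fun z => g1 z) s) with g1' by (symmetry; apply is_derive_unique, Hg1).
        ring. }
    destruct (locally_singleton _ _ Lx) as [Dx Dy].
    exists (fun z => 2 * x z t * du x z t + 2 * y z t * du y z t),
      (2 * (du x u t * du x u t + x u t * du (du x) u t
            + (du y u t * du y u t + y u t * du (du y) u t))),
      (2 * x u t * dt x u t + 2 * y u t * dt y u t).
    split; [|split; [|split]].
    + apply filter_imp with (2 := Lx); intros z [H1 H2].
      exact (Hsq (fun v => x v t) (fun v => y v t) z _ _ H1 H2).
    + exact (Hmul (fun v => x v t) (fun v => y v t) (fun v => du x v t) (fun v => du y v t)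
               u _ _ _ _ Dx Dy Dxu Dyu).
    + exact (Hsq (fun s => x u s) (fun s => y u s) t _ _ Dxt Dyt).
    + rewrite Ex, Ey.
      replace (-2) with (- 2 * (a * (du x u t ^ 2 + du y u t ^ 2))) by (rewrite HaS; ring).
      ring.
Qed.

(** * The Harnack quantity *)

Definition wedge_rate (x y : R -> R -> R) (u t : R) : R :=
  du x u t * y u t - du y u t * x u t.

Definition turning_rate (x y : R -> R -> R) (u t : R) : R :=
  angular_rate (du x u t) (du y u t) (du (du x) u t) (du (du y) u t).

Definition harnack_density (x y : R -> R -> R) (u t : R) : R :=
  1 / 2 * wedge_rate x y u t - t * turning_rate x y u t.

(** [1/2 *(gamma_t /\ gamma) - t psi_t]: the tangent angle [psi] is the angle of
    [(du x, du y)], and the time derivative of this vector is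
    [(du (dt x), du (dt y))]. *)
Definition harnack_flux (x y : R -> R -> R) (u t : R) : R :=
  1 / 2 * (dt x u t * y u t - dt y u t * x u t)
  - t * angular_rate (du x u t) (du y u t) (du (dt x) u t) (du (dt y) u t).

Lemma is_derive_wedge (p q m n : R -> R) (s p' q' m' n' : R) :
  is_derive p s p' -> is_derive q s q' -> is_derive m s m' -> is_derive n s n' ->
  is_derive (fun z => p z * n z - q z * m z) s (p' * n s + p s * n' - (q' * m s + q s * m')).
Proof.
  intros Hp Hq Hm Hn; auto_derive.
  - repeat (split; [eexists; eassumption|]); exact I.
  - replace (Derive (fun z => p z) s) with p' by (symmetry; apply is_derive_unique, Hp).
    replace (Derive (fun z => q z) s) with q' by (symmetry; apply is_derive_unique, Hq).
    replace (Derive (fun z => m z) s) with m' by (symmetry; apply is_derive_unique, Hm).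
    replace (Derive (fun z => n z) s) with n' by (symmetry; apply is_derive_unique, Hn).
    ring.
Qed.

(** The derivative of [angular_rate (p, q, m, n)] when the four arguments have
    the derivatives [p'], [q'], [m'], [n']. *)
Definition angular_rate_derivative (p q m n p' q' m' n' : R) : R :=
  ((p' * n + p * n' - (q' * m + q * m')) * (p ^ 2 + q ^ 2)
   - (p * n - q * m) * (2 * p * p' + 2 * q * q')) / (p ^ 2 + q ^ 2) ^ 2.

Lemma is_derive_angular_rate (p q m n : R -> R) (s p' q' m' n' : R) :
  is_derive p s p' -> is_derive q s q' -> is_derive m s m' -> is_derive n s n' ->
  0 < p s ^ 2 + q s ^ 2 ->
  is_derive (fun z => angular_rate (p z) (q z) (m z) (n z)) s
    (angular_rate_derivative (p s) (q s) (m s) (n s) p' q' m' n').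
Proof.
  intros Hp Hq Hm Hn HS; unfold angular_rate, angular_rate_derivative; auto_derive.
  - repeat (split; [eexists; eassumption|]); split; [simpl in HS; lra | exact I].
  - replace (Derive (fun z => p z) s) with p' by (symmetry; apply is_derive_unique, Hp).
    replace (Derive (fun z => q z) s) with q' by (symmetry; apply is_derive_unique, Hq).
    replace (Derive (fun z => m z) s) with m' by (symmetry; apply is_derive_unique, Hm).
    replace (Derive (fun z => n z) s) with n' by (symmetry; apply is_derive_unique, Hn).
    field; lra.
Qed.

Definition harnack_density_dt (x y : R -> R -> R) (u t : R) : R :=
  1 / 2 * (du (dt x) u t * y u t + du x u t * dt y u t
           - (du (dt y) u t * x u t + du y u t * dt x u t))
  - (turning_rate x y u t
     + t * angular_rate_derivative (du x u t) (du y u t) (du (du x) u t) (du (du y) u t)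
             (du (dt x) u t) (du (dt y) u t) (du (du (dt x)) u t) (du (du (dt y)) u t)).

Lemma is_derive_density (f k : R -> R) (s f' k' : R) :
  is_derive f s f' -> is_derive k s k' ->
  is_derive (fun z => 1 / 2 * f z - z * k z) s (1 / 2 * f' - (k s + s * k')).
Proof.
  intros Hf Hk; auto_derive.
  - repeat (split; [eexists; eassumption|]); exact I.
  - replace (Derive (fun z => f z) s) with f' by (symmetry; apply is_derive_unique, Hf).
    replace (Derive (fun z => k z) s) with k' by (symmetry; apply is_derive_unique, Hk).
    field.
Qed.

Lemma is_derive_density_const (f k : R -> R) (t s f' k' : R) :
  is_derive f s f' -> is_derive k s k' ->
  is_derive (fun z => 1 / 2 * f z - t * k z) s (1 / 2 * f' - t * k').
Proof.
  intros Hf Hk; auto_derive.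
  - repeat (split; [eexists; eassumption|]); exact I.
  - replace (Derive (fun z => f z) s) with f' by (symmetry; apply is_derive_unique, Hf).
    replace (Derive (fun z => k z) s) with k' by (symmetry; apply is_derive_unique, Hk).
    field.
Qed.

(** The partial derivatives that enter the evolution of the Harnack quantity,
    with the mixed ones taken in the order [du (dt x)]. *)
Record flow_derivatives (x : R -> R -> R) (u t : R) : Prop := {
  fd_u : is_derive (fun z => x z t) u (du x u t);
  fd_t : is_derive (fun s => x u s) t (dt x u t);
  fd_uu : is_derive (fun z => du x z t) u (du (du x) u t);
  fd_ut : is_derive (fun s => du x u s) t (du (dt x) u t);
  fd_tu : is_derive (fun z => dt x z t) u (du (dt x) u t);
  fd_uuu : is_derive (fun z => du (du x) z t) u (du (du (du x)) u t);
  fd_uut : is_derive (fun s => du (du x) u s) t (du (du (dt x)) u t);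
  fd_utu : is_derive (fun z => du (dt x) z t) u (du (du (dt x)) u t);
  fd_continuous : continuous_2 x u t /\ continuous_2 (dt x) u t /\
    continuous_2 (du x) u t /\ continuous_2 (du (du x)) u t /\
    continuous_2 (du (dt x)) u t /\ continuous_2 (du (du (dt x))) u t
}.

Lemma smooth_flow_derivatives (alpha beta T : Rbar) (x : R -> R -> R) (u t : R) :
  smooth_on (flow_domain alpha beta T) x -> open_flow_domain alpha beta T (u, t) ->
  flow_derivatives x u t.
Proof.
  intros Sx0 HD; set (D := open_flow_domain alpha beta T) in *.
  assert (Sx := smooth_on_subset _ D x (open_flow_domain_incl alpha beta T) Sx0).
  assert (HDo : forall u t, D (u, t) -> locally_2d (fun z s => D (z, s)) u t)
    by exact (open_flow_domain_open alpha beta T).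
  assert (HDu : forall u t, D (u, t) -> locally u (fun z => D (z, t)))
    by exact (open_flow_domain_slices_u alpha beta T).
  assert (HDt : forall u t, D (u, t) -> locally t (fun s => D (u, s)))
    by exact (open_flow_domain_slices_t alpha beta T).
  assert (Su := smooth_on_du D x HDu Sx); assert (St := smooth_on_dt D x HDt Sx).
  assert (Suu := smooth_on_du D _ HDu Su); assert (Stu := smooth_on_du D _ HDu St).
  assert (Stuu := smooth_on_du D _ HDu Stu).
  assert (Hut : forall z s, D (z, s) -> dt (du x) z s = du (dt x) z s)
    by (intros z s; apply smooth_on_mixed_partials; assumption).
  assert (Huut : dt (du (du x)) u t = du (du (dt x)) u t).
  { rewrite (smooth_on_mixed_partials D (du x) u t HDo Su HD).
    apply Derive_ext_loc; generalize (HDu u t HD); apply filter_imp; intros z Hz.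
    exact (Hut z t Hz). }
  split.
  - exact (smooth_on_is_derive_u D x u t HDu Sx HD).
  - exact (smooth_on_is_derive_t D x u t HDt Sx HD).
  - exact (smooth_on_is_derive_u D _ u t HDu Su HD).
  - rewrite <- (Hut u t HD); exact (smooth_on_is_derive_t D _ u t HDt Su HD).
  - exact (smooth_on_is_derive_u D _ u t HDu St HD).
  - exact (smooth_on_is_derive_u D _ u t HDu Suu HD).
  - rewrite <- Huut; exact (smooth_on_is_derive_t D _ u t HDt Suu HD).
  - exact (smooth_on_is_derive_u D _ u t HDu Stu HD).
  - repeat split; apply (smooth_on_continuous_2 D); auto.
Qed.

(** The identity behind the theorem.  The first term of the density gives
    [du] of half the wedge of velocity and position plus the turning rate, by the
    flow equation; the explicit factor [t] in the second term cancels this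
    turning rate, and the rest is the closedness of the form [d psi]. *)
Lemma harnack_density_conservation (alpha beta T : Rbar) (x y : R -> R -> R) (u t : R) :
  planar_flow alpha beta T x y -> open_flow_domain alpha beta T (u, t) ->
  is_derive (fun s => harnack_density x y u s) t (harnack_density_dt x y u t) /\
  is_derive (fun z => harnack_flux x y z t) u (harnack_density_dt x y u t).
Proof.
  intros Hpf HD.
  destruct (smooth_flow_derivatives alpha beta T x u t (pf_smooth_x _ _ _ _ _ Hpf) HD)
    as [X1 X2 X3 X4 X5 X6 X7 X8 _].
  destruct (smooth_flow_derivatives alpha beta T y u t (pf_smooth_y _ _ _ _ _ Hpf) HD)
    as [Y1 Y2 Y3 Y4 Y5 Y6 Y7 Y8 _].
  assert (HS := pf_immersed _ _ _ _ _ Hpf u t (proj1 HD) (proj1 (proj2 HD))).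
  assert (HE := pf_equation _ _ _ _ _ Hpf u t (proj1 HD) (proj2 HD)).
  split.
  - apply (is_derive_density (fun s => wedge_rate x y u s) (fun s => turning_rate x y u s)).
    + exact (is_derive_wedge (fun s => du x u s) (fun s => du y u s) (fun s => x u s)
               (fun s => y u s) t _ _ _ _ X4 Y4 X2 Y2).
    + exact (is_derive_angular_rate (fun s => du x u s) (fun s => du y u s)
        (fun s => du (du x) u s) (fun s => du (du y) u s) t _ _ _ _ X4 Y4 X7 Y7 HS).
  - assert (HF : is_derive (fun z => harnack_flux x y z t) u
        (1 / 2 * (du (dt x) u t * y u t + dt x u t * du y u t
                  - (du (dt y) u t * x u t + dt y u t * du x u t))
         - t * angular_rate_derivative (du x u t) (du y u t) (du (dt x) u t) (du (dt y) u t)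
             (du (du x) u t) (du (du y) u t) (du (du (dt x)) u t) (du (du (dt y)) u t))).
    { apply (is_derive_density_const (fun z => dt x z t * y z t - dt y z t * x z t)
         (fun z => angular_rate (du x z t) (du y z t) (du (dt x) z t) (du (dt y) z t))).
      - exact (is_derive_wedge (fun z => dt x z t) (fun z => dt y z t) (fun z => x z t)
                 (fun z => y z t) u _ _ _ _ X5 Y5 X1 Y1).
      - exact (is_derive_angular_rate (fun z => du x z t) (fun z => du y z t)
          (fun z => du (dt x) z t) (fun z => du (dt y) z t) u _ _ _ _ X3 Y3 X8 Y8 HS). }
    replace (harnack_density_dt x y u t) with
       (1 / 2 * (du (dt x) u t * y u t + dt x u t * du y u t
                  - (du (dt y) u t * x u t + dt y u t * du x u t))
         - t * angular_rate_derivative (du x u t) (du y u t) (du (dt x) u t) (du (dt y) u t)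
             (du (du x) u t) (du (du y) u t) (du (du (dt x)) u t) (du (du (dt y)) u t));
      [exact HF|].
    unfold harnack_density_dt, turning_rate; rewrite <- HE.
    assert (Hclosed : forall p q p1 q1 p2 q2 p3 q3, 0 < p ^ 2 + q ^ 2 ->
       angular_rate_derivative p q p1 q1 p2 q2 p3 q3
       = angular_rate_derivative p q p2 q2 p1 q1 p3 q3)
      by (intros; unfold angular_rate_derivative; field; lra).
    rewrite (Hclosed _ _ (du (dt x) u t) (du (dt y) u t)) by exact HS.
    field.
Qed.

(** For the turning part this says that the tangent angle satisfies the flow's
    linear equation; it follows by differentiating the flow equation in [u]. *)
Lemma harnack_flux_equation (alpha beta T : Rbar) (x y : R -> R -> R) (u t a b : R) :
  planar_flow alpha beta T x y -> open_flow_domain alpha beta T (u, t) ->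
  a * (du x u t ^ 2 + du y u t ^ 2) = 1 ->
  dt x u t = a * du (du x) u t + b * du x u t ->
  dt y u t = a * du (du y) u t + b * du y u t ->
  exists gu, is_derive (fun z => harnack_density x y z t) u gu /\
    harnack_flux x y u t = a * gu + b * harnack_density x y u t.
Proof.
  intros Hpf HD HaS Ex Ey.
  destruct (smooth_flow_derivatives alpha beta T x u t (pf_smooth_x _ _ _ _ _ Hpf) HD)
    as [X1 _ X3 _ X5 X6 _ _ _].
  destruct (smooth_flow_derivatives alpha beta T y u t (pf_smooth_y _ _ _ _ _ Hpf) HD)
    as [Y1 _ Y3 _ Y5 Y6 _ _ _].
  assert (HS := pf_immersed _ _ _ _ _ Hpf u t (proj1 HD) (proj1 (proj2 HD))).
  assert (HE := pf_equation _ _ _ _ _ Hpf u t (proj1 HD) (proj2 HD)).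
  set (k' := angular_rate_derivative (du x u t) (du y u t) (du (du x) u t) (du (du y) u t)
       (du (du x) u t) (du (du y) u t) (du (du (du x)) u t) (du (du (du y)) u t)).
  assert (Dk : is_derive (fun z => turning_rate x y z t) u k').
  { exact (is_derive_angular_rate (fun z => du x z t) (fun z => du y z t)
        (fun z => du (du x) z t) (fun z => du (du y) z t) u _ _ _ _ X3 Y3 X6 Y6 HS). }
  assert (Ek : k' = du (du x) u t * dt y u t + du x u t * du (dt y) u t
                    - (du (du y) u t * dt x u t + du y u t * du (dt x) u t)).
  { assert (D2 := is_derive_wedge (fun z => du x z t) (fun z => du y z t) (fun z => dt x z t)
                 (fun z => dt y z t) u _ _ _ _ X3 Y3 X5 Y5).
    rewrite <- (is_derive_unique _ _ _ Dk), <- (is_derive_unique _ _ _ D2).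
    apply Derive_ext_loc.
    generalize (open_flow_domain_slices_u alpha beta T u t HD); apply filter_imp.
    intros z Hz; symmetry; exact (pf_equation _ _ _ _ _ Hpf z t (proj1 Hz) (proj2 Hz)). }
  exists (1 / 2 * (du (du x) u t * y u t + du x u t * du y u t
                   - (du (du y) u t * x u t + du y u t * du x u t)) - t * k'); split.
  - apply (is_derive_density_const (fun z => wedge_rate x y z t) (fun z => turning_rate x y z t)).
    + exact (is_derive_wedge (fun z => du x z t) (fun z => du y z t) (fun z => x z t)
               (fun z => y z t) u _ _ _ _ X3 Y3 X1 Y1).
    + exact Dk.
  - unfold harnack_flux, harnack_density, wedge_rate, turning_rate.
    assert (Har : forall m n, angular_rate (du x u t) (du y u t) m n
                    = a * (du x u t * n - du y u t * m)).
    { intros m n; unfold angular_rate.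
      replace a with (/ (du x u t ^ 2 + du y u t ^ 2)); [unfold Rdiv; ring|].
      apply Rmult_eq_reg_r with (du x u t ^ 2 + du y u t ^ 2); [|lra].
      rewrite HaS; apply Rinv_l; lra. }
    rewrite !Har, Ek, Ex, Ey; ring.
Qed.

Lemma cont_angular_rate {U : UniformSpace} (p q m n : U -> R) (x : U) :
  continuous p x -> continuous q x -> continuous m x -> continuous n x ->
  0 < p x ^ 2 + q x ^ 2 ->
  continuous (fun y => angular_rate (p y) (q y) (m y) (n y)) x.
Proof.
  intros Hp Hq Hm Hn HS; unfold angular_rate, Rdiv.
  apply cont_mult; [apply cont_minus; now apply cont_mult|].
  apply (cont_inv (fun y => p y ^ 2 + q y ^ 2)); [now apply continuous_sq_sum | lra].
Qed.

Lemma cont_density {U : UniformSpace} (x y p q m n s : U -> R) (z : U) :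
  continuous x z -> continuous y z -> continuous p z -> continuous q z ->
  continuous m z -> continuous n z -> continuous s z -> 0 < p z ^ 2 + q z ^ 2 ->
  continuous (fun v => 1 / 2 * (p v * y v - q v * x v)
                       - s v * angular_rate (p v) (q v) (m v) (n v)) z.
Proof.
  intros; apply cont_minus.
  - apply cont_mult; [apply continuous_const|].
    apply cont_minus; now apply cont_mult.
  - apply cont_mult; [assumption | now apply cont_angular_rate].
Qed.

(** The integrand is uniformly continuous near the segment [[u0, u]] at time [t],
    and bounded near [(u, t)]. *)
Lemma continuous_2_RInt (alpha beta : Rbar) (g : R -> R -> R) (u0 u t : R) :
  Rbar_interval alpha beta u0 -> Rbar_interval alpha beta u ->
  (forall z : R, Rbar_interval alpha beta z -> continuous_2 g z t) ->
  locally t (fun s => forall z : R, Rbar_interval alpha beta z ->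
               continuous (fun v => g v s) z) ->
  continuous_2 (fun v s => RInt (fun z => g z s) u0 v) u t.
Proof.
  intros Hu0 Hu Hg [d0 Hgs].
  apply (proj1 (continuity_2d_pt_filterlim
           (fun v s => RInt (fun z => g z s) u0 v) u t)); intros eps.
  assert (Hint : forall s a b : R, Rabs (s - t) < d0 ->
            Rbar_interval alpha beta a -> Rbar_interval alpha beta b ->
            ex_RInt (fun z => g z s) a b).
  { intros s a b Hs Ha Hb; apply (ex_RInt_continuous (V := R_CompleteNormedModule)).
    intros z Hz; apply (Hgs s Hs), (Rbar_interval_convex alpha beta a b); assumption. }
  assert (Ht0 : Rabs (t - t) < d0) by (rewrite Rminus_diag, Rabs_R0; apply cond_pos).
  set (e1 := eps / (2 * (Rabs (u - u0) + 1))).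
  assert (He1 : 0 < e1).
  { apply Rdiv_lt_0_compat; [apply cond_pos|]; generalize (Rabs_pos (u - u0)); lra. }
  assert (He1' : Rabs (u - u0) * e1 <= eps / 2).
  { assert (H : e1 * (2 * (Rabs (u - u0) + 1)) = eps).
    { unfold e1; field; generalize (Rabs_pos (u - u0)); lra. }
    lra. }
  destruct (uniform_continuity_2d_1d g (Rmin u0 u) (Rmax u0 u) t) with (eps := mkposreal e1 He1)
    as [d1 Hd1].
  { intros z Hz; apply continuity_2d_pt_filterlim, Hg.
    apply (Rbar_interval_convex alpha beta u0 u); assumption. }
  destruct (proj2 (continuity_2d_pt_filterlim g u t) (Hg u Hu) (mkposreal 1 Rlt_0_1))
    as [d2 Hd2]; simpl in Hd1, Hd2.
  destruct (Rbar_interval_open alpha beta u Hu) as [d3 Hd3].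
  set (B := Rabs (g u t) + 1).
  assert (HB : 0 < B) by (unfold B; generalize (Rabs_pos (g u t)); lra).
  set (d4 := eps / (4 * B)).
  assert (Hd4 : 0 < d4) by (apply Rdiv_lt_0_compat; [apply cond_pos | lra]).
  set (d := Rmin (Rmin (Rmin d0 d1) (Rmin d2 d3)) d4).
  assert (Hd : 0 < d).
  { unfold d; repeat apply Rmin_glb_lt; try apply cond_pos; exact Hd4. }
  assert (Hdle : d <= d0 /\ d <= d1 /\ d <= d2 /\ d <= d3 /\ d <= d4).
  { unfold d; generalize (Rmin_l (Rmin (Rmin d0 d1) (Rmin d2 d3)) d4),
      (Rmin_r (Rmin (Rmin d0 d1) (Rmin d2 d3)) d4), (Rmin_l (Rmin d0 d1) (Rmin d2 d3)),
      (Rmin_r (Rmin d0 d1) (Rmin d2 d3)), (Rmin_l d0 d1), (Rmin_r d0 d1),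
      (Rmin_l d2 d3), (Rmin_r d2 d3); lra. }
  exists (mkposreal d Hd); simpl; intros v s Hv Hs.
  assert (Hst : Rabs (s - t) < d0) by lra.
  assert (HIv : Rbar_interval alpha beta v) by (apply Hd3; change (Rabs (v - u) < d3); lra).
  assert (Hsplit : RInt (fun z => g z s) u0 v - RInt (fun z => g z t) u0 u
    = RInt (fun z => g z s - g z t) u0 u + RInt (fun z => g z s) u v).
  { assert (E1 := RInt_Chasles (V := R_CompleteNormedModule) (fun z => g z s) u0 u v
        (Hint s u0 u Hst Hu0 Hu) (Hint s u v Hst Hu HIv)).
    assert (E2 := RInt_minus (V := R_CompleteNormedModule) (fun z => g z s) (fun z => g z t) u0 u
        (Hint s u0 u Hst Hu0 Hu) (Hint t u0 u Ht0 Hu0 Hu)).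
    unfold plus, minus, opp in E1, E2; simpl in E1, E2.
    unfold plus, minus, opp in E2; simpl in E2.
    change (RInt (fun z => g z s - g z t) u0 u
            = RInt (fun z => g z s) u0 u - RInt (fun z => g z t) u0 u) in E2.
    rewrite E2, <- E1; ring. }
  rewrite Hsplit.
  assert (B1 : Rabs (RInt (fun z => g z s - g z t) u0 u) <= Rabs (u - u0) * e1).
  { apply (norm_RInt_le_const_abs (V := R_NormedModule) (fun z => g z s - g z t) u0 u).
    - intros z Hz; apply Rlt_le; apply Rabs_def2 in Hs; assert (Hp := cond_pos d1).
      change (Rabs (g z s - g z t) < e1); apply Hd1; try lra.
      rewrite Rminus_diag, Rabs_R0; exact Hp.
    - apply (RInt_correct (V := R_CompleteNormedModule)).
      apply (ex_RInt_minus (V := R_NormedModule)); apply Hint; assumption. }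
  assert (B2 : Rabs (RInt (fun z => g z s) u v) <= Rabs (v - u) * B).
  { apply (norm_RInt_le_const_abs (V := R_NormedModule) (fun z => g z s) u v).
    - intros z Hz; change (Rabs (g z s) <= B); unfold B.
      assert (Hzu : Rabs (z - u) < d2).
      { apply Rabs_def2 in Hv; apply Rabs_def1;
          unfold Rmin, Rmax in Hz; destruct (Rle_dec u v); lra. }
      generalize (Hd2 z s Hzu ltac:(lra)), (Rabs_triang_inv (g z s) (g u t)); lra.
    - apply (RInt_correct (V := R_CompleteNormedModule)), Hint; assumption. }
  assert (B3 : Rabs (v - u) * B <= eps / 4).
  { replace (eps / 4) with (d4 * B) by (unfold d4; field; lra).
    apply Rmult_le_compat_r; lra. }
  apply Rle_lt_trans with (1 := Rabs_triang _ _); generalize (cond_pos eps); lra.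
Qed.

(** Freezing the function before time [0] turns continuity up to the initial time
    into continuity on a neighbourhood of it. *)
Definition clamp (f : R -> R -> R) (u t : R) : R := f u (Rmax t 0).

Lemma clamp_id (f : R -> R -> R) (u t : R) : 0 <= t -> clamp f u t = f u t.
Proof. intros H; unfold clamp; rewrite Rmax_left by exact H; reflexivity. Qed.

Lemma continuous_clamp (alpha beta T : Rbar) (f : R -> R -> R) (u t : R) :
  smooth_on (flow_domain alpha beta T) f -> flow_domain alpha beta T (u, t) ->
  continuous_2 (clamp f) u t.
Proof.
  intros Hf HD; assert (HD' := HD); destruct HD' as [Hu [Ht HtT]]; simpl in Hu, Ht, HtT.
  apply continuity_2d_pt_filterlim; intros eps.
  destruct (smooth_on_continuity _ f u t Hf HD eps) as [d Hd].
  destruct (Rbar_interval_open alpha beta u Hu) as [d1 H1].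
  destruct (open_Rbar_lt T t HtT) as [d2 H2].
  exists (mkposreal (Rmin d (Rmin d1 d2))
           (Rmin_stable_in_posreal d (mkposreal _ (Rmin_stable_in_posreal d1 d2)))); simpl.
  intros z s Hz Hs.
  assert (Hm := Rmin_l d (Rmin d1 d2)); assert (Hm' := Rmin_r d (Rmin d1 d2)).
  assert (Hm1 := Rmin_l d1 d2); assert (Hm2 := Rmin_r d1 d2).
  rewrite (clamp_id f u t Ht); unfold clamp.
  assert (Hst : Rabs (Rmax s 0 - t) <= Rabs (s - t)).
  { unfold Rmax, Rabs; destruct (Rle_dec s 0); repeat destruct (Rcase_abs _); lra. }
  apply Hd; [lra | lra|]; split; simpl.
  - apply H1; change (Rabs (z - u) < d1); lra.
  - split; [apply Rmax_r|]; unfold Rmax; destruct (Rle_dec s 0).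
    + exact (Rbar_le_lt_trans 0 t T Ht HtT).
    + apply H2; change (Rabs (s - t) < d2); lra.
Qed.

Lemma clamp_locally (f : R -> R -> R) (u t : R) :
  0 < t -> locally_2d (fun z s => f z s = clamp f z s) u t.
Proof.
  intros Ht; exists (mkposreal t Ht); simpl; intros z s _ Hs.
  symmetry; apply clamp_id; apply Rabs_def2 in Hs; lra.
Qed.

(** The Harnack quantity is a difference of two values of this function of one
    point; [u0] is arbitrary. *)
Definition harnack_potential (x y : R -> R -> R) (u0 u t : R) : R :=
  RInt (fun z => harnack_density x y z t) u0 u.

Lemma density_continuous_u {alpha beta T : Rbar} {x y : R -> R -> R} (u t : R) :
  planar_flow alpha beta T x y ->
  flow_domain alpha beta T (u, t) -> continuous (fun z => harnack_density x y z t) u.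
Proof.
  intros Hpf HD; assert (HS := pf_immersed _ _ _ _ _ Hpf u t (proj1 HD) (proj2 HD)).
  assert (HDu := flow_domain_slices alpha beta T).
  assert (C : forall f, smooth_on (flow_domain alpha beta T) f ->
            continuous (fun z => f z t) u).
  { intros f Hf; apply (ex_derive_continuous (K := R_AbsRing) (V := R_NormedModule)).
    eexists; exact (smooth_on_is_derive_u _ f u t HDu Hf HD). }
  assert (Sx := pf_smooth_x _ _ _ _ _ Hpf); assert (Sy := pf_smooth_y _ _ _ _ _ Hpf).
  assert (Sxu := smooth_on_du _ x HDu Sx); assert (Syu := smooth_on_du _ y HDu Sy).
  apply (cont_density (fun z => x z t) (fun z => y z t) (fun z => du x z t) (fun z => du y z t)
    (fun z => du (du x) z t) (fun z => du (du y) z t) (fun _ => t)); try apply C; auto.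
  - exact (smooth_on_du _ _ HDu Sxu).
  - exact (smooth_on_du _ _ HDu Syu).
  - apply continuous_const.
Qed.

Lemma density_continuous_clamp {alpha beta T : Rbar} {x y : R -> R -> R} (u t : R) :
  planar_flow alpha beta T x y ->
  flow_domain alpha beta T (u, t) -> continuous_2 (clamp (harnack_density x y)) u t.
Proof.
  intros Hpf HD; assert (HS := pf_immersed _ _ _ _ _ Hpf u t (proj1 HD) (proj2 HD)).
  assert (HDu := flow_domain_slices alpha beta T).
  assert (C : forall f, smooth_on (flow_domain alpha beta T) f -> continuous_2 (clamp f) u t)
    by (intros f Hf; exact (continuous_clamp alpha beta T f u t Hf HD)).
  assert (Sx := pf_smooth_x _ _ _ _ _ Hpf); assert (Sy := pf_smooth_y _ _ _ _ _ Hpf).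
  assert (Sxu := smooth_on_du _ x HDu Sx); assert (Syu := smooth_on_du _ y HDu Sy).
  apply (cont_density (fun p : R * R => clamp x (fst p) (snd p))
    (fun p => clamp y (fst p) (snd p)) (fun p => clamp (du x) (fst p) (snd p))
    (fun p => clamp (du y) (fst p) (snd p)) (fun p => clamp (du (du x)) (fst p) (snd p))
    (fun p => clamp (du (du y)) (fst p) (snd p)) (fun p => Rmax (snd p) 0)); try apply C; auto.
  - exact (smooth_on_du _ _ HDu Sxu).
  - exact (smooth_on_du _ _ HDu Syu).
  - apply continuous_Rmax, continuous_snd.
  - simpl; rewrite !clamp_id by exact (proj1 (proj2 HD)); exact HS.
Qed.

Lemma density_integrable {alpha beta T : Rbar} {x y : R -> R -> R} (v w t : R) :
  planar_flow alpha beta T x y ->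
  Rbar_interval alpha beta v -> Rbar_interval alpha beta w -> time_interval T t ->
  ex_RInt (fun z => harnack_density x y z t) v w.
Proof.
  intros Hpf Hv Hw Ht; apply (ex_RInt_continuous (V := R_CompleteNormedModule)).
  intros z Hz; apply (density_continuous_u _ _ Hpf); split; [|exact Ht].
  apply (Rbar_interval_convex alpha beta v w); assumption.
Qed.

Lemma potential_continuous {alpha beta T : Rbar} {x y : R -> R -> R} (u0 u t : R) :
  planar_flow alpha beta T x y ->
  Rbar_interval alpha beta u0 -> flow_domain alpha beta T (u, t) ->
  continuous_2 (clamp (harnack_potential x y u0)) u t.
Proof.
  intros Hpf Hu0 HD; destruct HD as [Hu [Ht HtT]]; simpl in Hu, Ht, HtT.
  apply (continuous_2_RInt alpha beta (clamp (harnack_density x y)) u0 u t Hu0 Hu).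
  - intros z Hz; apply (density_continuous_clamp _ _ Hpf); repeat split; assumption || apply Hz.
  - generalize (open_Rbar_lt T t HtT); apply filter_imp; intros s Hs z Hz.
    apply (density_continuous_u _ _ Hpf); split; [exact Hz|]; split; [apply Rmax_r|].
    unfold Rmax; destruct (Rle_dec s 0); [exact (Rbar_le_lt_trans 0 t T Ht HtT) | exact Hs].
Qed.

Lemma density_dt_continuous {alpha beta T : Rbar} {x y : R -> R -> R} (u t : R) :
  planar_flow alpha beta T x y ->
  open_flow_domain alpha beta T (u, t) -> continuous_2 (harnack_density_dt x y) u t.
Proof.
  intros Hpf HD; assert (HS := pf_immersed _ _ _ _ _ Hpf u t (proj1 HD) (proj1 (proj2 HD))).
  destruct (smooth_flow_derivatives alpha beta T x u t (pf_smooth_x _ _ _ _ _ Hpf) HD)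
    as [_ _ _ _ _ _ _ _ (X0 & X1 & X2 & X3 & X4 & X5)].
  destruct (smooth_flow_derivatives alpha beta T y u t (pf_smooth_y _ _ _ _ _ Hpf) HD)
    as [_ _ _ _ _ _ _ _ (Y0 & Y1 & Y2 & Y3 & Y4 & Y5)].
  unfold continuous_2 in *; unfold harnack_density_dt, turning_rate.
  apply cont_minus; [|apply cont_plus].
  - repeat cont_ring.
  - apply (cont_angular_rate (fun p : R * R => du x (fst p) (snd p))
      (fun p => du y (fst p) (snd p)) (fun p => du (du x) (fst p) (snd p))
      (fun p => du (du y) (fst p) (snd p))); assumption.
  - apply cont_mult; [apply continuous_snd|].
    unfold angular_rate_derivative, Rdiv; apply cont_mult.
    + repeat cont_ring.
    + apply (cont_inv (fun p : R * R => (du x (fst p) (snd p) ^ 2 + du y (fst p) (snd p) ^ 2) ^ 2)).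
      * apply (continuous_ext (fun p : R * R =>
            (du x (fst p) (snd p) ^ 2 + du y (fst p) (snd p) ^ 2)
            * (du x (fst p) (snd p) ^ 2 + du y (fst p) (snd p) ^ 2))); [intros p; ring_R|].
        apply cont_mult; now apply (continuous_sq_sum (fun p : R * R => du x (fst p) (snd p))
          (fun p => du y (fst p) (snd p))).
      * apply pow_nonzero; simpl in *; lra.
Qed.

(** The first derivative of the potential is the density and its time derivative
    is the difference of the fluxes at [u] and [u0]; minus the flux at [u0] is
    the source. *)
Lemma potential_evolves {alpha beta T : Rbar} {x y : R -> R -> R} (u0 u t a b : R) :
  planar_flow alpha beta T x y ->
  Rbar_interval alpha beta u0 -> open_flow_domain alpha beta T (u, t) ->
  a * (du x u t ^ 2 + du y u t ^ 2) = 1 ->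
  dt x u t = a * du (du x) u t + b * du x u t ->
  dt y u t = a * du (du y) u t + b * du y u t ->
  evolves a b (- harnack_flux x y u0 t) (harnack_potential x y u0) u t.
Proof.
  intros Hpf Hu0 HD HaS Ex Ey.
  destruct (harnack_flux_equation alpha beta T x y u t a b Hpf HD HaS Ex Ey) as [gu [Dgu Eflux]].
  assert (HD' := HD); destruct HD' as [Hu Ht]; simpl in Hu, Ht.
  assert (Hdom : forall z, Rmin u0 u <= z <= Rmax u0 u -> open_flow_domain alpha beta T (z, t)).
  { intros z Hz; split; [|exact Ht].
    exact (Rbar_interval_convex alpha beta u0 u z Hu0 Hu Hz). }
  exists (fun z => harnack_density x y z t), gu, (harnack_flux x y u t - harnack_flux x y u0 t).
  split; [|split; [exact Dgu | split; [|rewrite Eflux; ring]]].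
  - generalize (open_flow_domain_slices_u alpha beta T u t HD); apply filter_imp; intros z Hz.
    apply (is_derive_RInt (fun v => harnack_density x y v t)
             (fun v => harnack_potential x y u0 v t) u0 z).
    + generalize (open_flow_domain_slices_u alpha beta T z t Hz); apply filter_imp; intros v Hv.
      apply (RInt_correct (V := R_CompleteNormedModule)).
      apply (density_integrable _ _ _ Hpf); [exact Hu0 | exact (proj1 Hv) | exact (proj1 Ht)].
    + apply (density_continuous_u _ _ Hpf), open_flow_domain_incl, Hz.
  - assert (Hderiv : forall z s, open_flow_domain alpha beta T (z, s) ->
              is_derive (fun r => harnack_density x y z r) s (harnack_density_dt x y z s))
      by (intros z s Hzs;
          exact (proj1 (harnack_density_conservation alpha beta T x y z s Hpf Hzs))).
    assert (Htime : locally t (fun s => positive_part (time_interval T) s)).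
    { generalize (open_flow_domain_slices_t alpha beta T u t HD).
      apply filter_imp; intros s Hs; exact (proj2 Hs). }
    assert (HI : is_RInt (fun z => harnack_density_dt x y z t) u0 u
                   (harnack_flux x y u t - harnack_flux x y u0 t)).
    { apply (is_RInt_derive (V := R_CompleteNormedModule) (fun z => harnack_flux x y z t)).
      - intros z Hz.
        exact (proj2 (harnack_density_conservation alpha beta T x y z t Hpf (Hdom z Hz))).
      - intros z Hz; exact (continuous_2_l _ z t (density_dt_continuous z t Hpf (Hdom z Hz))). }
    rewrite <- (is_RInt_unique _ _ _ _ HI).
    replace (RInt (fun z => harnack_density_dt x y z t) u0 u)
      with (RInt (fun z => Derive (fun s => harnack_density x y z s) t) u0 u).
    + apply (is_derive_RInt_param (fun s z => harnack_density x y z s) u0 u t).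
      * generalize Htime; apply filter_imp; intros s Hs z Hz.
        eexists; apply Hderiv; split; [|exact Hs].
        exact (Rbar_interval_convex alpha beta u0 u z Hu0 Hu Hz).
      * intros z Hz; apply continuity_2d_pt_ext_loc with (fun s v => harnack_density_dt x y v s).
        -- destruct (open_flow_domain_open alpha beta T z t (Hdom z Hz)) as [d Hd].
           exists d; intros s v Hs Hv; symmetry; apply is_derive_unique, Hderiv, Hd; assumption.
        -- apply continuity_2d_pt_filterlim.
           apply (continuous_2_comp (harnack_density_dt x y) (fun p : R * R => snd p)
                    (fun p : R * R => fst p) (t, z)).
           ++ exact (density_dt_continuous z t Hpf (Hdom z Hz)).
           ++ apply continuous_snd.
           ++ apply continuous_fst.
      * generalize Htime; apply filter_imp; intros s Hs.
        apply (density_integrable _ _ _ Hpf); [exact Hu0 | exact Hu | exact (proj1 Hs)].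
    + apply RInt_ext; intros z Hz; apply is_derive_unique, Hderiv, Hdom; lra.
Qed.

(** * Growth of the Harnack quantity *)

Definition proper_flow (alpha beta : Rbar) (t1 : R) (x y : R -> R -> R) : Prop :=
  forall B, exists uL uR : R,
    Rbar_interval alpha beta uL /\ Rbar_interval alpha beta uR /\
    forall u t : R, Rbar_interval alpha beta u -> 0 <= t <= t1 ->
      u <= uL \/ uR <= u -> B < x u t ^ 2 + y u t ^ 2.

Lemma Rbar_interval_inhabited (alpha beta : Rbar) :
  Rbar_lt alpha beta -> exists u : R, Rbar_interval alpha beta u.
Proof.
  intros H; destruct alpha as [a| |], beta as [b| |]; simpl in H; try contradiction.
  - exists ((a + b) / 2); split; simpl; lra.
  - exists (a + 1); split; simpl; [lra | exact I].
  - exists (b - 1); split; simpl; [exact I | lra].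
  - exists 0; split; exact I.
Qed.

Lemma Rbar_interval_no_extrema (alpha beta : Rbar) (u : R) :
  Rbar_interval alpha beta u ->
  exists v w : R, Rbar_interval alpha beta v /\ Rbar_interval alpha beta w /\ v < u < w.
Proof.
  intros Hu; destruct (Rbar_interval_open alpha beta u Hu) as [d Hd].
  assert (Hp := cond_pos d).
  exists (u - d / 2), (u + d / 2); split; [|split; [|lra]]; apply Hd.
  - change (Rabs (u - d / 2 - u) < d); apply Rabs_def1; lra.
  - change (Rabs (u + d / 2 - u) < d); apply Rabs_def1; lra.
Qed.

(** The points where the curve meets a square, over all times in [[0, t1]], form a
    compact set, whose projection to the parameter interval stays away from the
    ends. *)
Lemma ups_proper_flow (alpha beta T : Rbar) (gamma : R -> R -> R * R) (t1 : R) :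
  Rbar_lt alpha beta ->
  uniformly_proper_solution (Rbar_interval alpha beta) (time_interval T) gamma ->
  0 <= t1 -> Rbar_lt t1 T ->
  proper_flow alpha beta t1 (coord_x gamma) (coord_y gamma).
Proof.
  intros Hab Hups Ht1 HT B.
  set (M := Rabs B + 1).
  assert (HM : 0 < M /\ B < M ^ 2).
  { unfold M; generalize (Rabs_pos B), (Rle_abs B); nra. }
  assert (HK := compact_product _ _ (compact_segment (- M) M) (compact_segment (- M) M)).
  assert (HJ : forall t, 0 <= t <= t1 -> time_interval T t).
  { intros t Ht; split; [lra|]; exact (Rbar_le_lt_trans t t1 T (proj2 Ht) HT). }
  assert (HC := ups_proper _ _ _ Hups 0 t1 Ht1 HJ _ HK).
  set (C := fun p : R * R => product_set (Rbar_interval alpha beta)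
     (fun t => 0 <= t <= t1) p /\ (- M <= fst (gamma (fst p) (snd p)) <= M /\
       - M <= snd (gamma (fst p) (snd p)) <= M)).
  change (compact_set C) in HC.
  assert (Hin : forall u t : R, Rbar_interval alpha beta u -> 0 <= t <= t1 ->
            fst (gamma u t) ^ 2 + snd (gamma u t) ^ 2 <= B -> C (u, t)).
  { intros u t Hu Ht HB; split; [split; assumption|]; simpl.
    split; split; nra. }
  destruct (classic (exists p, C p)) as [Hex|Hno].
  - destruct (compact_attains_max C (fun p => fst p) HC Hex) as [[uM tM] [CM HmaxM]].
    { intros [u t] _; apply continuous_fst. }
    destruct (compact_attains_max C (fun p => - fst p) HC Hex) as [[um tm] [Cm Hmaxm]].
    { intros [u t] _; apply (continuous_opp (V := R_NormedModule) (fun p : R * R => fst p)).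
      apply continuous_fst. }
    simpl in HmaxM, Hmaxm.
    destruct (Rbar_interval_no_extrema alpha beta um (proj1 (proj1 Cm)))
      as (uL & wL & HuL & _ & HL).
    destruct (Rbar_interval_no_extrema alpha beta uM (proj1 (proj1 CM)))
      as (vR & uR & _ & HuR & HR).
    exists uL, uR; split; [exact HuL|]; split; [exact HuR|].
    intros u t Hu Ht Hout; apply Rnot_le_lt; intros HB.
    assert (Cut := Hin u t Hu Ht HB).
    generalize (HmaxM _ Cut), (Hmaxm _ Cut); simpl; lra.
  - destruct (Rbar_interval_inhabited alpha beta Hab) as [u0 Hu0].
    exists u0, u0; split; [exact Hu0|]; split; [exact Hu0|].
    intros u t Hu Ht _; apply Rnot_le_lt; intros HB.
    apply Hno; exists (u, t); now apply Hin.
Qed.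

Definition frame_x (theta : R) (x y : R -> R -> R) (u t : R) : R :=
  cos theta * x u t + sin theta * y u t.
Definition frame_y (theta : R) (x y : R -> R -> R) (u t : R) : R :=
  (- sin theta) * x u t + cos theta * y u t.

Lemma frame_norm (theta : R) (x y : R -> R -> R) (u t : R) :
  frame_x theta x y u t ^ 2 + frame_y theta x y u t ^ 2 = x u t ^ 2 + y u t ^ 2.
Proof.
  unfold frame_x, frame_y; generalize (sin2_cos2 theta); unfold Rsqr; intros H.
  transitivity ((sin theta * sin theta + cos theta * cos theta) * (x u t ^ 2 + y u t ^ 2));
    [ring | rewrite H; ring].
Qed.

Lemma frame_polar (theta : R) (x y : R -> R -> R) (u t r : R) :
  x u t = r * cos theta -> y u t = r * sin theta ->
  frame_x theta x y u t = r /\ frame_y theta x y u t = 0.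
Proof.
  intros Hx Hy; unfold frame_x, frame_y; rewrite Hx, Hy.
  generalize (sin2_cos2 theta); unfold Rsqr; intros H; split; [|ring].
  transitivity (r * (sin theta * sin theta + cos theta * cos theta)); [ring|].
  rewrite H; ring.
Qed.

Lemma frame_wedge (theta a b c d : R) :
  (cos theta * a + sin theta * b) * (- sin theta * c + cos theta * d)
  - (- sin theta * a + cos theta * b) * (cos theta * c + sin theta * d) = a * d - b * c.
Proof.
  generalize (sin2_cos2 theta); unfold Rsqr; intros H.
  transitivity ((sin theta * sin theta + cos theta * cos theta) * (a * d - b * c));
    [ring | rewrite H; ring].
Qed.

Lemma frame_evolves (theta a b u t : R) (x y : R -> R -> R) :
  0 < t -> evolves a b 0 x u t -> evolves a b 0 y u t ->
  evolves a b (-2) (fun z s => x z s ^ 2 + y z s ^ 2) u t ->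
  evolves a b 0 (clamp (frame_x theta x y)) u t /\
  evolves a b 0 (clamp (frame_y theta x y)) u t /\
  evolves a b (-2) (fun z s => clamp (frame_x theta x y) z s ^ 2
                               + clamp (frame_y theta x y) z s ^ 2) u t.
Proof.
  intros Ht Ex Ey EN.
  assert (Hlin : forall c d, evolves a b 0 (fun z s => c * x z s + d * y z s) u t).
  { intros c d; replace 0 with (c * 0 + d * 0) by ring; now apply evolves_comb. }
  split; [|split].
  - apply evolves_ext_loc with (1 := clamp_locally (frame_x theta x y) u t Ht), Hlin.
  - apply evolves_ext_loc with (1 := clamp_locally (frame_y theta x y) u t Ht), Hlin.
  - apply evolves_ext_loc with (2 := EN).
    exists (mkposreal t Ht); simpl; intros z s _ Hs.
    unfold clamp; rewrite Rmax_left by (apply Rabs_def2 in Hs; lra).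
    symmetry; apply frame_norm.
Qed.

Lemma frame_continuous (alpha beta T : Rbar) (theta u t : R) (x y : R -> R -> R) :
  planar_flow alpha beta T x y -> flow_domain alpha beta T (u, t) ->
  continuous_2 (clamp (frame_x theta x y)) u t /\
  continuous_2 (clamp (frame_y theta x y)) u t.
Proof.
  intros Hpf HD.
  assert (Cx := continuous_clamp _ _ _ x u t (pf_smooth_x _ _ _ _ _ Hpf) HD).
  assert (Cy := continuous_clamp _ _ _ y u t (pf_smooth_y _ _ _ _ _ Hpf) HD).
  split; exact (continuous_lin _ _ _ _ _ Cx Cy).
Qed.

Lemma time_interval_le (T : Rbar) (t1 t : R) :
  Rbar_lt t1 T -> 0 <= t <= t1 -> time_interval T t.
Proof.
  intros HT Ht; split; [lra | exact (Rbar_le_lt_trans t t1 T (proj2 Ht) HT)].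
Qed.

Lemma flow_left_end (alpha beta T : Rbar) (theta u1 t1 : R) (x y : R -> R -> R) :
  planar_flow alpha beta T x y -> proper_flow alpha beta t1 x y ->
  0 < t1 -> Rbar_lt t1 T -> Rbar_interval alpha beta u1 ->
  left_end alpha u1 t1 (clamp (frame_x theta x y)) (clamp (frame_y theta x y)).
Proof.
  intros Hpf Hprop Ht1 HT Hu1.
  assert (HI : forall u : R, Rbar_lt alpha u -> u <= u1 -> Rbar_interval alpha beta u).
  { intros u Hu Huu; split; [exact Hu|].
    exact (Rbar_le_lt_trans u u1 beta Huu (proj2 Hu1)). }
  split; [exact (proj1 Hu1) | exact Ht1 | | |].
  - intros u t Hu Huu Ht; apply (frame_continuous alpha beta T); [exact Hpf|].
    split; [exact (HI u Hu Huu) | exact (time_interval_le T t1 t HT Ht)].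
  - intros u t Hu Huu Ht.
    destruct (planar_flow_evolves alpha beta T x y u t Hpf) as (a & b & Ha & _ & _ & _ & E).
    { split; [apply HI; simpl; [exact Hu | lra]|].
      split; simpl; [apply (time_interval_le T t1); [exact HT | lra] | lra]. }
    exists a, b; split; [exact Ha|]; apply frame_evolves; [lra | tauto | tauto | tauto].
  - intros M; destruct (Hprop M) as (uL & uR & HuL & _ & Hfar).
    destruct (Rbar_interval_no_extrema alpha beta u1 Hu1) as (v & v' & Hv & _ & Hvu).
    exists (Rmin uL v); split; [|split].
    + unfold Rmin; destruct (Rle_dec uL v); [exact (proj1 HuL) | exact (proj1 Hv)].
    + generalize (Rmin_r uL v); lra.
    + intros u t Hu Huu Ht.
      rewrite !clamp_id, frame_norm by lra; apply Hfar; [|exact Ht|].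
      * apply HI; [exact Hu|]; generalize (Rmin_r uL v); lra.
      * left; generalize (Rmin_l uL v); lra.
Qed.

Lemma Rbar_opp_lt_real (beta : Rbar) (u : R) :
  Rbar_lt (Rbar_opp beta) u <-> Rbar_lt (- u) beta.
Proof. destruct beta as [b| |]; simpl; split; intros; try tauto; lra. Qed.

(** Reversing the parametrization turns the right end into a left end. *)
Lemma flow_right_end (alpha beta T : Rbar) (theta u1 t1 : R) (x y : R -> R -> R) :
  planar_flow alpha beta T x y -> proper_flow alpha beta t1 x y ->
  0 < t1 -> Rbar_lt t1 T -> Rbar_interval alpha beta u1 ->
  left_end (Rbar_opp beta) (- u1) t1 (fun u t => clamp (frame_x theta x y) (- u) t)
    (fun u t => clamp (frame_y theta x y) (- u) t).
Proof.
  intros Hpf Hprop Ht1 HT Hu1.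
  assert (Hopp := Rbar_opp_lt_real beta).
  assert (HI : forall u : R, Rbar_lt (Rbar_opp beta) u -> u <= - u1 ->
             Rbar_interval alpha beta (- u)).
  { intros u Hu Huu; split; [|exact (proj1 (Hopp u) Hu)].
    apply (Rbar_lt_le_trans alpha u1); [exact (proj1 Hu1) | simpl; lra]. }
  split; [| exact Ht1 | | |].
  - apply (proj2 (Hopp (- u1))); rewrite Ropp_involutive; exact (proj2 Hu1).
  - intros u t Hu Huu Ht.
    destruct (frame_continuous alpha beta T theta (- u) t x y Hpf) as [CX CY].
    { split; [exact (HI u Hu Huu) | exact (time_interval_le T t1 t HT Ht)]. }
    assert (C1 : continuous (fun p : R * R => - fst p) (u, t)).
    { apply (continuous_opp (V := R_NormedModule) (fun p : R * R => fst p)), continuous_fst. }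
    split.
    + apply (continuous_2_comp (clamp (frame_x theta x y)) (fun p : R * R => - fst p)
               (fun p : R * R => snd p) (u, t)); [exact CX | exact C1 | apply continuous_snd].
    + apply (continuous_2_comp (clamp (frame_y theta x y)) (fun p : R * R => - fst p)
               (fun p : R * R => snd p) (u, t)); [exact CY | exact C1 | apply continuous_snd].
  - intros u t Hu Huu Ht.
    destruct (planar_flow_evolves alpha beta T x y (- u) t Hpf) as (a & b & Ha & _ & _ & _ & E).
    { split; [apply HI; simpl; [exact Hu | lra]|].
      split; simpl; [apply (time_interval_le T t1); [exact HT | lra] | lra]. }
    destruct (frame_evolves theta a b (- u) t x y) as (E1 & E2 & E3); try tauto.
    exists a, (- b); split; [exact Ha|]; split; [|split].
    + exact (evolves_reflect _ _ _ _ _ _ E1).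
    + exact (evolves_reflect _ _ _ _ _ _ E2).
    + exact (evolves_reflect _ _ _ _ _ _ E3).
  - intros M; destruct (Hprop M) as (uL & uR & _ & HuR & Hfar).
    destruct (Rbar_interval_no_extrema alpha beta u1 Hu1) as (v' & v & _ & Hv & Hvu).
    assert (Hm := Rmax_l uR v); assert (Hm' := Rmax_r uR v).
    exists (- Rmax uR v); split; [|split].
    + apply (proj2 (Hopp _)); rewrite Ropp_involutive.
      unfold Rmax; destruct (Rle_dec uR v); [exact (proj2 Hv) | exact (proj2 HuR)].
    + lra.
    + intros u t Hu Huu Ht.
      rewrite !clamp_id, frame_norm by lra; apply Hfar; [|exact Ht | right; lra].
      apply HI; [exact Hu | lra].
Qed.

Lemma frame_is_derive (alpha beta T : Rbar) (theta u t : R) (x y : R -> R -> R) :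
  planar_flow alpha beta T x y -> flow_domain alpha beta T (u, t) ->
  is_derive (fun z => frame_x theta x y z t) u (frame_x theta (du x) (du y) u t) /\
  is_derive (fun z => frame_y theta x y z t) u (frame_y theta (du x) (du y) u t).
Proof.
  intros Hpf HD; assert (HDu := flow_domain_slices alpha beta T).
  assert (Dx := smooth_on_is_derive_u _ x u t HDu (pf_smooth_x _ _ _ _ _ Hpf) HD).
  assert (Dy := smooth_on_is_derive_u _ y u t HDu (pf_smooth_y _ _ _ _ _ Hpf) HD).
  split.
  - exact (is_derive_plus (V := R_NormedModule) _ _ _ _ _
             (is_derive_scal (fun z => x z t) u (cos theta) _ Dx)
             (is_derive_scal (fun z => y z t) u (sin theta) _ Dy)).
  - exact (is_derive_plus (V := R_NormedModule) _ _ _ _ _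
             (is_derive_scal (fun z => x z t) u (- sin theta) _ Dx)
             (is_derive_scal (fun z => y z t) u (cos theta) _ Dy)).
Qed.

(** Far out [X] is monotone and tends to infinity as [u] decreases to [alpha], so
    that its derivative is nonpositive there. *)
Lemma left_end_graphical (alpha beta T : Rbar) (theta u1 t1 : R) (x y : R -> R -> R) :
  planar_flow alpha beta T x y -> proper_flow alpha beta t1 x y ->
  0 < t1 -> Rbar_lt t1 T -> Rbar_interval alpha beta u1 ->
  (forall u : R, Rbar_interval alpha beta u -> u <= u1 ->
     exists r, 0 <= r /\ x u 0 = r * cos theta /\ y u 0 = r * sin theta) ->
  (forall u v : R, Rbar_interval alpha beta u -> Rbar_interval alpha beta v ->
     x u 0 = x v 0 -> y u 0 = y v 0 -> u = v) ->
  exists uE c : R, Rbar_interval alpha beta uE /\ uE < u1 /\ 0 <= c /\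
    forall u t : R, Rbar_interval alpha beta u -> u <= uE -> 0 <= t <= t1 ->
      Rabs (frame_y theta x y u t) <= c /\ 0 <= (-1) * frame_x theta (du x) (du y) u t.
Proof.
  intros Hpf Hprop Ht1 HT Hu1 Hray Hinj.
  assert (Hend := flow_left_end alpha beta T theta u1 t1 x y Hpf Hprop Ht1 HT Hu1).
  assert (HI : forall u : R, Rbar_lt alpha u -> u <= u1 -> Rbar_interval alpha beta u).
  { intros u Hu Huu; split; [exact Hu|].
    exact (Rbar_le_lt_trans u u1 beta Huu (proj2 Hu1)). }
  destruct (end_graphical alpha u1 t1 _ _ Hend) as (uE & c & HuE & HuE1 & Hc & Hgr).
  - intros u Hu Huu; destruct (Hray u (HI u Hu Huu) Huu) as (r & Hr & Hx & Hy).
    rewrite !clamp_id by lra; destruct (frame_polar theta x y u 0 r Hx Hy) as [-> ->]; lra.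
  - intros u v Hu Huu Hv Hvv; rewrite !clamp_id by lra.
    destruct (Hray u (HI u Hu Huu) Huu) as (r & Hr & Hx & Hy).
    destruct (Hray v (HI v Hv Hvv) Hvv) as (r' & Hr' & Hx' & Hy').
    destruct (frame_polar theta x y u 0 r Hx Hy) as [-> _].
    destruct (frame_polar theta x y v 0 r' Hx' Hy') as [-> _].
    intros ->; apply Hinj; auto; congruence.
  - exists uE, c; split; [apply HI; [exact HuE | lra]|]; split; [exact HuE1|].
    split; [exact Hc|]; intros u t Hu Huu Ht.
    destruct (Hgr u t (proj1 Hu) Huu Ht) as [HY Hmon].
    rewrite clamp_id in HY by lra; split; [exact HY|].
    destruct (frame_is_derive alpha beta T theta u t x y Hpf) as [D _].
    { split; [exact Hu | exact (time_interval_le T t1 t HT Ht)]. }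
    apply Rnot_lt_le; intros Hneg.
    destruct (slope_above _ u _ 0 D ltac:(lra)) as [d [Hd [Hleft _]]].
    destruct (Rbar_interval_no_extrema alpha beta u Hu) as (v & v' & Hv & _ & Hvu).
    set (z := Rmax v (u - d / 2)).
    assert (Hz : u - d < z < u)
      by (unfold z, Rmax; destruct (Rle_dec v (u - d / 2)); lra).
    assert (Hzv : Rbar_lt alpha z) by exact (Rbar_lt_le_finite alpha v z (proj1 Hv) (Rmax_l _ _)).
    generalize (Hleft z Hz), (Hmon z Hzv ltac:(lra)); rewrite !clamp_id by lra; lra.
Qed.

Lemma right_end_graphical (alpha beta T : Rbar) (theta u1 t1 : R) (x y : R -> R -> R) :
  planar_flow alpha beta T x y -> proper_flow alpha beta t1 x y ->
  0 < t1 -> Rbar_lt t1 T -> Rbar_interval alpha beta u1 ->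
  (forall u : R, Rbar_interval alpha beta u -> u1 <= u ->
     exists r, 0 <= r /\ x u 0 = r * cos theta /\ y u 0 = r * sin theta) ->
  (forall u v : R, Rbar_interval alpha beta u -> Rbar_interval alpha beta v ->
     x u 0 = x v 0 -> y u 0 = y v 0 -> u = v) ->
  exists uE c : R, Rbar_interval alpha beta uE /\ u1 < uE /\ 0 <= c /\
    forall u t : R, Rbar_interval alpha beta u -> uE <= u -> 0 <= t <= t1 ->
      Rabs (frame_y theta x y u t) <= c /\ 0 <= 1 * frame_x theta (du x) (du y) u t.
Proof.
  intros Hpf Hprop Ht1 HT Hu1 Hray Hinj.
  assert (Hend := flow_right_end alpha beta T theta u1 t1 x y Hpf Hprop Ht1 HT Hu1).
  assert (Hopp := Rbar_opp_lt_real beta).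
  assert (HI : forall u : R, Rbar_lt (Rbar_opp beta) u -> u <= - u1 ->
             Rbar_interval alpha beta (- u)).
  { intros u Hu Huu; split; [|exact (proj1 (Hopp u) Hu)].
    apply (Rbar_lt_le_trans alpha u1); [exact (proj1 Hu1) | simpl; lra]. }
  destruct (end_graphical _ _ t1 _ _ Hend) as (uE & c & HuE & HuE1 & Hc & Hgr).
  - intros u Hu Huu; destruct (Hray (- u) (HI u Hu Huu) ltac:(lra)) as (r & Hr & Hx & Hy).
    rewrite !clamp_id by lra; destruct (frame_polar theta x y (- u) 0 r Hx Hy) as [-> ->]; lra.
  - intros u v Hu Huu Hv Hvv; rewrite !clamp_id by lra.
    destruct (Hray (- u) (HI u Hu Huu) ltac:(lra)) as (r & Hr & Hx & Hy).
    destruct (Hray (- v) (HI v Hv Hvv) ltac:(lra)) as (r' & Hr' & Hx' & Hy').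
    destruct (frame_polar theta x y (- u) 0 r Hx Hy) as [-> _].
    destruct (frame_polar theta x y (- v) 0 r' Hx' Hy') as [-> _].
    intros ->; assert (- u = - v); [|lra].
    apply Hinj; [apply HI; assumption | apply HI; assumption | congruence | congruence].
  - exists (- uE), c; split; [apply HI; [exact HuE | lra]|]; split; [lra|].
    split; [exact Hc|]; intros u t Hu Huu Ht.
    assert (Hopp' : forall z : R, Rbar_lt z beta -> Rbar_lt (Rbar_opp beta) (- z))
      by (intros z Hz; apply (proj2 (Hopp (- z))); rewrite Ropp_involutive; exact Hz).
    destruct (Hgr (- u) t (Hopp' u (proj2 Hu)) ltac:(lra) Ht) as [HY Hmon].
    rewrite Ropp_involutive, clamp_id in HY by lra; split; [exact HY|].
    destruct (frame_is_derive alpha beta T theta u t x y Hpf) as [D _].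
    { split; [exact Hu | exact (time_interval_le T t1 t HT Ht)]. }
    apply Rnot_lt_le; intros Hneg.
    destruct (slope_below _ u _ 0 D ltac:(lra)) as [d [Hd [_ Hright]]].
    destruct (Rbar_interval_no_extrema alpha beta u Hu) as (v' & v & _ & Hv & Hvu).
    set (z := Rmin v (u + d / 2)).
    assert (Hz : u < z < u + d)
      by (unfold z, Rmin; destruct (Rle_dec v (u + d / 2)); lra).
    assert (Hzv : Rbar_lt z beta).
    { apply (Rbar_le_lt_trans z v beta); [exact (Rmin_l _ _) | exact (proj2 Hv)]. }
    generalize (Hright z Hz), (Hmon (- z) (Hopp' z Hzv) ltac:(lra)).
    rewrite !Ropp_involutive, !clamp_id by lra; lra.
Qed.

Lemma flow_turning (alpha beta T : Rbar) (gamma : R -> R -> R * R) (t : R) :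
  planar_flow alpha beta T (coord_x gamma) (coord_y gamma) ->
  Rbar_lt alpha beta -> time_interval T t ->
  let psi := tangent_angle (Rbar_interval alpha beta) (fun u => gamma u t) in
  (forall u : R, Rbar_interval alpha beta u ->
     continuity_pt psi u /\
     du (coord_x gamma) u t
     = sqrt (du (coord_x gamma) u t ^ 2 + du (coord_y gamma) u t ^ 2) * cos (psi u) /\
     du (coord_y gamma) u t
     = sqrt (du (coord_x gamma) u t ^ 2 + du (coord_y gamma) u t ^ 2) * sin (psi u)) /\
  (forall v w : R, Rbar_interval alpha beta v -> Rbar_interval alpha beta w -> v <= w ->
     is_RInt (fun u => turning_rate (coord_x gamma) (coord_y gamma) u t) v w (psi w - psi v)).
Proof.
  set (x := coord_x gamma) in *; set (y := coord_y gamma) in *.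
  intros Hpf Hab Ht.
  apply (turning_integral alpha beta (fun u => gamma u t) (fun u => du x u t)
    (fun u => du y u t) (fun u => du (du x) u t) (fun u => du (du y) u t));
    [|exact (Rbar_interval_inhabited alpha beta Hab)].
  intros u Hu; assert (HD : flow_domain alpha beta T (u, t)) by (split; assumption).
  assert (HDu := flow_domain_slices alpha beta T).
  assert (Sx := pf_smooth_x _ _ _ _ _ Hpf); assert (Sy := pf_smooth_y _ _ _ _ _ Hpf).
  assert (Sxu := smooth_on_du _ x HDu Sx); assert (Syu := smooth_on_du _ y HDu Sy).
  assert (Sxuu := smooth_on_du _ _ HDu Sxu); assert (Syuu := smooth_on_du _ _ HDu Syu).
  split; [exact (smooth_on_is_derive_u _ x u t HDu Sx HD)|].
  split; [exact (smooth_on_is_derive_u _ y u t HDu Sy HD)|].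
  split; [exact (smooth_on_is_derive_u _ _ u t HDu Sxu HD)|].
  split; [exact (smooth_on_is_derive_u _ _ u t HDu Syu HD)|].
  split; [|split; [|exact (pf_immersed _ _ _ _ _ Hpf u t Hu Ht)]];
    apply (ex_derive_continuous (K := R_AbsRing) (V := R_NormedModule)); eexists.
  - exact (smooth_on_is_derive_u _ _ u t HDu Sxuu HD).
  - exact (smooth_on_is_derive_u _ _ u t HDu Syuu HD).
Qed.

Lemma density_integral (alpha beta T : Rbar) (gamma : R -> R -> R * R) (v w t : R) :
  planar_flow alpha beta T (coord_x gamma) (coord_y gamma) ->
  Rbar_lt alpha beta -> time_interval T t ->
  Rbar_interval alpha beta v -> Rbar_interval alpha beta w -> v <= w ->
  RInt (fun u => harnack_density (coord_x gamma) (coord_y gamma) u t) v w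
  = harnack (Rbar_interval alpha beta) gamma v w t.
Proof.
  set (x := coord_x gamma) in *; set (y := coord_y gamma) in *.
  intros Hpf Hab Ht Hv Hw Hvw.
  destruct (flow_turning alpha beta T gamma t Hpf Hab Ht) as [_ Hturn].
  specialize (Hturn v w Hv Hw Hvw).
  assert (HA : is_RInt (fun u => wedge_rate x y u t) v w (RInt (fun u => wedge_rate x y u t) v w)).
  { apply (RInt_correct (V := R_CompleteNormedModule)).
    apply (ex_RInt_continuous (V := R_CompleteNormedModule)); intros z Hz.
    assert (HD : flow_domain alpha beta T (z, t))
      by (split; [exact (Rbar_interval_convex alpha beta v w z Hv Hw Hz) | exact Ht]).
    assert (HDu := flow_domain_slices alpha beta T).
    assert (C : forall f, smooth_on (flow_domain alpha beta T) f ->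
              continuous (fun v => f v t) z).
    { intros f Hf; apply (ex_derive_continuous (K := R_AbsRing) (V := R_NormedModule)).
      eexists; exact (smooth_on_is_derive_u _ f z t HDu Hf HD). }
    assert (Sx := pf_smooth_x _ _ _ _ _ Hpf); assert (Sy := pf_smooth_y _ _ _ _ _ Hpf).
    apply cont_minus; apply cont_mult.
    - exact (C (du x) (smooth_on_du _ x HDu Sx)).
    - exact (C y Sy).
    - exact (C (du y) (smooth_on_du _ y HDu Sy)).
    - exact (C x Sx). }
  apply is_RInt_unique.
  apply (is_RInt_minus (V := R_NormedModule) (fun u => 1 / 2 * wedge_rate x y u t)
           (fun u => t * turning_rate x y u t)).
  - exact (is_RInt_scal (V := R_NormedModule) _ v w (1 / 2) _ HA).
  - exact (is_RInt_scal (V := R_NormedModule) _ v w t _ Hturn).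
Qed.

(** On an arc that is monotone in the direction [theta] the tangent stays in a
    half plane, so that the arc turns by at most [PI]. *)
Lemma density_integral_bound (alpha beta T : Rbar) (gamma : R -> R -> R * R)
    (theta s c v w t : R) :
  planar_flow alpha beta T (coord_x gamma) (coord_y gamma) ->
  Rbar_lt alpha beta -> time_interval T t ->
  Rbar_interval alpha beta v -> Rbar_interval alpha beta w -> v <= w ->
  0 <= c -> s = 1 \/ s = -1 ->
  (forall u, v <= u <= w -> Rabs (frame_y theta (coord_x gamma) (coord_y gamma) u t) <= c /\
     0 <= s * frame_x theta (du (coord_x gamma)) (du (coord_y gamma)) u t) ->
  Rabs (RInt (fun u => harnack_density (coord_x gamma) (coord_y gamma) u t) v w)
    <= 3 / 2 * c * (Rabs (frame_x theta (coord_x gamma) (coord_y gamma) v t)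
                    + Rabs (frame_x theta (coord_x gamma) (coord_y gamma) w t)) + t * PI.
Proof.
  set (x := coord_x gamma) in *; set (y := coord_y gamma) in *.
  intros Hpf Hab Ht Hv Hw Hvw Hc Hs Hend.
  assert (HI : forall u, v <= u <= w -> Rbar_interval alpha beta u).
  { intros u Hu; apply (Rbar_interval_convex alpha beta v w); [exact Hv | exact Hw|].
    rewrite Rmin_left, Rmax_right; lra. }
  assert (HDu := flow_domain_slices alpha beta T).
  assert (Sx := pf_smooth_x _ _ _ _ _ Hpf); assert (Sy := pf_smooth_y _ _ _ _ _ Hpf).
  assert (Sxu := smooth_on_du _ x HDu Sx); assert (Syu := smooth_on_du _ y HDu Sy).
  replace (RInt (fun u => harnack_density x y u t) v w)
    with (harnack (Rbar_interval alpha beta) gamma v w t)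
    by (symmetry; exact (density_integral alpha beta T gamma v w t Hpf Hab Ht Hv Hw Hvw)).
  unfold harnack.
  assert (HA : Rabs (swept_area (fun u => gamma u t) v w)
     <= 3 / 2 * c * (Rabs (frame_x theta x y v t) + Rabs (frame_x theta x y w t))).
  { unfold swept_area; rewrite Rabs_mult, (Rabs_pos_eq (1 / 2)) by lra.
    assert (HB := monotone_arc_area s c v w (fun u => frame_x theta x y u t)
      (fun u => frame_y theta x y u t) (fun u => frame_x theta (du x) (du y) u t)
      (fun u => frame_y theta (du x) (du y) u t) Hvw Hc).
    rewrite (RInt_ext _ (fun u => wedge_rate x y u t)) in HB.
    - assert (HB' := fun H1 H2 H3 => HB H1 H2 Hs H3).
      change (RInt (fun u => star_wedge (velocity (fun z => gamma z t) u) (gamma u t)) v w)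
        with (RInt (fun u => wedge_rate x y u t) v w).
      assert (HB2 : Rabs (RInt (fun u => wedge_rate x y u t) v w)
        <= 3 * c * (Rabs (frame_x theta x y v t) + Rabs (frame_x theta x y w t))); [|lra].
      apply HB'; [| |intros u Hu; apply Hend, Hu].
      + intros u Hu.
        assert (HD : flow_domain alpha beta T (u, t)) by (split; [exact (HI u Hu) | exact Ht]).
        destruct (frame_is_derive alpha beta T theta u t x y Hpf HD) as [D1 D2].
        split; [exact D1|]; split; [exact D2|].
        assert (Dxu := smooth_on_is_derive_u _ _ u t HDu Sxu HD).
        assert (Dyu := smooth_on_is_derive_u _ _ u t HDu Syu HD).
        assert (Cx : continuous (fun z => du x z t) u)
          by (apply (ex_derive_continuous (K := R_AbsRing) (V := R_NormedModule));
              eexists; exact Dxu).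
        assert (Cy : continuous (fun z => du y z t) u)
          by (apply (ex_derive_continuous (K := R_AbsRing) (V := R_NormedModule));
              eexists; exact Dyu).
        split; exact (continuous_lin _ _ _ _ _ Cx Cy).
      + intros u Hu; exact (proj2 (Hend u Hu)).
    - intros u _; exact (frame_wedge theta (du x u t) (du y u t) (x u t) (y u t)). }
  assert (HP : Rabs (turning (Rbar_interval alpha beta) (fun u => gamma u t) v w) <= PI).
  { destruct (flow_turning alpha beta T gamma t Hpf Hab Ht) as [Hpsi _].
    fold x y in Hpsi.
    apply (angle_variation_le_PI s v w _ theta Hvw).
    - intros u Hu; apply Hpsi, HI, Hu.
    - intros u Hu; destruct (Hpsi u (HI u Hu)) as (_ & Hcos & Hsin).
      set (psi := tangent_angle (Rbar_interval alpha beta) (fun z => gamma z t)) in *.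
      assert (HS := sqrt_lt_R0 _ (pf_immersed _ _ _ _ _ Hpf u t (HI u Hu) Ht)).
      set (n := sqrt (du x u t ^ 2 + du y u t ^ 2)) in *.
      generalize (proj2 (Hend u Hu)); unfold frame_x; rewrite Hcos, Hsin, cos_minus; intros H.
      apply Rmult_le_reg_l with (1 := HS); rewrite Rmult_0_r.
      apply Rle_trans with (1 := H); right; ring.
    - destruct Hs; lra. }
  apply Rle_trans with (1 := Rabs_triang _ _); rewrite Rabs_Ropp, Rabs_mult.
  rewrite (Rabs_pos_eq t) by exact (proj1 Ht).
  apply Rplus_le_compat; [exact HA | apply Rmult_le_compat_l; [exact (proj1 Ht) | exact HP]].
Qed.

Lemma bounded_on_rectangle (a b t1 : R) (f : R -> R -> R) :
  a <= b -> 0 <= t1 ->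
  (forall u t : R, a <= u <= b -> 0 <= t <= t1 -> continuous_2 f u t) ->
  exists B, 0 <= B /\ forall u t : R, a <= u <= b -> 0 <= t <= t1 -> Rabs (f u t) <= B.
Proof.
  intros Hab Ht1 Hf.
  destruct (compact_attains_max _ (fun p : R * R => Rabs (f (fst p) (snd p)))
     (compact_product _ _ (compact_segment a b) (compact_segment 0 t1)))
    as [[u0 t0] [_ Hmax]].
  - exists (a, 0); simpl; lra.
  - intros [u t] [Hu Ht].
    apply (continuous_comp (fun p : R * R => f (fst p) (snd p)) Rabs); [|apply continuous_Rabs].
    exact (Hf u t Hu Ht).
  - exists (Rabs (f u0 t0)); split; [apply Rabs_pos|].
    intros u t Hu Ht; exact (Hmax (u, t) (conj Hu Ht)).
Qed.

(** Between [uE] and [vE] the potential is bounded by compactness.  Beyond these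
    points the curve is monotone along the ray of the end, and the rest of the
    integral is at most linear in [r]. *)
Lemma potential_growth (alpha beta T : Rbar) (gamma : R -> R -> R * R) (t1 : R) :
  Rbar_lt alpha beta -> csf_initially_radial_ends (Rbar_interval alpha beta) T gamma ->
  planar_flow alpha beta T (coord_x gamma) (coord_y gamma) ->
  proper_flow alpha beta t1 (coord_x gamma) (coord_y gamma) ->
  0 < t1 -> Rbar_lt t1 T ->
  exists u0 C : R, Rbar_interval alpha beta u0 /\ 0 < C /\
    forall u t : R, Rbar_interval alpha beta u -> 0 <= t <= t1 ->
      harnack_potential (coord_x gamma) (coord_y gamma) u0 u t ^ 2
      <= C * (1 + (coord_x gamma u t ^ 2 + coord_y gamma u t ^ 2)).
Proof.
  set (x := coord_x gamma) in *; set (y := coord_y gamma) in *.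
  intros Hab [Hups (ta & tb & u1 & u2 & Hu1 & Hu2 & H12 & Hra & Hrb)] Hpf Hprop Ht1 HT.
  assert (Hinj : forall u v : R, Rbar_interval alpha beta u -> Rbar_interval alpha beta v ->
     x u 0 = x v 0 -> y u 0 = y v 0 -> u = v).
  { intros u v Hu Hv Hx Hy.
    assert (H0 : time_interval T 0) by (apply (time_interval_le T t1); [exact HT | lra]).
    destruct (ups_embedded _ _ _ Hups 0 H0) as (_ & Hi & _).
    apply (Hi u v Hu Hv); unfold x, y, coord_x, coord_y in Hx, Hy.
    destruct (gamma u 0), (gamma v 0); simpl in Hx, Hy; congruence. }
  destruct (Rbar_interval_no_extrema alpha beta u1 Hu1) as (v1 & w1 & Hv1 & _ & Hvu1).
  destruct (Rbar_interval_no_extrema alpha beta u2 Hu2) as (w2 & v2 & _ & Hv2 & Hvu2).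
  destruct (left_end_graphical alpha beta T ta v1 t1 x y) as (uE & c & HuE & HuE1 & Hc & HL);
    try assumption.
  { intros u Hu Huu; destruct (Hra u Hu ltac:(lra)) as (r & Hr & Hg); exists r.
    unfold x, y, coord_x, coord_y; rewrite Hg; auto. }
  destruct (right_end_graphical alpha beta T tb v2 t1 x y) as (vE & c' & HvE & HvE1 & Hc' & HR);
    try assumption.
  { intros u Hu Huu; destruct (Hrb u Hu ltac:(lra)) as (r & Hr & Hg); exists r.
    unfold x, y, coord_x, coord_y; rewrite Hg; auto. }
  set (h := harnack_potential x y uE).
  assert (HTt : forall t, 0 <= t <= t1 -> time_interval T t)
    by (intros t; exact (time_interval_le T t1 t HT)).
  assert (HDt : forall u t : R, uE <= u <= vE -> 0 <= t <= t1 -> flow_domain alpha beta T (u, t)).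
  { intros u t Hu Ht; split; [|exact (HTt t Ht)].
    apply (Rbar_interval_convex alpha beta uE vE); [exact HuE | exact HvE|].
    rewrite Rmin_left, Rmax_right; simpl; lra. }
  destruct (bounded_on_rectangle uE vE t1 (clamp h)) as (B & HB & Hmid); [lra | lra | |].
  { intros u t Hu Ht; exact (potential_continuous uE u t Hpf HuE (HDt u t Hu Ht)). }
  destruct (bounded_on_rectangle uE vE t1 (clamp (frame_x ta x y))) as (B1 & HB1 & Hm1);
    [lra | lra | |].
  { intros u t Hu Ht.
    exact (proj1 (frame_continuous alpha beta T ta u t x y Hpf (HDt u t Hu Ht))). }
  destruct (bounded_on_rectangle uE vE t1 (clamp (frame_x tb x y))) as (B2 & HB2 & Hm2);
    [lra | lra | |].
  { intros u t Hu Ht.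
    exact (proj1 (frame_continuous alpha beta T tb u t x y Hpf (HDt u t Hu Ht))). }
  assert (HPI := PI_RGT_0).
  set (k := 3 / 2 * c + 3 / 2 * c').
  set (m := B + 3 / 2 * c * B1 + 3 / 2 * c' * B2 + t1 * PI).
  assert (P1 : 0 <= c * B1) by now apply Rmult_le_pos.
  assert (P2 : 0 <= c' * B2) by now apply Rmult_le_pos.
  assert (P3 : 0 <= t1 * PI) by (apply Rmult_le_pos; lra).
  assert (Hm : 0 <= m) by (unfold m; lra).
  assert (Hk : 0 <= k) by (unfold k; lra).
  assert (Hlin : forall u t : R, Rbar_interval alpha beta u -> 0 <= t <= t1 ->
    exists r, Rabs r ^ 2 <= x u t ^ 2 + y u t ^ 2 /\ Rabs (h u t) <= k * Rabs r + m).
  { intros u t Hu Ht.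
    assert (Hframe : forall theta, Rabs (frame_x theta x y u t) ^ 2 <= x u t ^ 2 + y u t ^ 2).
    { intros theta; rewrite pow2_abs, <- (frame_norm theta).
      generalize (pow2_ge_0 (frame_y theta x y u t)); lra. }
    assert (Hpt : t * PI <= t1 * PI) by (apply Rmult_le_compat_r; lra).
    destruct (Rle_or_lt u uE) as [HuL|HuL]; [|destruct (Rle_or_lt u vE) as [HuR|HuR]].
    - exists (frame_x ta x y u t); split; [apply Hframe|].
      assert (Hbd := density_integral_bound alpha beta T gamma ta (-1) c u uE t Hpf Hab (HTt t Ht)
        Hu HuE HuL Hc (or_intror eq_refl)); fold x y in Hbd.
      specialize (Hbd (fun z Hz => HL z t (Rbar_interval_convex alpha beta u uE z Hu HuE
        ltac:(rewrite Rmin_left, Rmax_right by lra; exact Hz)) (proj2 Hz) Ht)).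
      assert (Hsw : h u t = - RInt (fun z => harnack_density x y z t) u uE).
      { symmetry; apply (opp_RInt_swap (V := R_CompleteNormedModule)).
        exact (density_integrable u uE t Hpf Hu HuE (HTt t Ht)). }
      rewrite Hsw, Rabs_Ropp.
      assert (Hmem : uE <= uE <= vE) by lra.
      generalize (Hm1 uE t Hmem Ht); rewrite clamp_id by lra; intros HB1'.
      apply Rmult_le_compat_l with (r := c) in HB1'; [|exact Hc].
      assert (0 <= c' * Rabs (frame_x ta x y u t)) by (apply Rmult_le_pos; [lra | apply Rabs_pos]).
      unfold k, m; lra.
    - exists 0; split.
      + rewrite Rabs_R0; generalize (pow2_ge_0 (x u t)), (pow2_ge_0 (y u t)); lra.
      + assert (Hmem : uE <= u <= vE) by lra.
        generalize (Hmid u t Hmem Ht); rewrite clamp_id by lra.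
        rewrite Rabs_R0; unfold m; lra.
    - exists (frame_x tb x y u t); split; [apply Hframe|].
      assert (Hbd := density_integral_bound alpha beta T gamma tb 1 c' vE u t Hpf Hab (HTt t Ht)
        HvE Hu (Rlt_le _ _ HuR) Hc' (or_introl eq_refl)); fold x y in Hbd.
      specialize (Hbd (fun z Hz => HR z t (Rbar_interval_convex alpha beta vE u z HvE Hu
        ltac:(rewrite Rmin_left, Rmax_right by lra; exact Hz)) (proj1 Hz) Ht)).
      assert (Hsw : h u t = h vE t + RInt (fun z => harnack_density x y z t) vE u).
      { symmetry; apply (RInt_Chasles (V := R_CompleteNormedModule)).
        - exact (density_integrable uE vE t Hpf HuE HvE (HTt t Ht)).
        - exact (density_integrable vE u t Hpf HvE Hu (HTt t Ht)). }
      rewrite Hsw; apply Rle_trans with (1 := Rabs_triang _ _).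
      assert (Hmem : uE <= vE <= vE) by lra.
      generalize (Hmid vE t Hmem Ht), (Hm2 vE t Hmem Ht).
      rewrite !clamp_id by lra; intros HB' HB2'.
      apply Rmult_le_compat_l with (r := c') in HB2'; [|exact Hc'].
      assert (0 <= c * Rabs (frame_x tb x y u t)) by (apply Rmult_le_pos; [lra | apply Rabs_pos]).
      unfold k, m; lra. }
  exists uE, (2 * k ^ 2 + 2 * m ^ 2 + 1); split; [exact HuE|]; split.
  { generalize (pow2_ge_0 k), (pow2_ge_0 m); lra. }
  intros u t Hu Ht; destruct (Hlin u t Hu Ht) as (r & Hr & Hh); fold h.
  rewrite <- (pow2_abs (h u t)); set (N := x u t ^ 2 + y u t ^ 2) in *.
  assert (HR0 := Rabs_pos r); assert (Hh0 := Rabs_pos (h u t)).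
  assert (HN : 0 <= N) by (apply Rle_trans with (2 := Hr), pow2_ge_0).
  apply Rle_trans with ((k * Rabs r + m) ^ 2); [apply pow_incr; split; assumption|].
  apply Rle_trans with (2 * k ^ 2 * Rabs r ^ 2 + 2 * m ^ 2).
  { generalize (pow2_ge_0 (k * Rabs r - m)); intros; nra. }
  assert (Hk2 := pow2_ge_0 k); assert (Hm2' := pow2_ge_0 m).
  apply Rle_trans with (2 * k ^ 2 * N + 2 * m ^ 2); [|nra].
  apply Rplus_le_compat_r, Rmult_le_compat_l; [lra | exact Hr].
Qed.

Lemma potential_difference (alpha beta T : Rbar) (gamma : R -> R -> R * R) (u0 v w t : R) :
  planar_flow alpha beta T (coord_x gamma) (coord_y gamma) ->
  Rbar_lt alpha beta -> time_interval T t ->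
  Rbar_interval alpha beta u0 -> Rbar_interval alpha beta v ->
  Rbar_interval alpha beta w -> v <= w ->
  harnack_potential (coord_x gamma) (coord_y gamma) u0 w t
  - harnack_potential (coord_x gamma) (coord_y gamma) u0 v t
  = harnack (Rbar_interval alpha beta) gamma v w t.
Proof.
  set (x := coord_x gamma) in *; set (y := coord_y gamma) in *.
  intros Hpf Hab Ht Hu0 Hv Hw Hvw.
  rewrite <- (density_integral alpha beta T gamma v w t Hpf Hab Ht Hv Hw Hvw).
  fold x y; unfold harnack_potential.
  rewrite <- (RInt_Chasles (V := R_CompleteNormedModule) (fun z => harnack_density x y z t) u0 v w
    (density_integrable u0 v t Hpf Hu0 Hv Ht) (density_integrable v w t Hpf Hv Hw Ht)).
  unfold plus; simpl; ring.
Qed.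

(** * The Harnack inequality *)

Theorem theorem1p7 (alpha beta T : Rbar) (gamma : R -> R -> R * R)
    (Aminus Aplus : R) :
  Rbar_lt alpha beta ->
  Rbar_lt 0 T ->
  csf_initially_radial_ends (Rbar_interval alpha beta) T gamma ->
  smooth_down_to_0 (Rbar_interval alpha beta) T gamma ->
  (forall v w : R,
     Rbar_interval alpha beta v -> Rbar_interval alpha beta w -> v <= w ->
     Aminus <= swept_area (fun u => gamma u 0) v w <= Aplus) ->
  forall v w t : R,
    Rbar_interval alpha beta v -> Rbar_interval alpha beta w -> v < w ->
    time_interval T t ->
    Aminus <= harnack (Rbar_interval alpha beta) gamma v w t <= Aplus.
Proof.
  intros Hab HT0 Hcsf Hsm Harea v w t Hv Hw Hvw Ht.
  assert (H0 : forall v w, harnack (Rbar_interval alpha beta) gamma v w 0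
                 = swept_area (fun u => gamma u 0) v w) by (intros; unfold harnack; ring).
  destruct (Req_dec t 0) as [->|Hne]; [rewrite H0; apply Harea; auto; lra|].
  assert (Ht1 : 0 < t) by (destruct Ht; lra).
  assert (HtT : Rbar_lt t T) by exact (proj2 Ht).
  set (x := coord_x gamma); set (y := coord_y gamma).
  assert (Hpf : planar_flow alpha beta T x y)
    by exact (csf_planar_flow alpha beta T gamma (proj1 Hcsf) Hsm).
  assert (Hprop : proper_flow alpha beta t x y)
    by exact (ups_proper_flow alpha beta T gamma t Hab (proj1 Hcsf) (Rlt_le _ _ Ht1) HtT).
  destruct (potential_growth alpha beta T gamma t Hab Hcsf Hpf Hprop Ht1 HtT)
    as (u0 & C & Hu0 & HC & Hgrow).
  fold x y in Hgrow.
  assert (HTs : forall s, 0 <= s <= t -> time_interval T s)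
    by (intros s; exact (time_interval_le T t s HtT)).
  assert (Hsign : Aminus <= 0 <= Aplus).
  { generalize (Harea v v Hv Hv (Rle_refl v)); unfold swept_area.
    rewrite RInt_point; unfold zero; simpl; lra. }
  (* [sigma = 1] gives the upper bound and [sigma = -1] the lower one *)
  assert (Hmax : forall sigma M, sigma ^ 2 = 1 -> 0 <= M ->
    (forall v w : R, Rbar_interval alpha beta v -> Rbar_interval alpha beta w -> v <= w ->
       sigma * swept_area (fun u => gamma u 0) v w <= M) ->
    sigma * harnack (Rbar_interval alpha beta) gamma v w t <= M).
  { intros sigma M Hsig HM Hinit.
    assert (Hdiff : forall v w s, Rbar_interval alpha beta v -> Rbar_interval alpha beta w ->
       v <= w -> 0 <= s <= t ->
       sigma * clamp (harnack_potential x y u0) w s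
         - (sigma * clamp (harnack_potential x y u0) v s)
       = sigma * harnack (Rbar_interval alpha beta) gamma v w s).
    { intros v' w' s Hv' Hw' Hvw' Hs; rewrite !clamp_id by lra.
      rewrite <- (potential_difference alpha beta T gamma u0 v' w' s Hpf Hab (HTs s Hs)
         Hu0 Hv' Hw' Hvw'); fold x y; ring. }
    rewrite <- Hdiff by (auto; lra).
    apply (two_point_maximum_principle alpha beta t C M
       (fun u s => sigma * clamp (harnack_potential x y u0) u s)
       (clamp (fun u s => x u s ^ 2 + y u s ^ 2))
       (fun s => sigma * - harnack_flux x y u0 s)); auto; try lra.
    - intros u s Hu Hs.
      assert (HD : flow_domain alpha beta T (u, s)) by (split; [exact Hu | exact (HTs s Hs)]).
      split.
      + exact (continuous_scal_r (V := R_NormedModule) sigma _ _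
          (potential_continuous u0 u s Hpf Hu0 HD)).
      + exact (continuous_sq_sum _ _ _
          (continuous_clamp alpha beta T x u s (pf_smooth_x _ _ _ _ _ Hpf) HD)
          (continuous_clamp alpha beta T y u s (pf_smooth_y _ _ _ _ _ Hpf) HD)).
    - intros u s Hu Hs.
      assert (HD : open_flow_domain alpha beta T (u, s)).
      { split; [exact Hu|]; split; [apply HTs|]; simpl; lra. }
      destruct (planar_flow_evolves alpha beta T x y u s Hpf HD)
        as (a & b & Ha & HaS & Ex & Ey & _ & _ & EN).
      exists a, b; split; [exact Ha|]; split.
      + apply evolves_scal, evolves_ext_loc with (1 := clamp_locally _ u s (proj1 Hs)).
        exact (potential_evolves u0 u s a b Hpf Hu0 HD HaS Ex Ey).
      + exact (evolves_ext_loc _ _ _ _ _ _ _ (clamp_locally _ u s (proj1 Hs)) EN).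
    - intros B; destruct (Hprop B) as (uL & uR & HuL & HuR & Hfar).
      exists uL, uR; split; [exact HuL|]; split; [exact HuR|].
      intros u s Hu Hs Hout; rewrite clamp_id by lra; now apply Hfar.
    - intros u s Hu Hs; rewrite !clamp_id by lra; split.
      + generalize (pow2_ge_0 (x u s)), (pow2_ge_0 (y u s)); lra.
      + generalize (Hgrow u s Hu Hs).
        replace ((sigma * harnack_potential x y u0 u s) ^ 2)
          with (sigma ^ 2 * harnack_potential x y u0 u s ^ 2) by ring.
        rewrite Hsig; lra.
    - intros v' w' Hv' Hw' Hvw'; rewrite Hdiff by (auto; lra).
      rewrite H0; auto. }
  split.
  - assert (H := Hmax (-1) (- Aminus) ltac:(ring) ltac:(lra)).
    cut (-1 * harnack (Rbar_interval alpha beta) gamma v w t <= - Aminus); [lra|].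
    apply H; intros v' w' Hv' Hw' Hvw'; generalize (Harea v' w' Hv' Hw' Hvw'); lra.
  - cut (1 * harnack (Rbar_interval alpha beta) gamma v w t <= Aplus); [lra|].
    apply Hmax; [ring | lra|].
    intros v' w' Hv' Hw' Hvw'; generalize (Harea v' w' Hv' Hw' Hvw'); lra.
Qed.
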